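(* Let $N\ge 2$, $s\in(0,1)$, let $\Omega\subset\mathbb{R}^N$ be a smooth bounded domain and let $q>\frac{N}{2s}$. Let $g_0,V_0\in L^q(\Omega)$ satisfy $g_0^+\not\equiv 0$ and $\|V_0^-\|_q\le \frac{\frac{C_{N,s}}{2}-\delta}{C^2}$ for some $\delta\in\left(0,\frac{C_{N,s}}{2}\right)$. Then there exist $\underline{g}\in\mathcal{E}(g_0)$ and $\underline{V}\in\mathcal{E}(V_0)$ such that $$\lambda_1(\underline{g},\underline{V})=\lambda_1^{\min}(g_0,V_0):=\inf\{\lambda_1(g,V): g\in\mathcal{E}(g_0),\ V\in\mathcal{E}(V_0)\}.$$ That is, the minimum of $\lambda_1$ over $\mathcal{E}(g_0)\times\mathcal{E}(V_0)$ is attained.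
   Context: $C_{N,s}>0$ is the normalization constant of the fractional Laplacian $(-\Delta)^s u(x)=C_{N,s}\,\mathrm{P.V.}\int_{\mathbb{R}^N}\frac{u(x)-u(y)}{|x-y|^{N+2s}}\,dy$, i.e. $C_{N,s}=\left(\int_{\mathbb{R}^N}\frac{1-\cos\zeta_1}{|\zeta|^{N+2s}}d\zeta\right)^{-1}$. $[u]_s=\left(\int_{\mathbb{R}^N}\int_{\mathbb{R}^N}\frac{|u(x)-u(y)|^2}{|x-y|^{N+2s}}\,dx\,dy\right)^{1/2}$; $H^s(\mathbb{R}^N)=\{u\in L^2(\mathbb{R}^N):[u]_s<\infty\}$; $H_0^s(\Omega)=\{u\in H^s(\mathbb{R}^N): u=0 \text{ in } \mathbb{R}^N\setminus\Omega\}$. With $q'=\frac{q}{q-1}$, $C$ is the best constant of the embedding $H_0^s(\Omega)\hookrightarrow L^{2q'}(\Omega)$, i.e. the smallest constant with $\|u\|_{L^{2q'}(\Omega)}\le C[u]_s$ for all $u\in H^s_0(\Omega)$. Also $h^+=\max\{h,0\}$, $h^-=\max\{-h,0\}$, and $\|\cdot\|_q$ is the $L^q(\Omega)$ norm. For weights $g,V$, $$\lambda_1(g,V)=\inf\left\{\frac{\frac{C_{N,s}}{2}[u]_s^2+\int_\Omega V|u|^2dx}{\int_\Omega g|u|^2dx}: u\in H_0^s(\Omega),\ \int_\Omega g|u|^2dx>0\right\}.$$ For a measurable $\phi:\Omega\to\mathbb{R}$, the rearrangement class $\mathcal{E}(\phi)$ is the set of all measurable $\psi:\Omega\to\mathbb{R}$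 with $|\{x\in\Omega:\psi(x)>t\}|=|\{x\in\Omega:\phi(x)>t\}|$ for all $t\in\mathbb{R}$, where $|\cdot|$ is Lebesgue measure. *)

(* Defs.v *)
From HB Require Import structures.
From mathcomp Require Import all_boot all_order all_algebra.
From mathcomp Require Import all_classical all_reals all_analysis.

Set Implicit Arguments.
Unset Strict Implicit.
Unset Printing Implicit Defensive.
Import Order.TTheory GRing.Theory Num.Theory.
Import numFieldNormedType.Exports.
Local Open Scope classical_set_scope.
Local Open Scope ring_scope.

Definition tuple_cons (R : realType) (n : nat) (p : R * n.-tuple R) :
  n.+1.-tuple R := [tuple of p.1 :: p.2].

Lemma measurable_tuple_cons (R : realType) (n : nat) :
  measurable_fun setT (@tuple_cons R n).
Proof. by apply: measurable_cons. Qed.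

Section product_step.
Context (R : realType) (n : nat).
Variable mu : {sigma_finite_measure set (n.-tuple R) -> \bar R}.

Definition product_step : set (n.+1.-tuple R) -> \bar R :=
  pushforward (@lebesgue_measure R \x mu)%E (@tuple_cons R n).

Let step := @measure_function_pushforward__canonical__measure_function_Measure
  _ _ _ _ R (@lebesgue_measure R \x mu)%E (@tuple_cons R n)
  (@measurable_tuple_cons R n).

Let product_step0 : product_step set0 = 0%E.
Proof. exact: (measure0 step). Qed.

Let product_step_ge0 A : (0 <= product_step A)%E.
Proof. exact: (measure_ge0 step). Qed.

Let product_step_semi_sigma_additive : semi_sigma_additive product_step.
Proof. exact: (@measure_semi_sigma_additive _ _ _ step). Qed.

HB.instance Definition _ := isMeasure.Build _ _ _ product_step
  product_step0 product_step_ge0 product_step_semi_sigma_additive.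

Let product_step_sigma_finite : sigma_finite setT product_step.
Proof.
have /sigma_finiteP[F [TF ndF Foo]] := sigma_finiteT (@lebesgue_measure R).
have /sigma_finiteP[G [TG ndG Goo]] := sigma_finiteT mu.
pose g (t : n.+1.-tuple R) : R * n.-tuple R := (thead t, [tuple of behead t]).
have mg : measurable_fun setT g.
  by apply: measurable_fun_pair; [exact: measurable_tnth|exact: measurable_behead].
have gK : cancel (@tuple_cons R n) g.
  by case=> x t; rewrite /g /tuple_cons; congr pair; apply: val_inj.
exists (fun k => g @^-1` (F k `*` G k)).
  rewrite -preimage_bigcup (_ : \bigcup_k _ = setT) ?preimage_setT//.
  rewrite -setXTT TF TG predeqE => -[x y]; split.
    by move=> [k _ []/= ? ?]; split; exists k.
  move=> [/= [k _ Fkx] [l _ Gly]]; exists (maxn k l) => //; split.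
  - by move: x Fkx; exact/subsetPset/ndF/leq_maxl.
  - by move: y Gly; exact/subsetPset/ndG/leq_maxr.
move=> k; have [mF Fk] := Foo k; have [mG Gk] := Goo k; split.
  by rewrite -[X in measurable X]setTI; apply: mg => //; exact: measurableX.
rewrite /product_step /pushforward -comp_preimage (_ : g \o _ = id).
  by rewrite preimage_id product_measure1E// lte_mul_pinfty// ge0_fin_numE.
exact/funext.
Qed.

HB.instance Definition _ := Measure_isSigmaFinite.Build _ _ _ product_step
  product_step_sigma_finite.

End product_step.

(* n-fold product of the one-dimensional Lebesgue measure, on the product
   (= Borel) sigma-algebra of n.-tuple R *)
Fixpoint borel_lebesgue (R : realType) (n : nat) :
    {sigma_finite_measure set (n.-tuple R) -> \bar R} :=
  match n with
  | 0 => \d_([tuple] : 0.-tuple R)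
  | m.+1 => product_step (borel_lebesgue R m)
  end.

(* Lebesgue measure on row vectors: the outer measure generated by
   borel_lebesgue, restricted to its Caratheodory sigma-algebra. Hence
   "measurable" below means Lebesgue measurable. *)
Definition lebesgue_outer (R : realType) (n : nat) (A : set 'rV[R]_n) : \bar R :=
  ((borel_lebesgue R n)^*)%mu
    [set t : n.-tuple R | A (\row_(i < n) tnth t i)].

Section lebesgue_outer_measure.
Context (R : realType) (n : nat).

Let lebesgue_outer0 : @lebesgue_outer R n set0 = 0%E.
Proof. exact: outer_measure0. Qed.

Let lebesgue_outer_ge0 A : (0 <= @lebesgue_outer R n A)%E.
Proof. exact: outer_measure_ge0. Qed.

Let le_lebesgue_outer :
  {homo @lebesgue_outer R n : A B / A `<=` B >-> (A <= B)%E}.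
Proof. by move=> A B AB; apply: le_outer_measure => t /=; exact: AB. Qed.

Let lebesgue_outer_sigma_subadditive : sigma_subadditive (@lebesgue_outer R n).
Proof.
move=> F; exact: (outer_measure_sigma_subadditive (borel_lebesgue R n)^*%mu
  (fun k => [set t : n.-tuple R | F k (\row_(i < n) tnth t i)])).
Qed.

HB.instance Definition _ := isOuterMeasure.Build R 'rV[R]_n
  (@lebesgue_outer R n) lebesgue_outer0 lebesgue_outer_ge0
  le_lebesgue_outer lebesgue_outer_sigma_subadditive.

HB.instance Definition _ := @isMeasurable.Build
  (caratheodory_display (@lebesgue_outer R n)) 'rV[R]_n
  (@lebesgue_outer R n).-caratheodory
  (caratheodory_measurable_set0 (@lebesgue_outer R n))
  (@caratheodory_measurable_setC _ _ (@lebesgue_outer R n))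
  (@caratheodory_measurable_bigcup _ _ (@lebesgue_outer R n)).

Definition lebesgue_rV : set 'rV[R]_n -> \bar R := @lebesgue_outer R n.

Let lebesgue_rV_sigma_additive : semi_sigma_additive lebesgue_rV.
Proof. exact: caratheodory_measure_sigma_additive. Qed.

HB.instance Definition _ := isMeasure.Build _ 'rV[R]_n R lebesgue_rV
  lebesgue_outer0 lebesgue_outer_ge0 lebesgue_rV_sigma_additive.

End lebesgue_outer_measure.
Arguments lebesgue_rV {R n}.

Section domains.
Context {R : realType}.

Definition partial n (f : 'rV[R]_n -> R) (i : 'I_n) : 'rV[R]_n -> R :=
  'D_(delta_mx 0 i) f.

Definition smooth n (f : 'rV[R]_n -> R) : Prop :=
  forall s : seq 'I_n, let h := foldl (@partial n) f s in
  continuous h /\ forall i x, derivable h x (delta_mx 0 i).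

(* Near each boundary point, Omega lies strictly on one side of the graph of a
   smooth function of N - 1 variables, after relabelling (i) and reorienting
   (b) the coordinate axes. For i : 'I_N, col' i x drops the i-th coordinate. *)
Definition smooth_boundary N (Omega : set 'rV[R]_N) : Prop :=
  forall x0, (closure Omega `\` interior Omega) x0 ->
  exists (i : 'I_N) (b : bool) (gamma : 'rV[R]_N.-1 -> R),
    smooth gamma /\
    \forall x \near x0, Omega x <-> gamma (col' i x) < (-1) ^+ b * x 0 i.

Definition smooth_bounded_domain N (Omega : set 'rV[R]_N) : Prop :=
  [/\ Omega !=set0, open Omega, connected Omega, bounded_set Omega &
      smooth_boundary Omega].

End domains.

Section fractional_sobolev.
Context {R : realType} {N : nat}.
Notation mu := (@lebesgue_rV R N).
Implicit Types (s p : R) (u g V phi : 'rV[R]_N -> R) (Omega : set 'rV[R]_N).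

(* matrices carry the sup norm in the library *)
Definition euclidean_norm (x : 'rV[R]_N) : R :=
  Num.sqrt (\sum_(i < N) x 0 i ^+ 2).

(* zeta_1; the default 0 is only reached when N = 0 *)
Definition first_coord (z : 'rV[R]_N) : R :=
  if insub 0%N is Some i then z 0 i else 0.

Definition frac_laplacian_cst s : R :=
  (\int[mu]_z ((1 - cos (first_coord z)) /
               euclidean_norm z `^ (N%:R + 2 * s)))^-1.

Definition gagliardo s u : \bar R :=
  ((\int[mu]_y \int[mu]_x
     (`|u x - u y| ^+ 2 / euclidean_norm (x - y) `^ (N%:R + 2 * s))%:E)
    `^ 2^-1)%E.

Definition Hs s : set ('rV[R]_N -> R) :=
  [set u | u \in Lfun mu 2%:E /\ (gagliardo s u < +oo)%E].

Definition H0s s Omega : set ('rV[R]_N -> R) :=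
  [set u | Hs s u /\ {ae mu, forall x, ~ Omega x -> u x = 0}].

Definition LpOn Omega p : set ('rV[R]_N -> R) :=
  [set f | f \_ Omega \in Lfun mu p%:E].

Definition normOn Omega p (f : 'rV[R]_N -> R) : \bar R :=
  'N[mu]_p%:E [EFin \o f \_ Omega].

(* best constant of the embedding H0s Omega -> L^p(Omega) *)
Definition embedding_cst s Omega p : R :=
  inf [set C : R | forall u, H0s s Omega u ->
                   (normOn Omega p u <= C%:E * gagliardo s u)%E].

Definition lambda1 s Omega g V : \bar R :=
  ereal_inf
    [set ((frac_laplacian_cst s / 2 * fine (gagliardo s u) ^+ 2
           + \int[mu]_(x in Omega) (V x * `|u x| ^+ 2))
          / \int[mu]_(x in Omega) (g x * `|u x| ^+ 2))%:E
    | u in [set u | H0s s Omega u /\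
                    0 < \int[mu]_(x in Omega) (g x * `|u x| ^+ 2)]].

(* Functions on Omega are represented by functions on the whole space whose
   values outside Omega are irrelevant. *)
Definition rearrangements Omega phi : set ('rV[R]_N -> R) :=
  [set psi | measurable_fun Omega psi /\
             forall t : R, mu (Omega `&` [set x | t < psi x]) =
                           mu (Omega `&` [set x | t < phi x])].

Definition lambda1_min s Omega g0 V0 : \bar R :=
  ereal_inf [set lambda1 s Omega gV.1 gV.2
            | gV in rearrangements Omega g0 `*` rearrangements Omega V0].

End fractional_sobolev.
Arguments frac_laplacian_cst {R} N s.

(* Main.v *)
Require Import Defs.
From HB Require Import structures.
From mathcomp Require Import all_boot all_order all_algebra.
From mathcomp Require Import all_classical all_reals all_analysis.
From mathcomp Require Import measurable_realfun.
From mathcomp Require Import ring lra.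

Set Implicit Arguments.
Unset Strict Implicit.
Unset Printing Implicit Defensive.
Import Order.TTheory GRing.Theory Num.Theory.
Import numFieldNormedType.Exports.
Local Open Scope classical_set_scope.
Local Open Scope ring_scope.

(** For a function u vanishing outside Omega write E(u) for its squared
    Gagliardo seminorm ([energy]), c for C_{N,s}, and I_h(u) for the integral
    of h u^2 over Omega. The ratio to minimize over g, V and u is (c/2 E(u) + I_V(u)) / I_g(u),
    and the proof is the direct method.

    Let (g_n, V_n, u_n) be a minimizing sequence, scaled so that
    I_{g_n}(u_n) = 1. Rearrangements have the same norm of the negative part,
    so Hoelder's inequality, the embedding constant and the bound on V0^- give
    delta E(u) <= c/2 E(u) + I_V(u) for every V in the class of V0
    ([coercive]); hence the energies E(u_n) are bounded. The weights need not
    converge in any useful sense, but they stay in one ball of L^q, and on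
    such a ball the forms I_h are compact uniformly in h
    ([forms_compactness]): along a subsequence there is a v with
    E(v) <= liminf E(u_n) and I_h(u_n) - I_h(v) -> 0 uniformly in h.
    Therefore I_{g_n}(v) -> 1, and c/2 E(v) + limsup I_{V_n}(v) is at most
    the infimum. For this fixed v the bathtub principle ([bathtub]) provides
    a rearrangement g of g0 maximizing I_g(v) and a rearrangement V of V0
    minimizing I_V(v). Replacing g_n and V_n by them only helps:
    I_g(v) >= 1 and the numerator is at most the infimum, so that (g, V, v)
    attains it. If the infimum is +oo, every pair attains it.

    Uniform compactness rests on dyadic cubes. On a cube Q of side h one
    sampled value u(y) approximates u in mean square with error h^(2s) times
    the energy on Q x Q ([mean_square_sample]), because the kernel is at least
    h^-(N+2s) there up to a constant. The resulting step functions v_k of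
    level k satisfy |u - v_k|_2^2 <= C 2^(-2sk) E(u). A weight w >= 0 with
    |w|_q <= W has mass at most W h^(-N/q) |Q| on Q, and v_{k+1} - v_k is
    constant on the cubes of level k+1, so the integral of
    w (v_{k+1} - v_k)^2 is at most C W 2^(-(2s - N/q)k) E(u). These bounds
    are summable precisely because q > N/(2s) ([weighted_tail_le]), and they
    reduce the compactness to that of the finitely many values of v_k, which
    are bounded because u vanishes on a set of positive measure of the large
    cube ([coefficient_le]).

    In the bathtub principle the difficulty is that v^2 may be constant on
    sets of positive measure. The ties are broken by a coordinate function,
    whose level sets are null: the upper sets of the lexicographic order of
    (v^2, x_i) are nested and have every measure between 0 and |Omega|
    ([lex_upper_exists]), so a rearrangement of g0 can be built that has them
    as superlevel sets ([comonotone_rearrangement_exists]); the layer-cake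
    formula concludes. *)

(** * Rearrangements and the bathtub principle *)

Section equimeasurable.
Context d (T : measurableType d) (R : realType).
Variable mu : {measure set T -> \bar R}.
Implicit Types (D : set T) (f g : T -> R).

(** For the Lebesgue measure this is membership in the class of rearrangements. *)
Definition equimeasurable D f g := measurable_fun D g /\
  forall t : R, mu (D `&` [set x | t < g x]) = mu (D `&` [set x | t < f x]).

Lemma ge0_integral_mrestr D (mD : measurable D) (h : T -> \bar R) :
  measurable_fun setT h -> (forall x, 0 <= h x)%E ->
  (\int[mrestr mu mD]_x h x = \int[mu]_(x in D) h x)%E.
Proof.
move=> mh h0; rewrite (@ge0_negligible_integral _ _ _ _ setT (~` D))//; first last.
- by rewrite /= /mrestr setICl measure0.
- exact: measurableC.
rewrite setTD setCK; apply: eq_measure_integral => A mA AD /=.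
by rewrite /mrestr setIidl.
Qed.

(** The image measures of [mu] restricted to [D] under [f] and [g] agree on the
    half-lines, which generate the Borel sets of R and are stable under
    intersection; hence they are equal. *)
Lemma equimeasurable_integral D f g (h : R -> \bar R) :
  measurable D -> (mu D < +oo)%E -> measurable_fun D f ->
  equimeasurable D f g -> measurable_fun setT h -> (forall r, 0 <= h r)%E ->
  (\int[mu]_(x in D) h (g x) = \int[mu]_(x in D) h (f x))%E.
Proof.
move=> mD Doo mf [mg fg] mh h0.
have toT (k : T -> R) : (\int[mu]_(x in D) h (k x) =
    \int[mu]_(x in D) h ((k \_ D) x))%E.
  by apply: eq_integral => x xD; rewrite patchE xD.
have law (k : T -> R) : measurable_fun D k ->
    (\int[mu]_(x in D) h (k x) =
     \int[pushforward (mrestr mu mD) (k \_ D)]_r h r)%E.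
  move=> mk; have mkD : measurable_fun setT (k \_ D) by apply/(measurable_restrictT k mD).
  rewrite toT [RHS](@ge0_integral_pushforward _ _ _ _ _ _ mkD)//.
  rewrite preimage_setT -(@ge0_integral_mrestr D mD (h \o (k \_ D)))//.
    exact: measurableT_comp.
  by move=> x; exact: h0.
rewrite law// [RHS]law//.
have mfD : measurable_fun setT (f \_ D) by apply/(measurable_restrictT f mD).
have mgD : measurable_fun setT (g \_ D) by apply/(measurable_restrictT g mD).
apply: eq_measure_integral => A mA _.
apply: (measure_unique (RGenOInfty.G (R:=R))
  (fun n => `]- n%:R, +oo[%classic)) => //.
- exact: RGenOInfty.measurableE.
- move=> _ _ [x ->] [y ->]; exists (Num.max x y).
  by apply/seteqP; split => z /=; rewrite !in_itv/= !andbT gt_max => /andP.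
- by move=> i; exists (- i%:R).
- rewrite -subTset => x _; exists (Num.bound `|x|) => //=.
  rewrite in_itv/= andbT ltrNl (le_lt_trans (ler_norm _))// normrN.
  exact: archi_boundP (normr_ge0 x).
- move=> _ [t ->] /=; rewrite /pushforward /mrestr.
  have E (k : T -> R) : k \_ D @^-1` `]t, +oo[ `&` D = D `&` [set x | t < k x].
    apply/seteqP; split => x /=.
      by rewrite in_itv/= andbT patchE => -[] /[swap] Dx; rewrite mem_set.
    by move=> [Dx]; rewrite in_itv/= andbT patchE mem_set.
  by rewrite !E fg.
- move=> k; rewrite /= /pushforward /mrestr; apply: le_lt_trans Doo.
  apply: le_measure; rewrite ?inE//; apply: measurableI => //.
  by rewrite -[X in measurable X]setTI; exact: mgD.
Qed.

End equimeasurable.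

Section level_sets.
Context d (T : measurableType d) (R : realType).
Variable mu : {measure set T -> \bar R}.
Implicit Types (D S : set T) (f g p : T -> R) (a : \bar R).

Lemma measure_bigcup_le (F : (set T)^nat) a : (forall n, measurable (F n)) ->
  {homo F : n m / (n <= m)%N >-> (n <= m)%O} -> (forall n, mu (F n) <= a)%E ->
  (mu (\bigcup_n F n) <= a)%E.
Proof.
move=> mF ndF Fa.
have cF := @nondecreasing_cvg_mu _ _ _ mu F mF (bigcupT_measurable _ mF) ndF.
rewrite -(cvg_lim _ cF)//; apply: lime_le; first by apply/cvg_ex; eexists; exact: cF.
by apply: nearW.
Qed.

Lemma measure_bigcap_ge (F : (set T)^nat) a : (forall n, measurable (F n)) ->
  {homo F : n m / (n <= m)%N >-> (m <= n)%O} -> (mu (F 0%N) < +oo)%E ->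
  (forall n, a <= mu (F n))%E -> (a <= mu (\bigcap_n F n))%E.
Proof.
move=> mF niF F0 Fa.
have cF := @nonincreasing_cvg_mu _ _ _ mu F F0 mF (bigcapT_measurable mF) niF.
rewrite -(cvg_lim _ cF)//; apply: lime_ge; first by apply/cvg_ex; eexists; exact: cF.
by apply: nearW.
Qed.

Lemma measurable_gtr D f t : measurable D -> measurable_fun D f ->
  measurable (D `&` [set x | t < f x]).
Proof.
move=> mD mf; have := mf mD _ (measurable_itv `]t, +oo[).
by congr measurable; apply/seteqP; split => x /=; rewrite in_itv/= andbT.
Qed.

Lemma measurable_ger D f t : measurable D -> measurable_fun D f ->
  measurable (D `&` [set x | t <= f x]).
Proof.
move=> mD mf; have := mf mD _ (measurable_itv `[t, +oo[).
by congr measurable; apply/seteqP; split => x /=; rewrite in_itv/= andbT.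
Qed.

Lemma superlevel_antitone D f s t : s <= t ->
  D `&` [set x | t < f x] `<=` D `&` [set x | s < f x].
Proof. by move=> st x [Dx /=] tf; split => //=; exact: le_lt_trans tf. Qed.

Lemma superlevel_bigcup D f t :
  D `&` [set x | t < f x] = \bigcup_n (D `&` [set x | t + n.+1%:R^-1 < f x]).
Proof.
apply/seteqP; split => x /=.
  move=> [Dx tf]; exists (Num.truncn (f x - t)^-1) => //; split => //=.
  have d0 : 0 < f x - t by rewrite subr_gt0.
  rewrite -ltrBrDl -[ltRHS]invrK ltf_pV2 ?posrE ?invr_gt0//.
  by rewrite truncnS_gt.
by move=> [n _ [Dx /= h]]; split => //; apply: lt_trans h; rewrite ltrDl.
Qed.

(** The level is the supremum of the [t] with [a < mu {t < f}]; both bounds then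
    follow from continuity of the measure along monotone sequences of levels. *)
Lemma level_exists D f a : measurable D -> (mu D < +oo)%E -> measurable_fun D f ->
  (0 < a < mu D)%E -> exists t : R,
  (mu (D `&` [set x | (t < f x)%R]) <= a <= mu (D `&` [set x | (t <= f x)%R]))%E.
Proof.
move=> mD Doo mf /andP[a0 aD].
have mG t := measurable_gtr t mD mf.
have Goo t : (mu (D `&` [set x | (t < f x)%R]) < +oo)%E.
  by apply: le_lt_trans Doo; apply: le_measure; rewrite ?inE.
pose S := [set t : R | (a < mu (D `&` [set x | (t < f x)%R]))%E].
have S0 : S !=set0.
  apply: contrapT => nS; move: aD; apply/negP; rewrite -leNgt.
  have -> : D = \bigcup_n (D `&` [set x | - n%:R < f x]).
    apply/seteqP; split => x; last by case=> n _ [].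
    move=> Dx; exists (Num.bound `|f x|) => //; split => //=.
    rewrite ltrNl (le_lt_trans (ler_norm _))// normrN.
    exact: archi_boundP (normr_ge0 _).
  apply: measure_bigcup_le => // [n m nm|n].
    by apply/subsetPset; apply: superlevel_antitone; rewrite lerN2 ler_nat.
  by rewrite leNgt; apply/negP => h; apply: nS; exists (- n%:R).
have hS : has_ubound S.
  apply: contrapT => nS; move: a0; apply/negP; rewrite -leNgt.
  rewrite -(@measure0 _ _ _ mu).
  have -> : set0 = \bigcap_n (D `&` [set x | n%:R < f x]).
    apply/seteqP; split => // x /(_ (Num.bound `|f x|) I)[_ /=].
    rewrite ltNge => /negP; apply; apply: le_trans (ler_norm _) _.
    exact/ltW/archi_boundP/normr_ge0.
  apply: measure_bigcap_ge => // [n m nm|n].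
    by apply/subsetPset; apply: superlevel_antitone; rewrite ler_nat.
  rewrite leNgt; apply/negP => h; apply: nS; exists n%:R => t St.
  rewrite leNgt; apply/negP => nt; move: St; rewrite /S/=; apply/negP; rewrite -leNgt.
  apply: le_trans (ltW h); apply: le_measure; rewrite ?inE//.
  exact/superlevel_antitone/ltW.
exists (sup S); apply/andP; split.
  rewrite superlevel_bigcup; apply: measure_bigcup_le => // [n m nm|n].
    apply/subsetPset; apply: superlevel_antitone; rewrite lerD2l.
    by rewrite lef_pV2 ?posrE// ler_nat.
  rewrite leNgt; apply/negP => h.
  have : sup S + n.+1%:R^-1 <= sup S by apply: ub_le_sup.
  by rewrite -subr_ge0 opprD addrA subrr sub0r oppr_ge0 leNgt invr_gt0 ltr0n.
have -> : D `&` [set x | sup S <= f x] =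
    \bigcap_n (D `&` [set x | sup S - n.+1%:R^-1 < f x]).
  apply/seteqP; split => x /=.
    by move=> [Dx Sf] n _; split => //=; apply: lt_le_trans Sf; rewrite ltrBlDr ltrDl.
  move=> h; split; first by have [] := h 0%N I.
  rewrite leNgt; apply/negP => fS.
  have : (D `&` [set x | sup S - f x <= 0]) x.
    split; first by have [] := h 0%N I.
    rewrite /= leNgt; apply/negP => d0.
    have [_ /=] := h (Num.truncn (sup S - f x)^-1) I.
    rewrite ltrBlDr -ltrBlDl ltNge => /negP; apply.
    rewrite -[leRHS]invrK lef_pV2 ?posrE ?invr_gt0//.
    by rewrite ltW// truncnS_gt.
  by move=> [_ /=]; rewrite leNgt subr_gt0 fS.
apply: measure_bigcap_ge => // [n m nm|n].
  apply/subsetPset; apply: superlevel_antitone; rewrite lerD2l lerN2.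
  by rewrite lef_pV2 ?posrE// ler_nat.
have : sup S - n.+1%:R^-1 < sup S by rewrite ltrBlDr ltrDl.
move=> /(sup_gt S0)[t St /ltW lt]; apply: le_trans (ltW St) _.
by apply: le_measure; rewrite ?inE//; exact: superlevel_antitone.
Qed.

(** Upper sets of the lexicographic preorder of [(f, p)] on [D]. The second
    function refines the superlevel sets of [f] inside its plateaus. *)
Definition lex_upper D f p S := S `<=` D /\ forall x y, S x -> D y ->
  f x < f y \/ (f x = f y /\ p x <= p y) -> S y.

(** The preorder is total, so that its upper sets form a chain. *)
Lemma lex_upper_nested D f p S S' : lex_upper D f p S -> lex_upper D f p S' ->
  S `<=` S' \/ S' `<=` S.
Proof.
move=> [SD uS] [S'D uS']; have [|nS] := pselect (S `<=` S'); first by left.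
right=> y S'y; apply: contrapT => nSy; apply: nS => x Sx.
have [fxy|fxy|fxy] := ltgtP (f x) (f y).
- by exfalso; apply: nSy; apply: uS (Sx) (S'D _ S'y) _; left.
- by apply: uS' (S'y) (SD _ Sx) _; left.
- have [pxy|/ltW pyx] := leP (p x) (p y).
    by exfalso; apply: nSy; apply: uS (Sx) (S'D _ S'y) _; right.
  by apply: uS' (S'y) (SD _ Sx) _; right; split.
Qed.

Lemma lex_upper_superlevel D f p t : lex_upper D f p (D `&` [set x | t < f x]).
Proof.
split=> [x []//|x y [Dx /= tf] Dy h]; split => //=; apply: lt_le_trans tf _.
by case: h => [/ltW//|[->]].
Qed.

(** A level [t] of [f] brackets the measure [a]; the missing part is then cut out
    of the plateau [f = t] by a level of [p], exactly because the level sets of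
    [p] are null. *)
Lemma lex_upper_exists D f p a : measurable D -> (mu D < +oo)%E ->
  measurable_fun D f -> measurable_fun D p ->
  (forall c, mu (D `&` [set x | p x = c]) = 0)%E -> (0 <= a <= mu D)%E ->
  exists S, [/\ measurable S, lex_upper D f p S & mu S = a].
Proof.
move=> mD Doo mf mp p0 /andP[].
rewrite le_eqVlt => /predU1P[<- _|a0].
  by exists set0; rewrite measure0; split=> //; split=> // x y [].
rewrite le_eqVlt => /predU1P[->|aD].
  by exists D; split=> //; split=> // x y.
have [t /andP[ta at_]] := level_exists mD Doo mf (introT andP (conj a0 aD)).
set S0 := D `&` [set x | t < f x] in ta; set S1 := D `&` [set x | t <= f x] in at_.
have mS0 : measurable S0 by exact: measurable_gtr.
have mS1 : measurable S1 by exact: measurable_ger.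
(* the plateau [f = t] *)
pose A := S1 `\` S0.
have mA : measurable A by exact: measurableD.
have AE x : A x -> D x /\ f x = t.
  move=> [[Dx /= tf] /not_andP[//|/=]]; split => //.
  by apply/eqP; rewrite eq_le tf andbT leNgt; apply/negP.
have AD : A `<=` D by move=> x /AE[].
have S01 : S0 `<=` S1 by move=> x [Dx /= /ltW].
have finA : (mu A < +oo)%E by apply: le_lt_trans Doo; apply: le_measure; rewrite ?inE.
have S1A : mu S1 = (mu S0 + mu A)%E.
  rewrite -measureU//; last by rewrite /A setDE setICA setICr setI0.
  by rewrite /A setDUK.
have finS0 : mu S0 \is a fin_num.
  rewrite ge0_fin_numE//; apply: le_lt_trans Doo; apply: le_measure; rewrite ?inE//.
  by move=> x [].
have fina : a \is a fin_num.
  by rewrite ge0_fin_numE ?(ltW a0)//; exact: lt_trans Doo.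
move: ta; rewrite le_eqVlt => /predU1P[<-|ta].
  by exists S0; split => //; exact: lex_upper_superlevel.
move: at_; rewrite le_eqVlt => /predU1P[->|at_].
  exists S1; split => //; split=> [x []//|x y [Dx /= tf] Dy h]; split => //=.
  by apply: le_trans tf _; case: h => [/ltW//|[->]].
have aA : (0 < a - mu S0 < mu A)%E.
  by rewrite sube_gt0 ta/= lteBlDl// -S1A.
have mpA : measurable_fun A p by exact: measurable_funS mp.
have [c /andP[ca ac]] := level_exists mA finA mpA aA.
have mB : measurable (A `&` [set x | c < p x]) by exact: measurable_gtr.
have mC : measurable (A `&` [set x | c <= p x]) by exact: measurable_ger.
have mE : measurable (D `&` [set x | p x = c]).
  have := mp mD [set c] (measurable_set1 c).
  by congr measurable; apply/seteqP; split.
have BE : mu (A `&` [set x | c < p x]) = (a - mu S0)%E.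
  apply/eqP; rewrite eq_le ca/=; apply: le_trans ac _.
  rewrite -[leRHS]adde0 -(p0 c); apply: le_trans (measureU2 _ _ _) => //.
  apply: le_measure; rewrite ?inE//; first exact: measurableU.
  move=> x [Ax /=]; rewrite le_eqVlt => /predU1P[->|cp]; last by left.
  by right; split => //; exact: AD.
exists (S0 `|` (A `&` [set x | c < p x])); split; first exact: measurableU.
  split; first by move=> x [[]//|[/AD]].
  move=> x y [S0x|[/AE[Dx fx] /= cp]] Dy h.
    by left; have [_] := @lex_upper_superlevel D f p t; apply; [exact: S0x|exact: Dy|].
  case: h => [fxy|[fxy pxy]]; first by left; split => //=; rewrite -fx.
  right; split; last exact: lt_le_trans pxy.
  by split; [split => //=; rewrite -fxy fx|case=> _ /=; rewrite -fxy fx ltxx].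
rewrite measureU//; last first.
  by rewrite setIA /A setDE [S0 `&` _]setICA setICr setI0 set0I.
by transitivity (mu S0 + (a - mu S0))%E; [congr adde|rewrite addeC subeK].
Qed.

End level_sets.

Section rearrangement.
Context d (T : measurableType d) (R : realType).
Variable mu : {measure set T -> \bar R}.
Implicit Types (D S E : set T) (f g p phi psi : T -> R).

Lemma measure_le_null E S N0 : measurable E -> measurable S -> measurable N0 ->
  mu N0 = 0%E -> E `<=` S `|` N0 -> (mu E <= mu S)%E.
Proof.
move=> mE mS mN N00 ES; rewrite -[leRHS]adde0 -N00.
apply: le_trans (measureU2 _ _ _) => //.
by apply: le_measure; rewrite ?inE//; exact: measurableU.
Qed.

(** To each level [t] one assigns the upper set whose measure is that of
    [phi > t], and [psi x] is the supremum of the levels whose upper set contains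
    [x]. Comonotonicity of [psi] with [(f, p)] is recorded in the only form used
    below: an upper set is, up to null sets, either trivial or separated from its
    complement by a level of [psi]. *)
Lemma comonotone_rearrangement_exists D f p phi :
  measurable D -> (mu D < +oo)%E ->
  measurable_fun D f -> measurable_fun D p -> measurable_fun D phi ->
  (forall c, mu (D `&` [set x | p x = c]) = 0)%E ->
  exists psi, equimeasurable mu D phi psi /\
    forall E, measurable E -> lex_upper D f p E ->
    [\/ mu (D `\` E) = 0%E, mu E = 0%E | exists t N0, [/\ measurable N0, mu N0 = 0%E,
      (forall x, E x -> ~ N0 x -> t <= psi x) &
      (forall x, D x -> ~ E x -> ~ N0 x -> psi x <= t)]].
Proof.
move=> mD Doo mf mp mphi p0.
pose a t := mu (D `&` [set x | (t < phi x)%R]).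
have mG t : measurable (D `&` [set x | t < phi x]) by exact: measurable_gtr.
have aD t : (0 <= a t <= mu D)%E.
  by rewrite measure_ge0 /a le_measure ?inE.
have a_le s t : s <= t -> (a t <= a s)%E.
  move=> st; apply: le_measure; rewrite ?inE//.
  exact: superlevel_antitone.
have /choice[S HS] : forall b : \bar R, exists S, (0 <= b <= mu D)%E ->
    [/\ measurable S, lex_upper D f p S & mu S = b].
  move=> b; have [h|h] := pselect (0 <= b <= mu D)%E; last by exists set0.
  by have [S HS] := lex_upper_exists mD Doo mf mp p0 h; exists S.
pose E t := S (a t).
have mE t : measurable (E t) by have [] := HS _ (aD t).
have uE t : lex_upper D f p (E t) by have [] := HS _ (aD t).
have muE t : mu (E t) = a t by have [] := HS _ (aD t).
have ED t : E t `<=` D by have [] := uE t.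
have Ele s t : s <= t -> E t `<=` E s.
  move=> st; have := a_le _ _ st; rewrite le_eqVlt => /predU1P[h|h].
    by rewrite /E h.
  have [//|h'] := lex_upper_nested (uE t) (uE s).
  move: h; rewrite -!muE ltNge le_measure ?inE//.
(* points lying in the upper sets of no level or of all levels *)
pose N0 := (D `\` \bigcup_n E (- n%:R)) `|` \bigcap_n (E n%:R).
have mN1 : measurable (D `\` \bigcup_n E (- n%:R)).
  by apply: measurableD => //; exact: bigcupT_measurable.
have mN2 : measurable (\bigcap_n (E n%:R)) by exact: bigcapT_measurable.
have mN : measurable N0 by exact: measurableU.
have N00 : mu N0 = 0%E.
  have h1 : mu (D `\` \bigcup_n E (- n%:R)) = 0%E.
    rewrite measureD//; last exact: bigcupT_measurable.
    rewrite setIidr; last by move=> x [n _ /ED].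
    apply/eqP; rewrite sube_eq//; last by rewrite ge0_fin_numE.
    rewrite add0e; apply/eqP/le_anti/andP; split; last first.
      apply: le_measure; rewrite ?inE//; first exact: bigcupT_measurable.
      by move=> x [n _ /ED].
    have {1}-> : D = \bigcup_n (D `&` [set x | - n%:R < phi x]).
      apply/seteqP; split => x; last by case=> n _ [].
      move=> Dx; exists (Num.bound `|phi x|) => //; split => //=.
      rewrite ltrNl (le_lt_trans (ler_norm _))// normrN.
      exact: archi_boundP (normr_ge0 _).
    apply: measure_bigcup_le => // [n m nm|n].
      by apply/subsetPset; apply: superlevel_antitone; rewrite lerN2 ler_nat.
    rewrite -/(a _) -muE; apply: le_measure; rewrite ?inE//.
      exact: bigcupT_measurable.
    by move=> x Ex; exists n.
  have h2 : mu (\bigcap_n (E n%:R)) = 0%E.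
    apply/eqP; rewrite eq_le measure_ge0 andbT -(@measure0 _ _ _ mu).
    have -> : set0 = \bigcap_n (D `&` [set x | n%:R < phi x]).
      apply/seteqP; split => // x /(_ (Num.bound `|phi x|) I)[_ /=].
      rewrite ltNge => /negP; apply; apply: le_trans (ler_norm _) _.
      exact/ltW/archi_boundP/normr_ge0.
    apply: measure_bigcap_ge => // [n m nm| |n].
    - by apply/subsetPset; apply: superlevel_antitone; rewrite ler_nat.
    - by apply: le_lt_trans Doo; apply: le_measure; rewrite ?inE.
    rewrite -/(a _) -muE; apply: le_measure; rewrite ?inE//.
    by move=> x /(_ n I).
  apply/eqP; rewrite eq_le measure_ge0 andbT.
  rewrite -[leRHS]h1; exact: (measure_le_null mN mN1 mN2 h2).
pose V x := [set t | E t x].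
have V0 x : D x -> ~ N0 x -> V x !=set0.
  move=> Dx nN; apply: contrapT => h; apply: nN; left; split => // -[n _ Ex].
  by apply: h; exists (- n%:R).
have Vub x : D x -> ~ N0 x -> has_ubound (V x).
  move=> Dx nN; apply: contrapT => h; apply: nN; right => n _.
  apply: contrapT => nE; apply: h; exists n%:R => t Vt; rewrite leNgt; apply/negP => nt.
  by apply: nE; apply: Ele Vt; exact: ltW.
pose psi x := if x \in N0 then 0 else sup (V x).
have psiE x : ~ N0 x -> psi x = sup (V x) by move=> nN; rewrite /psi memNset.
have psi_gt x t : D x -> ~ N0 x ->
    (t < psi x <-> exists n, E (t + n.+1%:R^-1) x).
  move=> Dx nN; rewrite psiE//; split.
    move=> /(sup_gt (V0 _ Dx nN))[r Vr tr]; exists (Num.truncn (r - t)^-1).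
    apply: Ele Vr; rewrite -lerBrDl -[leRHS]invrK lef_pV2 ?posrE ?invr_gt0 ?subr_gt0//.
    by rewrite ltW// truncnS_gt.
  move=> [n En]; apply: (@lt_le_trans _ _ (t + n.+1%:R^-1)); first by rewrite ltrDl.
  by apply: ub_le_sup => //; exact: Vub.
pose U t := \bigcup_n E (t + n.+1%:R^-1).
have mU t : measurable (U t) by exact: bigcupT_measurable.
have levelE t : D `&` [set x | t < psi x] =
    (U t `\` N0) `|` (if t < 0 then N0 else set0).
  have ND : N0 `<=` D by move=> x [[]//|/(_ 0%N I)/ED].
  apply/seteqP; split => x /=.
    move=> [Dx tx]; have [Nx|nN] := pselect (N0 x).
      by right; move: tx; rewrite /psi mem_set// => ->.
    by left; split => //; have [n En] := (psi_gt x t Dx nN).1 tx; exists n.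
  move=> [[[n _ En] nN]|]; last first.
    by case: ifPn => // t0 Nx; split; [exact: ND|rewrite /psi mem_set].
  by have Dx := ED _ _ En; split => //; apply/psi_gt => //; exists n.
have mif (t : R) : measurable (if t < 0 then N0 else set0) by case: ifP.
have mlev t : measurable (D `&` [set x | t < psi x]).
  by rewrite levelE; apply: measurableU => //; exact: measurableD.
exists psi; split; first split.
- apply: (measurability _ (RGenOInfty.measurableE R)) => //.
  move=> _ [_ [t ->] <-]; rewrite (_ : _ `&` _ = D `&` [set x | t < psi x])//.
  by apply/seteqP; split => x [Dx /=]; rewrite in_itv/= andbT.
- move=> t; transitivity (mu (U t)).
    apply/le_anti/andP; split; apply: (@measure_le_null _ _ N0) => //.
      by rewrite levelE => x [[]|]; [left|case: ifP => // _; right].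
    move=> x Ux; rewrite levelE; have [|nN] := pselect (N0 x); first by right.
    by left; left.
  rewrite -/(a t); apply/le_anti/andP; split.
    rewrite -muE; apply: le_measure; rewrite ?inE//.
    by move=> x [n _]; apply: Ele; rewrite lerDl.
  rewrite /a superlevel_bigcup; apply: measure_bigcup_le => // [n m nm|n].
    apply/subsetPset; apply: superlevel_antitone; rewrite lerD2l.
    by rewrite lef_pV2 ?posrE// ler_nat.
  rewrite -/(a _) -muE; apply: le_measure; rewrite ?inE//.
  by move=> x Ex; exists n.
move=> F mF uF; have FD : F `<=` D by case: uF.
have N0le X : measurable X -> X `<=` N0 -> mu X = 0%E.
  move=> mX XN; apply/eqP; rewrite eq_le measure_ge0 andbT -N00.
  by apply: le_measure; rewrite ?inE.
pose J := [set t | F `<=` E t].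
have [J0|J0] := pselect (J !=set0); last first.
  apply: Or31; apply: N0le; first exact: measurableD.
  move=> x [Dx nF]; left; split => // -[n _ Ex].
  have [FE|/(_ _ Ex)//] := lex_upper_nested uF (uE (- n%:R)).
  by apply: J0; exists (- n%:R).
have [Jb|Jb] := pselect (has_ubound J); last first.
  apply: Or32; apply: N0le => // x Fx; right => n _.
  apply: contrapT => nE; apply: Jb; exists n%:R => t Jt; rewrite leNgt; apply/negP => nt.
  by apply: nE; apply: Ele (Jt _ Fx); exact: ltW.
apply: Or33; exists (sup J), N0; split => // [x Fx nN|x Dx nF nN].
  apply: ge_sup => // t Jt; rewrite psiE//; apply: ub_le_sup; last exact: Jt.
  by apply: Vub => //; exact: FD.
rewrite psiE//; apply: ge_sup; first exact: V0.
move=> t Vt; apply: ub_le_sup => // y Fy.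
by have [|/(_ _ Vt)//] := lex_upper_nested uF (uE t); exact.
Qed.

End rearrangement.

Section bathtub.
Context d (T : measurableType d) (R : realType).
Variable mu : {sigma_finite_measure set T -> \bar R}.
Implicit Types (D E : set T) (f g p phi psi P Q : T -> R).

Lemma integrable_cst_on D (k : R) : measurable D -> (mu D < +oo)%E ->
  mu.-integrable D (EFin \o cst k).
Proof.
move=> mD Doo; apply/integrableP; split.
  by apply/measurable_EFinP.
rewrite [X in (X < _)%E](_ : _ = \int[mu]_(x in D) (cst `|k|%:E x))%E//.
by rewrite integral_cst// lte_mul_pinfty// ?lee_fin.
Qed.

Lemma equimeasurable_integrable D phi g : measurable D -> (mu D < +oo)%E ->
  mu.-integrable D (EFin \o phi) -> equimeasurable mu D phi g ->
  mu.-integrable D (EFin \o g).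
Proof.
move=> mD Doo /integrableP[mphi iphi] eg; have [mg _] := eg.
apply/integrableP; split; first exact/measurable_EFinP.
have -> : (\int[mu]_(x in D) `|(EFin \o g) x| =
    \int[mu]_(x in D) `|(EFin \o phi) x|)%E; last by [].
apply: (@equimeasurable_integral _ _ _ mu D phi g (fun r => `|r%:E|%E)) => //.
  exact/measurable_EFinP.
by apply/measurable_EFinP; exact: normr_measurable.
Qed.

Lemma equimeasurable_integral_eq D phi g : measurable D -> (mu D < +oo)%E ->
  measurable_fun D phi -> equimeasurable mu D phi g ->
  (\int[mu]_(x in D) (g x)%:E = \int[mu]_(x in D) (phi x)%:E)%E.
Proof.
move=> mD Doo mphi eg; rewrite integralE [RHS]integralE; congr (_ - _)%E.
- under eq_integral do rewrite funeposE; under [RHS]eq_integral do rewrite funeposE.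
  apply: (@equimeasurable_integral _ _ _ mu D phi g (fun r => maxe r%:E 0)%E) => //.
    by apply: measurable_maxe => //; exact: EFin_measurable.
  by move=> r; rewrite le_max lexx orbT.
- under eq_integral do rewrite funenegE; under [RHS]eq_integral do rewrite funenegE.
  apply: (@equimeasurable_integral _ _ _ mu D phi g (fun r => maxe (- r%:E) 0)%E) => //.
    by apply: measurable_maxe => //; apply: measurableT_comp => //; exact: EFin_measurable.
  by move=> r; rewrite le_max lexx orbT.
Qed.

(** With [t] the level that separates [E] from its complement,
    [g <= t + (g - t)^+] everywhere and, up to the null set [N0],
    [psi = t + (psi - t)^+] on [E] while [(psi - t)^+] vanishes off [E]; and it has
    the same integral over [D] as [(g - t)^+]. *)
Lemma comonotone_integral_le D E phi psi g t N0 :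
  measurable D -> (mu D < +oo)%E -> measurable E -> E `<=` D ->
  mu.-integrable D (EFin \o phi) ->
  equimeasurable mu D phi psi -> equimeasurable mu D phi g ->
  measurable N0 -> mu N0 = 0%E ->
  (forall x, E x -> ~ N0 x -> t <= psi x) ->
  (forall x, D x -> ~ E x -> ~ N0 x -> psi x <= t) ->
  (\int[mu]_(x in E) (g x)%:E <= \int[mu]_(x in E) (psi x)%:E)%E.
Proof.
move=> mD Doo mE ED iphi epsi eg mN N00 geE leE.
have Eoo : (mu E < +oo)%E.
  by apply: le_lt_trans Doo; apply: le_measure; rewrite ?inE.
have mphi : measurable_fun D phi by apply/measurable_EFinP; case/integrableP : iphi.
pose k r : R := Num.max (r - t) 0.
have mk : measurable_fun setT k.
  by apply: measurable_maxr => //; apply: measurable_funB.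
have k0 r : 0 <= k r by rewrite /k le_max lexx orbT.
have mkf f : measurable_fun D f -> measurable_fun D (k \o f).
  by move=> mf; exact: measurableT_comp.
have ik f : mu.-integrable D (EFin \o f) -> mu.-integrable D (EFin \o (k \o f)).
  move=> jf; have mf : measurable_fun D f.
    by apply/measurable_EFinP; case/integrableP : jf.
  apply: (@le_integrable _ _ _ mu D mD _ ((EFin \o f) \- cst t%:E)%E).
  - by apply/measurable_EFinP; exact: mkf.
  - move=> x Dx /=; rewrite lee_fin ger0_norm// /k ge_max normr_ge0 andbT.
    exact: ler_norm.
  - by apply: integrableB => //; exact: integrable_cst_on.
have ig := equimeasurable_integrable mD Doo iphi eg.
have ipsi := equimeasurable_integrable mD Doo iphi epsi.
have [mg _] := eg; have [mpsi _] := epsi.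
have iE f : mu.-integrable D (EFin \o f) -> mu.-integrable E (EFin \o f).
  by move=> jf; apply: integrableS jf.
have ict : mu.-integrable E (EFin \o cst t) by exact: integrable_cst_on.
have split_ f : mu.-integrable D (EFin \o f) ->
    (\int[mu]_(x in E) (t + k (f x))%:E =
     \int[mu]_(x in E) t%:E + \int[mu]_(x in E) (k (f x))%:E)%E.
  move=> jf; under eq_integral do rewrite EFinD.
  by rewrite (integralD_EFin mE ict (iE _ (ik _ jf))).
apply: (@le_trans _ _ (\int[mu]_(x in E) (t + k (g x))%:E)%E).
  apply: le_integral => //; first exact: iE.
    by apply: (eq_integrable _ ((EFin \o cst t) \+ (EFin \o (k \o g)))%E) => //;
      apply: integrableD => //; exact/iE/ik.
  by move=> x Ex; rewrite lee_fin -lerBlDl /k le_max lexx.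
rewrite split_//.
apply: (@le_trans _ _ (\int[mu]_(x in E) (t + k (psi x))%:E)%E); last first.
  rewrite le_eqVlt; apply/orP; left; apply/eqP.
  apply: ae_eq_integral => //.
  - apply/measurable_EFinP; apply: measurable_funD => //.
    by apply: measurable_funS (mkf _ mpsi).
  - by apply/measurable_EFinP; exact: measurable_funS mpsi.
  exists N0; split => // x /= h; apply: contrapT => nN; apply: h => Ex.
  by rewrite /k max_l ?subr_ge0 ?geE// addrC subrK.
rewrite split_// leeD2l//.
apply: (@le_trans _ _ (\int[mu]_(x in D) (k (g x))%:E)%E).
  apply: ge0_subset_integral => //; first by apply/measurable_EFinP; exact: mkf.
  by move=> x _; rewrite lee_fin.
have kE f : equimeasurable mu D phi f ->
    (\int[mu]_(x in D) (k (f x))%:E = \int[mu]_(x in D) (k (phi x))%:E)%E.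
  move=> ef; apply: (@equimeasurable_integral _ _ _ mu D phi f (EFin \o k)) => //.
  by apply/measurable_EFinP.
rewrite kE// -(kE psi)//.
rewrite (@ge0_negligible_integral _ _ _ _ D N0)//; last 2 first.
- by apply/measurable_EFinP; exact: mkf.
- by move=> x _; rewrite lee_fin.
rewrite -[X in (X <= _)%E](_ : \int[mu]_(x in (D `\` N0)) (((EFin \o (k \o psi)) \_ E) x) = _)%E; last first.
  apply: eq_integral => x /[!inE] -[Dx nN]; rewrite patchE; have [//|] := boolP (x \in E).
  rewrite notin_setE => nE.
  by rewrite /= /k max_r// subr_le0 leE.
rewrite -integral_mkcondr; apply: ge0_subset_integral => //.
- by apply: measurableI => //; exact: measurableD.
- by apply/measurable_EFinP; apply: measurable_funS (mkf _ mpsi).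
- by move=> x _ /=; rewrite lee_fin.
Qed.

(** The layer-cake formula: by Tonelli, the integral of [P f] is the integral over
    [t >= 0] of the integrals of [P] over [f > t]. *)
Lemma superlevel_integral_le D P Q f : measurable D ->
  measurable_fun D P -> measurable_fun D Q -> measurable_fun D f ->
  (forall x, D x -> 0 <= P x) -> (forall x, D x -> 0 <= Q x) ->
  (forall x, D x -> 0 <= f x) ->
  (forall t : R, (0 <= t)%R -> \int[mu]_(x in D `&` [set x | (t < f x)%R]) (P x)%:E <=
             \int[mu]_(x in D `&` [set x | (t < f x)%R]) (Q x)%:E)%E ->
  (\int[mu]_(x in D) (P x * f x)%:E <= \int[mu]_(x in D) (Q x * f x)%:E)%E.
Proof.
move=> mD mP mQ mf P0 Q0 f0 PQ.
pose lam := @lebesgue_measure R.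
pose GR := measurableTypeR R.
pose F (h : T -> R) (z : T * GR) : \bar R :=
  (if (z.1 \in D) && (0 <= z.2 < (f \_ D) z.1) then (h \_ D) z.1 else 0)%:E.
have mfD : measurable_fun setT (f \_ D) by apply/(measurable_restrictT f mD).
have mF (h : T -> R) : measurable_fun D h -> measurable_fun setT (F h).
  move=> mh; have mhD : measurable_fun setT (h \_ D) by apply/(measurable_restrictT h mD).
  apply/measurable_EFinP; apply: measurable_fun_if => //.
  - apply: measurable_and.
      apply: (@measurableT_comp _ _ _ _ _ _ (mem D)) => //.
      apply: (measurable_fun_bool true); rewrite setTI (_ : _ @^-1` _ = D)//.
      by apply/seteqP; split => x /=; [exact: set_mem|exact: mem_set].
    apply: measurable_and.
      by apply: measurable_fun_ler => //; exact: measurable_snd.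
    apply: measurable_fun_ltr; first exact: measurable_snd.
    by apply: measurableT_comp => //; exact: measurable_fst.
  - apply: (@measurable_funS _ _ _ _ setT) => //.
    by apply: measurableT_comp => //; exact: measurable_fst.
have F0 (h : T -> R) : (forall x, D x -> 0 <= h x) -> forall z, (0 <= F h z)%E.
  move=> h0 z; rewrite lee_fin; case: ifP => // /andP[zD _].
  by rewrite patchE zD; apply: h0; rewrite inE in zD.
have inner h x : (\int[lam]_s F h (x, s) = (if x \in D then h x * f x else 0)%:E)%E.
  have [xD|xD] := boolP (x \in D); last first.
    by rewrite integral0_eq// => s _; rewrite /F /= (negbTE xD).
  have Dx : D x by rewrite inE in xD.
  transitivity (\int[lam]_s ((h x)%:E * (\1_(`[0, f x[%classic : set R) s)%:E))%E.
    apply: eq_integral => s _; rewrite /F/= xD/= !patchE xD indicE.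
    rewrite mem_setE in_itv/=; case: ifP => _; by rewrite ?mule1 ?mule0.
  rewrite integralZl//; last by apply: integrable_indic_itv.
  rewrite integral_indic//= setIT lebesgue_measure_itv/= lte_fin.
  by case: ltP (f0 _ Dx) => [_ _|h1 h2]; rewrite ?sube0 ?EFinM// (@le_anti _ _ (f x) 0) ?h1// mulr0 mule0.
have outer (h : T -> R) s : measurable_fun D h -> (\int[mu]_x F h (x, s) =
    if (0 <= s)%R then \int[mu]_(x in D `&` [set x | (s < f x)%R]) (h x)%:E else 0)%E.
  move=> mh; case: ifPn => s0; last first.
    by rewrite integral0_eq// => x _; rewrite /F /= (negbTE s0) andbF.
  rewrite [RHS]integral_mkcond; apply: eq_integral => x _.
  rewrite /F/= s0/= !patchE; have [xD|xD] /= := boolP (x \in D); last first.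
    by rewrite ifF//; apply/negbTE; rewrite notin_setE => -[Dx]; rewrite notin_setE in xD.
  rewrite inE in xD; case: ifPn => sf; first by rewrite mem_set.
  by rewrite memNset// => -[_ /=]; exact/negP.
have tot (h : T -> R) : measurable_fun D h -> (forall x, D x -> 0 <= h x) ->
    (\int[mu]_(x in D) (h x * f x)%:E = \int[lam]_s \int[mu]_x F h (x, s))%E.
  move=> mh h0; rewrite -(fubini_tonelli (F h) (mF _ mh) (F0 _ h0)).
  rewrite [LHS]integral_mkcond; apply: eq_integral => x _.
  by rewrite inner patchE; case: ifP.
rewrite !tot//; apply: ge0_le_integral => //.
- by move=> s _; apply: integral_ge0 => x _; exact: F0.
- exact: measurable_fun_fubini_tonelli_G (mF _ mP) (F0 _ P0).
- exact: measurable_fun_fubini_tonelli_G (mF _ mQ) (F0 _ Q0).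
- by move=> s _; rewrite !outer//; case: ifPn => // s0; exact: PQ.
Qed.

(** Among the rearrangements of [phi] the one comonotone with [f] has the largest
    integral against [f]: its integral over each superlevel set of [f] is the
    largest. The function [p] only breaks ties. *)
Theorem bathtub D f p phi : measurable D -> (mu D < +oo)%E ->
  measurable_fun D f -> (forall x, D x -> 0 <= f x) ->
  measurable_fun D p -> (forall c, mu (D `&` [set x | p x = c]) = 0)%E ->
  mu.-integrable D (EFin \o phi) ->
  exists2 psi, equimeasurable mu D phi psi &
  forall g, equimeasurable mu D phi g ->
    mu.-integrable D (fun x => (g x * f x)%:E) ->
    mu.-integrable D (fun x => (psi x * f x)%:E) ->
    (\int[mu]_(x in D) (g x * f x)%:E <= \int[mu]_(x in D) (psi x * f x)%:E)%E.
Proof.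
move=> mD Doo mf f0 mp p0 iphi.
have mphi : measurable_fun D phi by apply/measurable_EFinP; case/integrableP : iphi.
have [psi [epsi como]] := comonotone_rearrangement_exists mD Doo mf mp mphi p0.
exists psi => // g eg igf ipf; have [mg _] := eg; have [mpsi _] := epsi.
have ig := equimeasurable_integrable mD Doo iphi eg.
have ipsi := equimeasurable_integrable mD Doo iphi epsi.
have le_level t : (\int[mu]_(x in D `&` [set x | (t < f x)%R]) (g x)%:E <=
    \int[mu]_(x in D `&` [set x | (t < f x)%R]) (psi x)%:E)%E.
  set E := D `&` _; have mE : measurable E by exact: measurable_gtr.
  have ED : E `<=` D by move=> x [].
  have mfE (h : T -> R) : measurable_fun D h -> measurable_fun E (EFin \o h).
    by move=> mh; apply/measurable_EFinP; exact: measurable_funS mh.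
  have [DE0|E0|[s [N0 [mN N00 sE Es]]]] := como E mE (lex_upper_superlevel D f p t).
  - have toD (h : T -> R) : mu.-integrable D (EFin \o h) ->
        (\int[mu]_(x in E) (h x)%:E = \int[mu]_(x in D) (h x)%:E)%E.
      move=> ih; rewrite [RHS](@negligible_integral _ _ _ _ D (D `\` E))//; last first.
        exact: measurableD.
      by rewrite setDD setIidr.
    by rewrite !toD// (equimeasurable_integral_eq mD Doo mphi eg)
      (equimeasurable_integral_eq mD Doo mphi epsi).
  - by rewrite !null_set_integral//; exact: mfE.
  - exact: (comonotone_integral_le mD Doo mE ED iphi epsi eg mN N00 sE Es).
(* the layer-cake formula needs nonnegative functions: adding both negative
   parts keeps the difference of the two integrands *)
pose P x := Num.max (g x) 0 + Num.max (- psi x) 0.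
pose Q x := Num.max (psi x) 0 + Num.max (- g x) 0.
have mP : measurable_fun D P.
  by apply: measurable_funD; apply: measurable_maxr => //; exact: measurable_funN.
have mQ : measurable_fun D Q.
  by apply: measurable_funD; apply: measurable_maxr => //; exact: measurable_funN.
have P0 x : 0 <= P x by rewrite addr_ge0// le_max lexx orbT.
have Q0 x : 0 <= Q x by rewrite addr_ge0// le_max lexx orbT.
have QP x : Q x - P x = psi x - g x.
  by rewrite /P /Q; case: (leP (g x) 0); case: (leP (psi x) 0);
    case: (leP (- g x) 0); case: (leP (- psi x) 0); lra.
have boundP x : P x <= `|g x| + `|psi x|.
  by rewrite lerD// ge_max normr_ge0 andbT ?ler_norm// -normrN ler_norm.
have boundQ x : Q x <= `|g x| + `|psi x|.
  by rewrite addrC lerD// ge_max normr_ge0 andbT ?ler_norm// -normrN ler_norm.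
have iPQ E (h : T -> R) : measurable E -> E `<=` D -> measurable_fun D h ->
    (forall x, 0 <= h x) ->
    (forall x, h x <= `|g x| + `|psi x|) -> mu.-integrable E (EFin \o h).
  move=> mE ED mh h0 hb; apply: integrableS ED _ => //.
  apply: (@le_integrable _ _ _ mu D mD _
    ((abse \o (EFin \o g)) \+ (abse \o (EFin \o psi)))%E).
  - exact/measurable_EFinP.
  - move=> x _ /=; rewrite lee_fin ger0_norm//; apply: le_trans (hb x) _.
    exact: ler_norm.
  - by apply: integrableD => //; exact: integrable_abse.
have iPQf (h : T -> R) : measurable_fun D h -> (forall x, 0 <= h x) ->
    (forall x, h x <= `|g x| + `|psi x|) ->
    mu.-integrable D (fun x => (h x * f x)%:E).
  move=> mh h0 hb; apply: (@le_integrable _ _ _ mu D mD _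
    ((abse \o (fun x => (g x * f x)%:E)) \+ (abse \o (fun x => (psi x * f x)%:E)))%E).
  - by apply/measurable_EFinP; exact: measurable_funM.
  - move=> x Dx /=; rewrite lee_fin ger0_norm ?mulr_ge0 ?f0//.
    rewrite !normrM (ger0_norm (f0 _ Dx)) -mulrDl.
    apply: le_trans (ler_norm _); apply: ler_wpM2r; [exact: f0|exact: hb].
  - by apply: integrableD => //; exact: integrable_abse.
have diff E (k : T -> R) : measurable E -> E `<=` D ->
    mu.-integrable E (fun x => (P x * k x)%:E) -> mu.-integrable E (fun x => (Q x * k x)%:E) ->
    mu.-integrable E (fun x => (g x * k x)%:E) -> mu.-integrable E (fun x => (psi x * k x)%:E) ->
    (\int[mu]_(x in E) (Q x * k x)%:E - \int[mu]_(x in E) (P x * k x)%:E =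
    \int[mu]_(x in E) (psi x * k x)%:E - \int[mu]_(x in E) (g x * k x)%:E)%E.
  move=> mE ED i1 i2 i3 i4; rewrite -!integralB//.
  by apply: eq_integral => x _; rewrite -!EFinB -!mulrBl QP.
have le_of_diff (a b a' b' : \bar R) : a \is a fin_num -> b \is a fin_num ->
    a' \is a fin_num -> b' \is a fin_num ->
    (b - a = b' - a')%E -> (a <= b)%E = (a' <= b')%E.
  case: a b a' b' => [a||] [b||] [a'||] [b'||]// _ _ _ _ [e].
  by rewrite !lee_fin -[LHS]subr_ge0 -[RHS]subr_ge0 e.
rewrite -(le_of_diff _ _ _ _ _ _ _ _ (diff D f mD _ _ _ igf ipf)) => //;
  try by apply: integrable_fin_num => //; exact: iPQf.
- apply: superlevel_integral_le => // t t0.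
  set E := D `&` _; have mE : measurable E by exact: measurable_gtr.
  have ED : E `<=` D by move=> x [].
  have one (h : T -> R) : (\int[mu]_(x in E) (h x)%:E = \int[mu]_(x in E) (h x * 1)%:E)%E.
    by under [RHS]eq_integral do rewrite mulr1.
  have i1 (h : T -> R) : mu.-integrable E (EFin \o h) -> mu.-integrable E (fun x => (h x * 1)%:E).
    by apply: eq_integrable => // x _; rewrite mulr1.
  have jP := i1 _ (iPQ _ _ mE ED mP P0 boundP).
  have jQ := i1 _ (iPQ _ _ mE ED mQ Q0 boundQ).
  have jg : mu.-integrable E (fun x => (g x * 1)%:E) by apply: i1; exact: integrableS ig.
  have jpsi : mu.-integrable E (fun x => (psi x * 1)%:E) by apply: i1; exact: integrableS ipsi.
  have := le_level t; rewrite -/E (one g) (one psi) (one P) (one Q).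
  rewrite -(le_of_diff _ _ _ _ _ _ _ _ (diff E (cst 1) mE ED jP jQ jg jpsi))//;
    exact: integrable_fin_num.
- exact: iPQf.
- exact: iPQf.
Qed.

End bathtub.

(** * Energies and nested partitions *)

Section energy.
Context d (T : measurableType d) (R : realType).
Variable mu : {sigma_finite_measure set T -> \bar R}.
Variable K : T -> T -> R.
Hypothesis K_ge0 : forall x y, 0 <= K x y.
Hypothesis mK : measurable_fun setT (fun z : T * T => K z.1 z.2).
Implicit Types (u w : T -> R) (A : set T).

Definition energy_density u x y : R := `|u x - u y| ^+ 2 * K x y.

(** With the fractional kernel this is the square of the Gagliardo seminorm. *)
Definition energy u : \bar R := (\int[mu]_y \int[mu]_x (energy_density u x y)%:E)%E.

Lemma energy_density_ge0 u x y : 0 <= energy_density u x y.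
Proof. by rewrite mulr_ge0// sqr_ge0. Qed.

Lemma measurable_energy_density u : measurable_fun setT u ->
  measurable_fun setT (fun z : T * T => energy_density u z.1 z.2).
Proof.
move=> mu_; apply: measurable_funM => //; apply: measurable_funX.
apply: measurableT_comp => //; apply: measurable_funB.
  by apply: measurableT_comp => //; exact: measurable_fst.
by apply: measurableT_comp => //; exact: measurable_snd.
Qed.

Lemma measurable_partial_integral A (F : T * T -> \bar R) : measurable A ->
  measurable_fun setT F -> (forall z, 0 <= F z)%E ->
  measurable_fun setT (fun y => \int[mu]_(x in A) F (x, y))%E.
Proof.
move=> mA mF F0.
(* extension by 0 outside A, to apply the theorem on full products *)
pose FA z := (F z * (\1_A z.1)%:E)%E.
have -> : (fun y => \int[mu]_(x in A) F (x, y))%E =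
    fubini_G mu FA.
  apply/funext => y; rewrite /fubini_G [LHS]integral_mkcond; apply: eq_integral => x _.
  by rewrite patchE /FA/= indicE; case: ifPn; rewrite ?mule1 ?mule0.
apply: measurable_fun_fubini_tonelli_G.
  apply: emeasurable_funM => //; apply/measurable_EFinP.
  by apply: measurableT_comp => //; exact: measurable_fst.
by move=> z; rewrite mule_ge0// lee_fin indicE.
Qed.

Lemma measurable_slice u y A : measurable A -> measurable_fun setT u ->
  measurable_fun A (fun x => (energy_density u x y)%:E).
Proof.
move=> mA mu_; apply: (@measurable_funS _ _ _ _ setT) => //; apply/measurable_EFinP.
exact: (measurableT_comp (measurable_energy_density mu_)
  (pair2_measurable y)).
Qed.

Lemma measurable_partial_energy u A : measurable A -> measurable_fun setT u ->
  measurable_fun setT (fun y => \int[mu]_(x in A) (energy_density u x y)%:E)%E.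
Proof.
move=> mA mu_.
apply: (@measurable_partial_integral A (fun z => (energy_density u z.1 z.2)%:E)) => //.
- by apply/measurable_EFinP; exact: measurable_energy_density.
- by move=> z; rewrite lee_fin energy_density_ge0.
Qed.

(** Averaging over [y] in [A] the mean square distance of [u] to the constant [u y]
    gives at most the energy on [A] times [kap / m]; hence some value [u y] does at
    least as well as the average. *)
Lemma mean_square_sample A u (m kap : R) : measurable A -> measurable_fun setT u ->
  mu A = m%:E -> 0 < m -> 0 <= kap ->
  (forall x y, A x -> A y -> x <> y -> 1 <= kap * K x y) ->
  (\int[mu]_(y in A) \int[mu]_(x in A) (energy_density u x y)%:E < +oo)%E ->
  exists c : R, (\int[mu]_(x in A) ((u x - c) ^+ 2)%:E <=
    (kap / m)%:E * \int[mu]_(y in A) \int[mu]_(x in A) (energy_density u x y)%:E)%E.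
Proof.
move=> mA mu_ muA m0 kap0 Kkap Joo.
set J := (\int[mu]_(y in A) _)%E in Joo *.
pose H y := (\int[mu]_(x in A) (energy_density u x y)%:E)%E.
have H0 y : (0 <= H y)%E by apply: integral_ge0 => x _; rewrite lee_fin energy_density_ge0.
have mH : measurable_fun A H.
  by apply: measurable_funTS; exact: measurable_partial_energy.
have J0 : (0 <= J)%E by apply: integral_ge0 => y _; exact: H0.
have Jfin : J \is a fin_num by rewrite ge0_fin_numE.
have Gle y : A y -> (\int[mu]_(x in A) ((u x - u y) ^+ 2)%:E <= kap%:E * H y)%E.
  move=> Ay; rewrite /H -ge0_integralZl_EFin//; last 2 first.
  - by move=> x _; rewrite lee_fin energy_density_ge0.
  - exact: measurable_slice.
  apply: ge0_le_integral => //.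
  - by move=> x _; rewrite lee_fin sqr_ge0.
  - apply/measurable_EFinP; apply: measurable_funX; apply: measurable_funB => //.
    exact: measurable_funTS.
  - by apply: measurable_funeM; exact: measurable_slice.
  move=> x Ax; rewrite lee_fin /energy_density.
  have [->|xy] := pselect (x = y).
    by rewrite subrr normr0 expr0n/= mul0r mulr0.
  rewrite mulrCA -[leLHS]mulr1 -normrX ger0_norm ?sqr_ge0//.
  by apply: ler_wpM2l; [exact: sqr_ge0|exact: Kkap].
apply: contrapT => nc.
have Hgt y : A y -> ((kap / m)%:E * J < kap%:E * H y)%E.
  move=> Ay; apply: lt_le_trans (Gle _ Ay); rewrite ltNge; apply/negP => h.
  by apply: nc; exists (u y).
have kappos : 0 < kap.
  have [A0|/set0P[y Ay]] := eqVneq A set0.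
    by move: muA; rewrite A0 measure0 => -[] /eqP; rewrite lt_eqF.
  rewrite lt_neqAle kap0 andbT; apply/eqP => k0.
  by have := Hgt y Ay; rewrite -k0 mul0r !mul0e ltxx.
(* if no value of u worked, H would exceed its mean everywhere on A *)
pose h y := (H y - (m^-1)%:E * J)%E.
have cfin : ((m^-1)%:E * J)%E \is a fin_num by rewrite fin_numM.
have h0 y : A y -> (0 < h y)%E.
  move=> /Hgt; rewrite EFinM -muleA lte_pmul2l ?lte_fin// /h => hy.
  by rewrite sube_gt0.
have mh : measurable_fun A h by apply: emeasurable_funB.
have ih : (\int[mu]_(y in A) h y = 0)%E.
  suff e : (\int[mu]_(y in A) h y + J = J)%E.
    by rewrite -[LHS](addeK _ Jfin) e subee.
  have {1}-> : J = (\int[mu]_(y in A) ((m^-1)%:E * J))%E.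
    rewrite [RHS]integral_cst// [X in (_ * X)%E]muA muleAC -EFinM mulVf ?mul1e//.
    exact: lt0r_neq0.
  rewrite -ge0_integralD//; last 2 first.
  - by move=> y /h0/ltW.
  - by move=> y _; rewrite mule_ge0// lee_fin invr_ge0 ltW.
  apply: eq_integral => y _; rewrite /h subeK//.
have := (@ae_eq_integral_abs _ _ _ mu A mA h mh).1.
rewrite (_ : (\int[mu]_(x in A) `|h x|)%E = 0%E); last first.
  by rewrite -ih; apply: eq_integral => y /[!inE] /h0/ltW/gee0_abs.
move=> /(_ erefl)[N [mN N0 AN]].
have : (mu A <= mu N)%E.
  apply: le_measure; rewrite ?inE// => y Ay; apply: AN => /= /(_ Ay) hy.
  by have := h0 _ Ay; rewrite hy ltxx.
by rewrite muA N0 lee_fin leNgt m0.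
Qed.

End energy.

Section integral_bounds.
Context d (T : measurableType d) (R : realType).
Variable mu : {measure set T -> \bar R}.
Implicit Types (A : set T) (f g h : T -> R).

Lemma integral_le_lincomb A f g h (a b G H : R) : measurable A ->
  measurable_fun A f -> measurable_fun A g -> measurable_fun A h ->
  0 <= a -> 0 <= b -> (forall x, A x -> 0 <= f x) ->
  (forall x, A x -> 0 <= g x) -> (forall x, A x -> 0 <= h x) ->
  (forall x, A x -> f x <= a * g x + b * h x) ->
  (\int[mu]_(x in A) (g x)%:E <= G%:E)%E -> (\int[mu]_(x in A) (h x)%:E <= H%:E)%E ->
  (\int[mu]_(x in A) (f x)%:E <= (a * G + b * H)%:E)%E.
Proof.
move=> mA mf mg mh a0 b0 f0 g0 h0 fgh gG hH.
apply: (@le_trans _ _ (\int[mu]_(x in A) (a%:E * (g x)%:E + b%:E * (h x)%:E))%E).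
  apply: ge0_le_integral => //; first exact/measurable_EFinP.
  by apply: emeasurable_funD; apply: measurable_funeM; exact/measurable_EFinP.
rewrite ge0_integralD//; last 4 first.
- by move=> x Ax; rewrite mule_ge0// lee_fin g0.
- by apply: measurable_funeM; exact/measurable_EFinP.
- by move=> x Ax; rewrite mule_ge0// lee_fin h0.
- by apply: measurable_funeM; exact/measurable_EFinP.
rewrite !ge0_integralZl_EFin//; [|exact/measurable_EFinP|exact/measurable_EFinP].
by rewrite EFinD !EFinM; apply: leeD; apply: lee_pmul => //;
  apply: integral_ge0 => x Ax; rewrite lee_fin; [exact: g0|exact: h0].
Qed.

Lemma integral_le_scale A f g (a G : R) : measurable A ->
  measurable_fun A f -> measurable_fun A g ->
  0 <= a -> (forall x, A x -> 0 <= f x) -> (forall x, A x -> 0 <= g x) ->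
  (forall x, A x -> f x <= a * g x) -> (\int[mu]_(x in A) (g x)%:E <= G%:E)%E ->
  (\int[mu]_(x in A) (f x)%:E <= (a * G)%:E)%E.
Proof.
move=> mA mf mg a0 f0 g0 fg gG.
rewrite -[a * G]addr0 -(mul0r G).
by apply: (@integral_le_lincomb _ f g g) => // x Ax; rewrite mul0r addr0 fg.
Qed.

Lemma integral_sum_le A n (f : 'I_n -> T -> R) (F : 'I_n -> R) : measurable A ->
  (forall j, measurable_fun A (f j)) -> (forall j x, A x -> 0 <= f j x) ->
  (forall j, \int[mu]_(x in A) (f j x)%:E <= (F j)%:E)%E ->
  (\int[mu]_(x in A) (\sum_(j < n) f j x)%:E <= (\sum_(j < n) F j)%:E)%E.
Proof.
move=> mA mf f0 fF; under eq_integral do rewrite -sumEFin.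
rewrite ge0_integral_sum//; last first.
  by move=> j; exact/measurable_EFinP.
by rewrite -sumEFin; apply: lee_sum => j _; exact: fF.
Qed.

Lemma le_ereal_of_eps (x : \bar R) (y : R) :
  (forall e, 0 < e -> (x <= (y + e)%:E)%E) -> (x <= y%:E)%E.
Proof. by move=> h; apply/lee_addgt0Pr => e e0; rewrite -EFinD; exact: h. Qed.

End integral_bounds.

(** Cauchy-Schwarz with geometric weights, which turns the square of a telescoping
    sum into a sum of squares at the cost of a slightly slower geometric rate. *)
Lemma sqr_sum_geometric (R : realFieldType) (th : R) n (a : nat -> R) : 0 < th < 1 ->
  (\sum_(j < n) a j) ^+ 2 <= (1 - th)^-1 * \sum_(j < n) (th^-1) ^+ j * a j ^+ 2.
Proof.
move=> /andP[th0 th1]; elim: n a => [|n IH] a.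
  by rewrite !big_ord0 expr0n mulr0.
rewrite !big_ord_recl expr0 mul1r.
set X := \sum_(i < n) _; set Y := \sum_(i < n) _.
have YE : Y = th^-1 * \sum_(i < n) th^-1 ^+ i * a i.+1 ^+ 2.
  by rewrite /Y big_distrr/=; apply: eq_bigr => i _; rewrite /bump/= add1n (exprS th^-1) -mulrA.
have := IH (fun j => a j.+1); rewrite -/X => XY.
have t1 : 0 < 1 - th by rewrite subr_gt0.
(* the weights 1 - th and th make the difference a perfect square *)
have key : (a 0%N + X) ^+ 2 <= (1 - th)^-1 * a 0%N ^+ 2 + th^-1 * X ^+ 2.
  rewrite -subr_ge0.
  have -> : (1 - th)^-1 * a 0%N ^+ 2 + th^-1 * X ^+ 2 - (a 0%N + X) ^+ 2 =
      (th * a 0%N - (1 - th) * X) ^+ 2 / (th * (1 - th)).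
    by field; rewrite !gt_eqF.
  by rewrite divr_ge0 ?sqr_ge0// mulr_ge0// ltW.
apply: le_trans key _; rewrite mulrDr; apply: lerD => //.
by rewrite YE [leRHS]mulrCA ler_pM2l ?invr_gt0//.
Qed.

Lemma geometric_sum_le (R : realFieldType) (r : R) n : 0 <= r < 1 ->
  \sum_(j < n) r ^+ j <= (1 - r)^-1.
Proof.
move=> /andP[r0 r1]; have r1' : 0 < 1 - r by rewrite subr_gt0.
rewrite -[leLHS]mul1r -[leRHS]mulr1 ler_pdivlMl// mulrA mulr1.
by rewrite -opprB mulNr -subrX1 opprB lerBlDr lerDl exprn_ge0.
Qed.

(** Nested finite partitions of a set into cells of equal mass at each scale
    [k = 0, 1, 2, ...], the coarsest one with a single cell. By [kernel_grid] the
    kernel is large on pairs of points of one cell; [decay] is the rate at which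
    the oscillation of a function of finite energy decreases with the scale, and
    [growth] the rate at which the weights may concentrate. *)
Record grid d (T : measurableType d) (R : realType)
    (mu : {sigma_finite_measure set T -> \bar R}) (K : T -> T -> R) := Grid {
  grid_dom : set T;
  cell_index : nat -> finType;
  locate : forall k, T -> cell_index k;
  parent : forall k, cell_index k.+1 -> cell_index k;
  cell_mass : nat -> R;
  oscillation_cst : R;
  decay : R;
  growth : R;
  grid_measurable : forall k i, measurable (grid_dom `&` [set x | locate k x = i]);
  locate_parent : forall k x, grid_dom x -> locate k x = parent (locate k.+1 x);
  single_root : forall i j : cell_index 0, i = j;
  cell_mass_gt0 : forall k, 0 < cell_mass k;
  mu_grid_cell : forall k i,
    mu (grid_dom `&` [set x | locate k x = i]) = (cell_mass k)%:E;
  oscillation_ge0 : 0 <= oscillation_cst;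
  kernel_grid : forall k x y, grid_dom x -> grid_dom y ->
    locate k x = locate k y -> x <> y ->
    1 <= (oscillation_cst * decay ^+ k * cell_mass k) * K x y;
  decay_bounds : 0 < decay < 1;
  growth_ge1 : 1 <= growth;
  decay_growth : decay * growth < 1 }.

Section grid_estimates.
Context d (T : measurableType d) (R : realType).
Variables (mu : {sigma_finite_measure set T -> \bar R}) (K : T -> T -> R).
Hypothesis K_ge0 : forall x y, 0 <= K x y.
Hypothesis mK : measurable_fun setT (fun z : T * T => K z.1 z.2).
Variable G : grid mu K.
Implicit Types (u w : T -> R).

Local Notation B := (grid_dom G).
Local Notation loc := (locate G).
Local Notation m := (cell_mass G).
Local Notation e0 := (oscillation_cst G).
Local Notation alpha := (decay G).
Local Notation beta := (growth G).

Definition cell k (i : cell_index G k) : set T := B `&` [set x | loc k x = i].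

Lemma measurable_cell k i : measurable (@cell k i).
Proof. exact: grid_measurable. Qed.

Lemma mu_cell k i : mu (@cell k i) = (m k)%:E.
Proof. exact: mu_grid_cell. Qed.

Lemma cell_sub k i : @cell k i `<=` B.
Proof. by move=> x []. Qed.

Lemma grid_dom_cells k : B = \big[setU/set0]_(i <- enum (cell_index G k)) @cell k i.
Proof.
apply/seteqP; split => [x Bx|x].
  by rewrite -bigcup_seq; exists (loc k x); rewrite //= mem_enum.
by rewrite -bigcup_seq => -[i _ []].
Qed.

Lemma measurable_grid_dom : measurable B.
Proof.
rewrite (grid_dom_cells 0); apply: bigsetU_measurable => i _.
exact: measurable_cell.
Qed.
Hint Resolve measurable_grid_dom measurable_cell : core.

Lemma integral_cells k (f : T -> \bar R) : measurable_fun B f ->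
  (forall x, B x -> 0 <= f x)%E ->
  (\int[mu]_(x in B) f x = \sum_(i <- enum (cell_index G k)) \int[mu]_(x in @cell k i) f x)%E.
Proof.
move=> mf f0; rewrite {1}(grid_dom_cells k).
rewrite ge0_integral_bigsetU -?grid_dom_cells//; first exact: enum_uniq.
by move=> i j _ _ [x [[_ /= <-] [_ /= <-]]].
Qed.

Lemma measurable_step k (c : cell_index G k -> R) : measurable_fun B (fun x => c (loc k x)).
Proof.
rewrite (grid_dom_cells k) => _ Y mY.
rewrite -grid_dom_cells (_ : _ `&` _ =
    \big[setU/set0]_(i <- enum (cell_index G k) | c i \in Y) @cell k i).
  by apply: bigsetU_measurable.
rewrite -bigcup_seq_cond; apply/seteqP; split => x /=.
  by move=> [Bx Yx]; exists (loc k x) => //=; rewrite mem_enum/= mem_set.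
by move=> [i /= /andP[_ /set_mem ci] [Bx /= li]]; split => //; rewrite li.
Qed.

(** The Morrey-type condition on weights that makes an integral over a cell
    controlled by the mass of the cell; on dyadic cubes the nonnegative functions
    of a ball of L^q satisfy it. *)
Definition grid_weight W w := [/\ measurable_fun setT w, forall x, 0 <= w x &
  forall k i, (\int[mu]_(x in @cell k i) (w x)%:E <= (W * beta ^+ k * m k)%:E)%E].

Lemma integral_step k (h : cell_index G k -> R) : (forall i, 0 <= h i) ->
  (\int[mu]_(x in B) (h (loc k x))%:E = (\sum_i h i * m k)%:E)%E.
Proof.
move=> h0; rewrite (integral_cells k); last 2 first.
- by apply/measurable_EFinP; exact: measurable_step.
- by move=> x _; rewrite lee_fin.
rewrite big_enum/= -sumEFin; apply: eq_bigr => i _.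
transitivity (\int[mu]_(x in cell i) (cst (h i)%:E x))%E.
  by apply: eq_integral => x /[!inE] -[_ /= ->].
by rewrite integral_cst// EFinM; congr (_ * _)%E; exact: mu_cell.
Qed.

(** A step function does not see more of the weight than its masses on the cells. *)
Lemma weighted_step_le k (c : cell_index G k -> R) W w (H : R) : 0 <= W -> grid_weight W w ->
  (\int[mu]_(x in B) (c (loc k x) ^+ 2)%:E <= H%:E)%E ->
  (\int[mu]_(x in B) (w x * c (loc k x) ^+ 2)%:E <= (W * beta ^+ k * H)%:E)%E.
Proof.
move=> W0 [mw w0 wW]; rewrite (@integral_step k (fun i => c i ^+ 2)); last first.
  by move=> i; exact: sqr_ge0.
rewrite lee_fin => cH.
have Wb0 : 0 <= W * beta ^+ k by rewrite mulr_ge0// exprn_ge0// (le_trans ler01 (growth_ge1 G)).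
have mc : measurable_fun B (fun x => c (loc k x) ^+ 2).
  by apply: measurable_funX; exact: measurable_step.
rewrite (integral_cells k); last 2 first.
- apply/measurable_EFinP; apply: measurable_funM => //; exact: measurable_funTS.
- by move=> x _; rewrite lee_fin mulr_ge0// sqr_ge0.
apply: (@le_trans _ _ (W * beta ^+ k * \sum_i c i ^+ 2 * m k)%:E); last first.
  by rewrite lee_fin ler_wpM2l.
rewrite big_enum/= mulr_sumr -sumEFin; apply: lee_sum => i _.
rewrite (_ : W * beta ^+ k * _ = c i ^+ 2 * (W * beta ^+ k * m k)); last by ring.
have -> : (\int[mu]_(x in @cell k i) (w x * c (loc k x) ^+ 2)%:E =
           \int[mu]_(x in @cell k i) (c i ^+ 2 * w x)%:E)%E.
  by apply: eq_integral => x /[!inE] -[_ /= ->]; rewrite mulrC.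
apply: (@integral_le_scale _ _ _ mu _ _ w) => //.
- by apply: measurable_funM => //; exact: measurable_funTS.
- exact: measurable_funTS.
- exact: sqr_ge0.
- by move=> x _; rewrite mulr_ge0// sqr_ge0.
Qed.

(** On each cell the constant is a sampled value of [u]; the energies of the
    diagonal blocks add up to at most the total energy. *)
Lemma grid_approximation u (E : R) : measurable_fun setT u -> (energy mu K u <= E%:E)%E ->
  exists c : forall k, cell_index G k -> R, forall k,
  (\int[mu]_(x in B) ((u x - c k (loc k x)) ^+ 2)%:E <= (e0 * alpha ^+ k * E)%:E)%E.
Proof.
move=> mu_ uE.
have dens0 x y : (0 <= (energy_density K u x y)%:E)%E.
  by rewrite lee_fin energy_density_ge0.
have mpart A : measurable A -> measurable_fun setT
    (fun y => \int[mu]_(x in A) (energy_density K u x y)%:E)%E.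
  by move=> mA; exact: measurable_partial_energy.
have mB := measurable_grid_dom.
pose J k (i : cell_index G k) := (\int[mu]_(y in cell i) \int[mu]_(x in cell i)
  (energy_density K u x y)%:E)%E.
have inner_le A y : measurable A -> (\int[mu]_(x in A) (energy_density K u x y)%:E <=
    \int[mu]_x (energy_density K u x y)%:E)%E.
  move=> mA; apply: ge0_subset_integral => //; exact: measurable_slice.
have sumJ k : (\sum_(i <- enum (cell_index G k)) J k i <= E%:E)%E.
  apply: le_trans uE; apply: (@le_trans _ _
      (\int[mu]_(y in B) \int[mu]_x (energy_density K u x y)%:E)%E); last first.
    apply: ge0_subset_integral => //; first exact: mpart.
    by move=> y _; exact: integral_ge0.
  rewrite (integral_cells k); last 2 first.
  - by apply: measurable_funTS; exact: mpart.
  - by move=> y _; exact: integral_ge0.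
  apply: lee_sum => i _; apply: ge0_le_integral => //.
  - by move=> y _; exact: integral_ge0.
  - by apply: measurable_funTS; exact: mpart.
  - by apply: measurable_funTS; exact: mpart.
  - by move=> y _; exact: inner_le.
have J0 k i : (0 <= J k i)%E by apply: integral_ge0 => y _; exact: integral_ge0.
have Joo k i : (J k i < +oo)%E.
  apply: le_lt_trans (ltry E); apply: le_trans (sumJ k).
  rewrite big_enum/= (bigD1 i)//= leeDl// sume_ge0//.
have coef0 k : 0 <= e0 * alpha ^+ k * m k.
  have /andP[a0 _] := decay_bounds G.
  by rewrite mulr_ge0 ?(ltW (cell_mass_gt0 G k))// mulr_ge0 ?oscillation_ge0// exprn_ge0// ltW.
have sample k (i : cell_index G k) : {c : R | (\int[mu]_(x in cell i) ((u x - c) ^+ 2)%:E <=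
    (e0 * alpha ^+ k)%:E * J k i)%E}.
  apply/cid.
  have [|c hc] := mean_square_sample K_ge0 mK (measurable_cell i) mu_ (mu_cell i)
      (cell_mass_gt0 G k) (coef0 k) _ (Joo k i).
    by move=> x y [Bx lx] [By ly]; apply: kernel_grid => //; rewrite lx ly.
  exists c; apply: le_trans hc _.
  by rewrite mulfK// gt_eqF// cell_mass_gt0.
exists (fun k i => sval (sample k i)) => k.
have mdiff : measurable_fun B (fun x => (u x - sval (sample k (loc k x))) ^+ 2).
  apply: measurable_funX; apply: measurable_funB; first exact: measurable_funTS.
  exact: (measurable_step (fun i => sval (sample k i))).
rewrite (integral_cells k); last 2 first.
- exact/measurable_EFinP.
- by move=> x _; rewrite lee_fin sqr_ge0.
have e0a : 0 <= e0 * alpha ^+ k.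
  have /andP[a0 _] := decay_bounds G.
  by rewrite mulr_ge0 ?oscillation_ge0// exprn_ge0// ltW.
apply: (@le_trans _ _ ((e0 * alpha ^+ k)%:E * \sum_(i <- enum (cell_index G k)) J k i)%E); last first.
  by rewrite [leRHS]EFinM lee_wpmul2l// lee_fin.
rewrite ge0_sume_distrr; last by move=> i _; exact: J0.
apply: lee_sum => i _; apply: le_trans (svalP (sample k i)).
rewrite le_eqVlt; apply/orP; left; apply/eqP.
by apply: eq_integral => x /[!inE] -[_ /= ->].
Qed.

End grid_estimates.

Section weighted_estimates.
Context d (T : measurableType d) (R : realType).
Variables (mu : {sigma_finite_measure set T -> \bar R}) (K : T -> T -> R).
Variable G : grid mu K.
Implicit Types (u w : T -> R).

Local Notation B := (grid_dom G).
Local Notation loc := (locate G).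
Local Notation m := (cell_mass G).
Local Notation e0 := (oscillation_cst G).
Local Notation alpha := (decay G).
Local Notation beta := (growth G).
Hint Resolve measurable_grid_dom measurable_cell : core.

Definition approximates u (E : R) (c : forall k, cell_index G k -> R) := forall k,
  (\int[mu]_(x in B) ((u x - c k (loc k x)) ^+ 2)%:E <= (e0 * alpha ^+ k * E)%:E)%E.

Let rho := alpha * beta.
Let th := (1 + rho) / 2.

Lemma alpha_gt0 : 0 < alpha. Proof. by case/andP: (decay_bounds G). Qed.
Lemma alpha_lt1 : alpha < 1. Proof. by case/andP: (decay_bounds G). Qed.
Lemma beta_gt0 : 0 < beta. Proof. exact: lt_le_trans ltr01 (growth_ge1 G). Qed.
Lemma rho_gt0 : 0 < rho. Proof. by rewrite mulr_gt0 ?alpha_gt0 ?beta_gt0. Qed.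
Lemma rho_lt1 : rho < 1. Proof. exact: decay_growth. Qed.

Let th_bounds : 0 < th < 1.
Proof. by have := rho_gt0; have := rho_lt1; rewrite /th => *; apply/andP; split; lra. Qed.

Let rho_th : 0 <= rho / th < 1.
Proof.
have /andP[t0 _] := th_bounds; rewrite divr_ge0 ?(ltW rho_gt0) ?(ltW t0)//=.
by rewrite ltr_pdivrMr// mul1r /th; have := rho_lt1 => *; lra.
Qed.

Definition tail_cst : R :=
  2 * (4 * e0 * beta) * (1 - th)^-1 * (1 - rho / th)^-1.

Lemma tail_cst_ge0 : 0 <= tail_cst.
Proof.
have /andP[t0 t1] := th_bounds; have /andP[r0 r1] := rho_th.
rewrite /tail_cst !mulr_ge0 ?invr_ge0 ?subr_ge0 ?(ltW t1) ?(ltW r1)//.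
- exact: oscillation_ge0.
- exact: ltW beta_gt0.
Qed.

Section approximants.
Variables (u : T -> R) (E : R) (c : forall k, cell_index G k -> R).
Hypotheses (mu_ : measurable_fun setT u) (E0 : 0 <= E) (uc : approximates u E c).
Let v k x := c (loc k x).

Let mv k : measurable_fun B (v k). Proof. exact: measurable_step. Qed.
Let muB : measurable_fun B u. Proof. exact: measurable_funTS. Qed.

Lemma increment_le k :
  (\int[mu]_(x in B) ((v k.+1 x - v k x) ^+ 2)%:E <= (4 * e0 * alpha ^+ k * E)%:E)%E.
Proof.
have ak0 : 0 <= e0 * alpha ^+ k * E.
  by rewrite !mulr_ge0 ?oscillation_ge0// exprn_ge0// ltW// alpha_gt0.
apply: (@le_trans _ _ (2 * (e0 * alpha ^+ k.+1 * E) + 2 * (e0 * alpha ^+ k * E))%:E).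
  apply: (@integral_le_lincomb _ _ _ mu B _ (fun x => (u x - v k.+1 x) ^+ 2)
    (fun x => (u x - v k x) ^+ 2)) => //; try (by move=> x _; exact: sqr_ge0);
    try (by apply: measurable_funX; apply: measurable_funB).
  - move=> x _; rewrite -subr_ge0.
    have -> : 2 * (u x - v k.+1 x) ^+ 2 + 2 * (u x - v k x) ^+ 2 - (v k.+1 x - v k x) ^+ 2
    = ((u x - v k.+1 x) + (u x - v k x)) ^+ 2 by ring.
    exact: sqr_ge0.
  - exact: uc.
  - exact: uc.
rewrite lee_fin exprS.
rewrite (_ : _ + _ = 2 * (e0 * alpha ^+ k * E) * (alpha + 1)); last by ring.
rewrite (_ : 4 * _ * _ * _ = 2 * (e0 * alpha ^+ k * E) * 2); last by ring.
by apply: ler_wpM2l; [exact: mulr_ge0|have := alpha_lt1; lra].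
Qed.

Lemma weighted_increment_le W w k : 0 <= W -> grid_weight G W w ->
  (\int[mu]_(x in B) (w x * (v k.+1 x - v k x) ^+ 2)%:E <=
   (W * (4 * e0 * beta) * rho ^+ k * E)%:E)%E.
Proof.
move=> W0 wW.
have E1 x : B x -> v k.+1 x - v k x =
    (fun i => c i - c (parent i)) (loc k.+1 x).
  by move=> Bx; rewrite /v /= -locate_parent.
have -> : (\int[mu]_(x in B) (w x * (v k.+1 x - v k x) ^+ 2)%:E =
  \int[mu]_(x in B) (w x * ((fun i => c i - c (parent i)) (loc k.+1 x)) ^+ 2)%:E)%E.
  by apply: eq_integral => x /[!inE] Bx; rewrite E1.
rewrite (_ : W * _ * _ * _ = W * beta ^+ k.+1 * (4 * e0 * alpha ^+ k * E)); last first.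
  by rewrite /rho exprMn exprS; ring.
apply: (@weighted_step_le _ _ _ _ _ G k.+1 (fun i => c i - c (parent i))) => //.
apply: le_trans (increment_le k).
by rewrite le_eqVlt; apply/orP; left; apply/eqP; apply: eq_integral => x /[!inE] Bx; rewrite E1.
Qed.

(** The weighted increments decay like [rho ^+ k] with [rho < 1]; the exponent loss
    of [sqr_sum_geometric] is absorbed by a rate [th] strictly between [rho] and 1. *)
Lemma weighted_step_tail W w k n : 0 <= W -> grid_weight G W w ->
  (\int[mu]_(x in B) (w x * (v (k + n)%N x - v k x) ^+ 2)%:E <=
   (tail_cst / 2 * W * rho ^+ k * E)%:E)%E.
Proof.
move=> W0 wW; have [mw w0 _] := wW; have mwB : measurable_fun B w by exact: measurable_funTS.
have /andP[t0 t1] := th_bounds.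
have t1' : 0 < 1 - th by rewrite subr_gt0.
pose f (j : 'I_n) x := (th^-1) ^+ j * (w x * (v (k + j).+1 x - v (k + j)%N x) ^+ 2).
pose F (j : 'I_n) := (th^-1) ^+ j * (W * (4 * e0 * beta) * rho ^+ (k + j) * E).
have mf j : measurable_fun B (f j).
  by apply: measurable_funM => //; apply: measurable_funM => //;
    apply: measurable_funX; apply: measurable_funB.
have tj j : 0 <= th^-1 ^+ j by rewrite exprn_ge0// invr_ge0 ltW.
have f0 (j : 'I_n) x : 0 <= f j x by rewrite mulr_ge0// mulr_ge0// sqr_ge0.
have fF j : (\int[mu]_(x in B) (f j x)%:E <= (F j)%:E)%E.
  apply: (@integral_le_scale _ _ _ mu B _
    (fun x => w x * (v (k + j).+1 x - v (k + j)%N x) ^+ 2)) => //.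
  - by apply: measurable_funM => //; apply: measurable_funX; apply: measurable_funB.
  - by move=> x _; rewrite mulr_ge0// sqr_ge0.
  - exact: weighted_increment_le.
apply: (@le_trans _ _ ((1 - th)^-1 * \sum_(j < n) F j)%:E).
  apply: (@integral_le_scale _ _ _ mu B _ (fun x => \sum_(j < n) f j x)) => //.
  - by apply: measurable_funM => //; apply: measurable_funX; apply: measurable_funB.
  - exact: measurable_sum.
  - by rewrite invr_ge0 ltW.
  - by move=> x _; rewrite mulr_ge0// sqr_ge0.
  - by move=> x _; apply: sumr_ge0.
  - move=> x _.
    have -> : v (k + n)%N x - v k x = \sum_(j < n) (v (k + j).+1 x - v (k + j)%N x).
      rewrite -(big_mkord xpredT (fun j => v (k + j).+1 x - v (k + j)%N x)).
      under eq_bigr do rewrite -addnS.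
      by rewrite (telescope_sumr (fun j => v (k + j)%N x))// addn0.
    apply: (@le_trans _ _ (w x * ((1 - th)^-1 *
      \sum_(j < n) th^-1 ^+ j * (v (k + j).+1 x - v (k + j)%N x) ^+ 2))).
      apply: ler_wpM2l => //.
      exact: (@sqr_sum_geometric _ th n (fun j => v (k + j).+1 x - v (k + j)%N x)).
    rewrite mulrCA ler_pM2l ?invr_gt0// mulr_sumr.
    by apply: ler_sum => j _; rewrite /f mulrCA.
  - exact: integral_sum_le.
rewrite lee_fin.
have -> : \sum_(j < n) F j = W * (4 * e0 * beta) * rho ^+ k * E * \sum_(j < n) (rho / th) ^+ j.
  rewrite mulr_sumr; apply: eq_bigr => j _; rewrite /F exprD (exprMn j rho th^-1).
  by move: (rho ^+ k) (rho ^+ j) (th^-1 ^+ j) => a b b'; ring.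
rewrite (_ : tail_cst / 2 * W * rho ^+ k * E = (1 - th)^-1 *
   (W * (4 * e0 * beta) * rho ^+ k * E * (1 - rho / th)^-1)); last first.
  by rewrite /tail_cst; move: (1 - th)^-1 (1 - rho / th)^-1 => a b; field.
rewrite ler_pM2l ?invr_gt0// ler_wpM2l//.
  by rewrite !mulr_ge0 ?oscillation_ge0 ?exprn_ge0 ?(ltW beta_gt0) ?(ltW rho_gt0).
exact: geometric_sum_le.
Qed.

End approximants.
End weighted_estimates.

(** * Compactness *)

Lemma geometric_small (R : realType) (r C e : R) : 0 < r < 1 -> 0 < e ->
  exists n : nat, C * r ^+ n <= e.
Proof.
move=> /andP[r0 r1] e0.
have : geometric C r @ \oo --> (0 : R).
  by apply: cvg_geometric; rewrite ger0_norm// ltW.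
move=> /cvgrPdist_le /(_ _ e0) [N _ /(_ N (leqnn N))] /=.
by rewrite sub0r normrN => h; exists N; apply: le_trans h; exact: ler_norm.
Qed.

(** An ultrafilter on the indices yields limits of all bounded sequences at once,
    which replaces a diagonal extraction. *)
Lemma ultra_bounded_limit (R : realType) (U : set_system nat) (a : nat -> R) (b : R) :
  UltraFilter U -> (forall n, `|a n| <= b) ->
  exists L : R, forall t, 0 < t -> U [set n | `|a n - L| <= t].
Proof.
move=> UU ab.
have PU : ProperFilter U by exact: ultra_proper.
have cpt : compact (`[- b, b]%classic : set R) by exact: segment_compact.
have [|L [_ clL]] := cpt (a @ U) _.
  apply: (@filterS _ U _ setT); last exact: filterT.
  by move=> n _ /=; rewrite in_itv/= -ler_norml.
exists L => t t0; have [//|Ut] := in_ultra_setVsetC [set n | `|a n - L| <= t] UU.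
have : (a @ U) [set x | ~ `|x - L| <= t] by [].
move=> /clL /(_ (nbhsx_ballx L t t0)) [x [nx]].
by rewrite -ball_normE /= distrC => /ltW.
Qed.

Section compactness.
Context d (T : measurableType d) (R : realType).
Variables (mu : {sigma_finite_measure set T -> \bar R}) (K : T -> T -> R).
Hypothesis K_ge0 : forall x y, 0 <= K x y.
Hypothesis mK : measurable_fun setT (fun z : T * T => K z.1 z.2).
Variable G : grid mu K.
Implicit Types (u w : T -> R).

Local Notation B := (grid_dom G).
Local Notation loc := (locate G).
Local Notation m := (cell_mass G).
Local Notation e0 := (oscillation_cst G).
Local Notation alpha := (decay G).
Local Notation beta := (growth G).
Local Notation rho := (decay G * growth G).
Hint Resolve measurable_grid_dom measurable_cell : core.

(** For a bounded weight the step functions converge to [u] in mean square, so the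
    bound of [weighted_step_tail] passes to the limit; a general weight is
    exhausted by the sets where it is at most [M]. *)
Lemma weighted_tail_le u (E : R) c W w k : measurable_fun setT u -> 0 <= E ->
  @approximates _ _ _ mu K G u E c -> 0 <= W -> grid_weight G W w ->
  (\int[mu]_(x in B) (w x * (u x - c k (loc k x)) ^+ 2)%:E <=
   (tail_cst G * W * rho ^+ k * E)%:E)%E.
Proof.
move=> mu_ E0 uc W0 wW; have [mw w0 _] := wW.
have mwB : measurable_fun B w by exact: measurable_funTS.
have muB : measurable_fun B u by exact: measurable_funTS.
have mv j : measurable_fun B (fun x => c j (loc j x)) by exact: measurable_step.
pose BM M := B `&` [set x | w x <= M%:R].
have mBM M : measurable (BM M).
  have := mwB (measurable_grid_dom G) _ (measurable_itv `]-oo, M%:R : R]).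
  by congr measurable; apply/seteqP; split => x /=; rewrite in_itv.
have BMB M : BM M `<=` B by move=> x [].
have mBMf M (f : T -> R) : measurable_fun B f -> measurable_fun (BM M) f.
  by move=> mf; exact: (measurable_funS (measurable_grid_dom G) (BMB M) mf).
have sub_le M (f : T -> R) (y : R) : measurable_fun B f -> (forall x, 0 <= f x) ->
    (\int[mu]_(x in B) (f x)%:E <= y%:E)%E ->
    (\int[mu]_(x in BM M) (f x)%:E <= y%:E)%E.
  move=> mf f0; apply: le_trans; apply: ge0_subset_integral => //.
    exact/measurable_EFinP.
  by move=> x _; rewrite lee_fin.
have mwuv j : measurable_fun B (fun x => w x * (u x - c j (loc j x)) ^+ 2).
  by apply: measurable_funM => //; apply: measurable_funX; exact: measurable_funB.
have muv j : measurable_fun B (fun x => (u x - c j (loc j x)) ^+ 2).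
  by apply: measurable_funX; exact: measurable_funB.
have mwvv j : measurable_fun B (fun x => w x * (c j (loc j x) - c k (loc k x)) ^+ 2).
  by apply: measurable_funM => //; apply: measurable_funX; exact: measurable_funB.
(* with M fixed, the bound at level k + n differs from the claim by a
   quantity that tends to 0 with n *)
have bM M : (\int[mu]_(x in BM M) (w x * (u x - c k (loc k x)) ^+ 2)%:E <=
    (tail_cst G * W * rho ^+ k * E)%:E)%E.
  apply: le_ereal_of_eps => e e_gt0.
  have [n hn] := geometric_small (2 * M%:R * e0 * alpha ^+ k * E) (decay_bounds G) e_gt0.
  apply: (@le_trans _ _ (2 * M%:R * (e0 * alpha ^+ (k + n) * E) +
      2 * (tail_cst G / 2 * W * rho ^+ k * E))%:E); last first.
    rewrite lee_fin addrC exprD; apply: lerD.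
      by rewrite le_eqVlt; apply/orP; left; apply/eqP; field.
    by apply: le_trans hn; rewrite le_eqVlt; apply/orP; left; apply/eqP; ring.
  apply: (@integral_le_lincomb _ _ _ mu (BM M) _
    (fun x => (u x - c (k + n)%N (loc (k + n)%N x)) ^+ 2)
    (fun x => w x * (c (k + n)%N (loc (k + n)%N x) - c k (loc k x)) ^+ 2)) => //.
  - exact: mBMf.
  - exact: mBMf.
  - exact: mBMf.
  - by move=> x _; rewrite mulr_ge0// sqr_ge0.
  - by move=> x _; exact: sqr_ge0.
  - by move=> x _; rewrite mulr_ge0// sqr_ge0.
  - move=> x [_ /= wM]; set a := u x; set b := c k _; set b' := c (k + n)%N _.
    apply: (@le_trans _ _ (w x * (2 * (a - b') ^+ 2 + 2 * (b' - b) ^+ 2))).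
      apply: ler_wpM2l => //; rewrite -subr_ge0.
      rewrite (_ : _ - _ = ((a - b') - (b' - b)) ^+ 2); last by ring.
      exact: sqr_ge0.
    rewrite mulrDr; apply: lerD; last by rewrite mulrCA.
    by rewrite mulrCA -mulrA ler_wpM2l// ler_wpM2r// sqr_ge0.
  - by apply: sub_le (uc (k + n)%N) => // x; exact: sqr_ge0.
  - apply: sub_le; [exact: mwvv|by move=> x; rewrite mulr_ge0// sqr_ge0|].
    exact: (weighted_step_tail mu_ E0 uc k n W0 wW).
have BE : B = \bigcup_M BM M.
  apply/seteqP; split => [x Bx|x [M _ []//]].
  exists (Num.bound (w x)) => //; split => //=; apply: ltW; exact: archi_boundP.
have ndBM : nondecreasing_seq BM.
  move=> M M' MM; apply/subsetPset => x [Bx /= h]; split => //=.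
  by apply: le_trans h _; rewrite ler_nat.
have cv := @ge0_nondecreasing_set_cvg_integral _ _ _ BM
  (fun x => (w x * (u x - c k (loc k x)) ^+ 2)%:E) mu ndBM mBM.
rewrite BE -(cvg_lim _ (cv _ _))//.
- apply: lime_le; last exact: nearW.
  by apply/cvg_ex; eexists; apply: cv => [i|i x _];
    [apply/measurable_EFinP; exact: mBMf|rewrite lee_fin mulr_ge0// sqr_ge0].
- by move=> i; apply/measurable_EFinP; exact: mBMf.
- by move=> i x _; rewrite lee_fin mulr_ge0// sqr_ge0.
Qed.

Section zero_set.
Variables (Z : set T) (z : R).
Hypotheses (mZ : measurable Z) (ZB : Z `<=` B) (z0 : 0 < z) (zZ : (z%:E <= mu Z)%E).

(** On the set [Z] of measure at least [z] the function vanishes, so there the error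
    of the coarsest approximation is the coarsest value itself. This is the
    substitute for a Poincare inequality. *)
Lemma root_value_le u (E : R) c i : measurable_fun setT u ->
  {ae mu, forall x, Z x -> u x = 0} ->
  @approximates _ _ _ mu K G u E c -> c 0%N i ^+ 2 <= e0 * E / z.
Proof.
move=> mu_ uZ uc.
have mv : measurable_fun B (fun x => (u x - c 0%N (loc 0%N x)) ^+ 2).
  apply: measurable_funX; apply: measurable_funB; first exact: measurable_funTS.
  exact: measurable_step.
rewrite ler_pdivlMr//.
have zE : ((c 0%N i ^+ 2 * z)%:E <= (c 0%N i ^+ 2)%:E * mu Z)%E.
  by rewrite EFinM lee_wpmul2l// lee_fin sqr_ge0.
rewrite -lee_fin; apply: le_trans zE _.
have /= := uc 0%N; rewrite expr0 mulr1 => /(le_trans _); apply.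
apply: (@le_trans _ _ (\int[mu]_(x in Z) ((u x - c 0%N (loc 0%N x)) ^+ 2)%:E)%E); last first.
  apply: ge0_subset_integral => //; first exact/measurable_EFinP.
  by move=> x _; rewrite lee_fin sqr_ge0.
rewrite -integral_cst// le_eqVlt; apply/orP; left; apply/eqP.
apply: ae_eq_integral => //.
  by apply/measurable_EFinP; exact: (measurable_funS (measurable_grid_dom G) ZB mv).
apply: filterS uZ => x /= h Zx; rewrite h// sub0r sqrrN.
by rewrite (single_root i (loc 0%N x)).
Qed.

Definition form_cst : R := 2 * tail_cst G + 2 * (e0 / z * m 0%N).

Lemma form_cst_ge0 : 0 <= form_cst.
Proof.
rewrite addr_ge0// mulr_ge0 ?tail_cst_ge0// mulr_ge0 ?(ltW (cell_mass_gt0 G _))//.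
by rewrite divr_ge0 ?oscillation_ge0 ?(ltW z0).
Qed.

(** The tail bound at level 0 together with the bound on the value there. *)
Lemma weighted_form_le u (E : R) W w : measurable_fun setT u -> 0 <= E ->
  (energy mu K u <= E%:E)%E ->
  {ae mu, forall x, Z x -> u x = 0} -> 0 <= W -> grid_weight G W w ->
  (\int[mu]_(x in B) (w x * u x ^+ 2)%:E <= (form_cst * W * E)%:E)%E.
Proof.
move=> mu_ E0 uE uZ W0 wW; have [mw w0 _] := wW.
have [c uc] := grid_approximation K_ge0 mK G mu_ uE.
have mwB : measurable_fun B w by exact: measurable_funTS.
have muB : measurable_fun B u by exact: measurable_funTS.
have mv : measurable_fun B (fun x => c 0%N (loc 0%N x)) by exact: measurable_step.
pose i0 := loc 0%N (point : T).
have H0 : (\int[mu]_(x in B) (c 0%N (loc 0%N x) ^+ 2)%:E <= (e0 * E / z * m 0%N)%:E)%E.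
  rewrite (@integral_step _ _ _ mu K G 0%N (fun i => c 0%N i ^+ 2)); last first.
    by move=> i; exact: sqr_ge0.
  rewrite (bigD1 i0)//= big1 ?addr0; last first.
    by move=> i; rewrite (single_root i i0) eqxx.
  rewrite lee_fin ler_wpM2r ?(ltW (cell_mass_gt0 G _))//.
  exact: root_value_le uc.
rewrite (_ : form_cst * W * E = 2 * (tail_cst G * W * rho ^+ 0 * E) +
  2 * (W * beta ^+ 0 * (e0 * E / z * m 0%N))); last first.
  by rewrite /form_cst !expr0; ring.
apply: (@integral_le_lincomb _ _ _ mu B _ (fun x => w x * (u x - c 0%N (loc 0%N x)) ^+ 2)
    (fun x => w x * c 0%N (loc 0%N x) ^+ 2)) => //;
  try (by apply: measurable_funM => //; apply: measurable_funX => //; apply: measurable_funB);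
  try (by move=> x _; rewrite mulr_ge0// sqr_ge0).
- move=> x _; rewrite !(mulrCA 2) -mulrDr; apply: ler_wpM2l => //.
  set a := u x; set b := c _ _; rewrite -subr_ge0.
  rewrite (_ : _ - _ = (a - b - b) ^+ 2); last by ring.
  exact: sqr_ge0.
- exact: weighted_tail_le.
- exact: weighted_step_le.
Qed.

Lemma grid_weight1 : grid_weight G 1 (fun=> 1).
Proof.
split => // k i; rewrite integral_cst// mul1e mul1r.
rewrite [X in (X <= _)%E](mu_cell i) lee_fin ler_peMl ?(ltW (cell_mass_gt0 G _))//.
by rewrite exprn_ege1// growth_ge1.
Qed.

Lemma coefficient_le u (E : R) c k i : measurable_fun setT u -> 0 <= E ->
  (energy mu K u <= E%:E)%E ->
  {ae mu, forall x, Z x -> u x = 0} -> @approximates _ _ _ mu K G u E c ->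
  c k i ^+ 2 * m k <= 2 * (form_cst * 1 * E) + 2 * (e0 * alpha ^+ k * E).
Proof.
move=> mu_ E0 uE uZ uc.
have mcell : measurable (cell i) by [].
have csub : cell i `<=` B by exact: cell_sub.
have mv : measurable_fun B (fun x => c k (loc k x)) by exact: measurable_step.
have muB : measurable_fun B u by exact: measurable_funTS.
have sub_le (f : T -> R) (y : R) : measurable_fun B f -> (forall x, 0 <= f x) ->
    (\int[mu]_(x in B) (f x)%:E <= y%:E)%E ->
    (\int[mu]_(x in cell i) (f x)%:E <= y%:E)%E.
  move=> mf f0; apply: le_trans; apply: ge0_subset_integral => //.
    exact/measurable_EFinP.
  by move=> x _; rewrite lee_fin.
have h1 : (\int[mu]_(x in B) (u x ^+ 2)%:E <= (form_cst * 1 * E)%:E)%E.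
  have := weighted_form_le mu_ E0 uE uZ ler01 grid_weight1.
  by under eq_integral do rewrite mul1r.
rewrite -lee_fin; apply: (@le_trans _ _ (\int[mu]_(x in cell i) (c k i ^+ 2)%:E)%E).
  by rewrite integral_cst// EFinM lee_wpmul2l ?lee_fin ?sqr_ge0//; rewrite -(mu_cell i).
apply: (@integral_le_lincomb _ _ _ mu _ _ (fun x => u x ^+ 2)
  (fun x => (u x - c k (loc k x)) ^+ 2)) => //;
  try (by move=> x _; exact: sqr_ge0).
- by apply: measurable_funX; exact: (measurable_funS (measurable_grid_dom G) csub muB).
- apply: measurable_funX; apply: measurable_funB.
    exact: (measurable_funS (measurable_grid_dom G) csub muB).
  exact: (measurable_funS (measurable_grid_dom G) csub mv).
- move=> x [_ /= ->]; set a := u x; set b := c _ _; rewrite -subr_ge0.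
  rewrite (_ : _ - _ = (2 * a - b) ^+ 2); last by ring.
  exact: sqr_ge0.
- by apply: sub_le h1 => //; [exact: measurable_funX|move=> x; exact: sqr_ge0].
- apply: sub_le (uc k) => //; last by move=> x; exact: sqr_ge0.
  by apply: measurable_funX; exact: measurable_funB.
Qed.

End zero_set.
End compactness.

Section fatou_bounds.
Context d (T : measurableType d) (R : realType).
Variable mu : {measure set T -> \bar R}.

Lemma measurable_limn_einf D (F : (T -> \bar R)^nat) :
  (forall n, measurable_fun D (F n)) -> measurable_fun D (fun x => limn_einf (F^~ x)).
Proof.
move=> mF; have -> : (fun x => limn_einf (F^~ x)) =
    (fun x => - limn_esup (fun n => - F n x))%E.
  apply/funext => x; rewrite -[RHS]limn_einfN; congr limn_einf.
  by apply/funext => n /=; rewrite oppeK.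
apply: measurableT_comp => //; apply: measurable_fun_limn_esup => n.
exact: measurableT_comp.
Qed.

Lemma limn_einf_le (a : (\bar R)^nat) (y : \bar R) N0 :
  (forall n, (N0 <= n)%N -> (a n <= y)%E) -> (limn_einf a <= y)%E.
Proof.
move=> ay; rewrite limn_einf_lim; apply: lime_le; first exact: is_cvg_einfs.
apply: nearW => n; apply: ge_ereal_inf; exists (a (maxn n N0)).
  by exists (maxn n N0) => //=; exact: leq_maxl.
by apply: ay; exact: leq_maxr.
Qed.

Lemma ae_fatou D (F : (T -> \bar R)^nat) (f : T -> \bar R) : measurable D ->
  (forall n, measurable_fun D (F n)) -> (forall n x, D x -> 0 <= F n x)%E ->
  measurable_fun D f -> (forall x, D x -> 0 <= f x)%E ->
  {ae mu, forall x, D x -> (f x <= limn_einf (F^~ x))%E} ->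
  (\int[mu]_(x in D) f x <= limn_einf (fun n => \int[mu]_(x in D) F n x))%E.
Proof.
move=> mD mF F0 mf f0 fF; apply: le_trans (fatou mu mD mF F0).
apply: ae_ge0_le_integral => //; last exact: measurable_limn_einf.
move=> x Dx; rewrite limn_einf_lim; apply: lime_ge; first exact: is_cvg_einfs.
by apply: nearW => n; apply: le_ereal_inf_tmp => _ [k _ <-]; exact: F0.
Qed.

Lemma ae_fatou_cvg D (F : (T -> \bar R)^nat) (f : T -> \bar R) : measurable D ->
  (forall n, measurable_fun D (F n)) -> (forall n x, D x -> 0 <= F n x)%E ->
  measurable_fun D f -> (forall x, D x -> 0 <= f x)%E ->
  {ae mu, forall x, D x -> F n x @[n --> \oo] --> f x} ->
  (\int[mu]_(x in D) f x <= limn_einf (fun n => \int[mu]_(x in D) F n x))%E.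
Proof.
move=> mD mF F0 mf f0 fF; apply: ae_fatou => //.
apply: filterS fF => x h Dx; have := h Dx => /cvg_limn_einf_sup[-> _].
exact: lexx.
Qed.

(** The series of [2 ^+ j (f j - f j.+1)^2] has finite integral, hence converges
    almost everywhere, and [`|x| <= 2 ^- j + 2 ^+ j x^2]. *)
Lemma fast_cauchy_cvg B (f : nat -> T -> R) : measurable B ->
  (forall j, measurable_fun B (f j)) ->
  (forall j, (\int[mu]_(x in B) ((f j x - f j.+1 x) ^+ 2)%:E <= (4^-1 ^+ j)%:E)%E) ->
  exists A, [/\ measurable A, A `<=` B, mu (B `\` A) = 0%E &
    forall x, A x -> cvgn (fun j => f j x)].
Proof.
move=> mB mf fle.
pose a j x := (2 ^+ j * (f j x - f j.+1 x) ^+ 2).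
have a0 j x : (0 <= (a j x)%:E)%E by rewrite lee_fin /a mulr_ge0 ?sqr_ge0// exprn_ge0.
have ma j : measurable_fun B (fun x => (a j x)%:E).
  apply/measurable_EFinP; apply: measurable_funM => //.
  by apply: measurable_funX; exact: measurable_funB.
pose S x := (\sum_(0 <= j <oo) (a j x)%:E)%E.
have S0 x : (0 <= S x)%E by apply: nneseries_ge0.
have mS : measurable_fun B S by apply: ge0_emeasurable_sum.
have iS : (\int[mu]_(x in B) S x <= 2%:E)%E.
  rewrite /S integral_nneseries//; apply: lime_le.
    by apply: is_cvg_ereal_nneg_natsum => n _; apply: integral_ge0 => x _.
  apply: nearW => n; apply: (@le_trans _ _ (\sum_(0 <= j < n) (2^-1 ^+ j)%:E)%E).
    apply: lee_sum => j _.
    have -> : (2^-1 : R) ^+ j = 2 ^+ j * 4^-1 ^+ j.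
      by rewrite -exprMn; congr (_ ^+ _); lra.
    apply: (@integral_le_scale _ _ _ mu B _ (fun x => (f j x - f j.+1 x) ^+ 2)) => //.
    - exact/measurable_EFinP/ma.
    - by apply: measurable_funX; exact: measurable_funB.
    - by move=> x _; have := a0 j x; rewrite lee_fin.
    - by move=> x _; exact: sqr_ge0.
  rewrite sumEFin lee_fin big_mkord; apply: le_trans (geometric_sum_le _ _) _.
    by apply/andP; split; lra.
  by rewrite le_eqVlt; apply/orP; left; apply/eqP; field.
have jS : mu.-integrable B S.
  apply/integrableP; split => //; under eq_integral do rewrite gee0_abs//.
  exact: le_lt_trans iS (ltry _).
pose A := B `&` [set x | (S x < +oo)%E].
have mA : measurable A by exact: emeasurable_fun_infty_o.
exists A; split => //; first by move=> x [].
  apply/eqP; rewrite eq_le measure_ge0 andbT.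
  have [N [mN N0 BN]] := integrable_ae mB jS.
  rewrite -[leRHS]N0; apply: le_measure; rewrite ?inE//; first exact: measurableD.
  move=> x [Bx nA]; apply: BN => /= h; apply: nA; split => //=.
  by have := h Bx; rewrite ge0_fin_numE.
move=> x [Bx /= Sx].
have Sfin : S x \is a fin_num by rewrite ge0_fin_numE.
pose b j := f j.+1 x - f j x.
suff cb : cvgn (series b).
  have -> : (fun j => f j x) = (fun j => f 0%N x + series b j).
    apply/funext => j; rewrite /series/= /b (telescope_sumr (fun j => f j x))//.
    by rewrite addrC subrK.
  by apply: is_cvgD => //; exact: is_cvg_cst.
apply: normed_cvg; apply: nondecreasing_is_cvgn.
  by apply: nondecreasing_series => *; exact: normr_ge0.
exists (2 + fine (S x)) => _ [n _ <-]; rewrite /series/=.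
apply: (@le_trans _ _ (\sum_(0 <= j < n) (2^-1 ^+ j + a j x))).
  apply: ler_sum => j _; rewrite /b distrC /a.
  set t := `|_|; have -> : (f j x - f j.+1 x) ^+ 2 = t ^+ 2.
    by rewrite -normrX ger0_norm// sqr_ge0.
  have p0 : (0 : R) < 2 ^+ j by rewrite exprn_gt0.
  have -> : (2^-1 : R) ^+ j = (2 ^+ j)^-1 by rewrite exprVn.
  set p := 2 ^+ j in p0 *.
  have t0 : 0 <= t by rewrite normr_ge0.
  rewrite -subr_ge0 (_ : _ - _ = p^-1 * ((p * t - 2^-1) ^+ 2 + 3 / 4)).
    by rewrite mulr_ge0// ?invr_ge0 ?(ltW p0)// addr_ge0 ?sqr_ge0//; lra.
  by field; rewrite gt_eqF.
rewrite big_split/=; apply: lerD.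
  rewrite big_mkord; apply: le_trans (geometric_sum_le _ _) _.
    by apply/andP; split; lra.
  by rewrite le_eqVlt; apply/orP; left; apply/eqP; field.
rewrite -lee_fin fineK// -sumEFin.
by apply: nneseries_lim_ge => k _.
Qed.

End fatou_bounds.

Section grid_compactness.
Context d (T : measurableType d) (R : realType).
Variables (mu : {sigma_finite_measure set T -> \bar R}) (K : T -> T -> R).
Hypothesis K_ge0 : forall x y, 0 <= K x y.
Hypothesis mK : measurable_fun setT (fun z : T * T => K z.1 z.2).
Variable G : grid mu K.
Implicit Types (w : T -> R).

Local Notation B := (grid_dom G).
Local Notation loc := (locate G).
Local Notation m := (cell_mass G).
Local Notation e0 := (oscillation_cst G).
Local Notation alpha := (decay G).
Local Notation beta := (growth G).
Local Notation rho := (decay G * growth G).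

Variables (Z : set T) (z E : R) (u : nat -> T -> R).
Hypotheses (mZ : measurable Z) (ZB : Z `<=` B) (z0 : 0 < z) (zZ : (z%:E <= mu Z)%E).
Hypotheses (E0 : 0 <= E) (mu_ : forall n, measurable_fun setT (u n)).
Hypothesis uE : forall n, (energy mu K (u n) <= E%:E)%E.
Hypothesis uZ : forall n, {ae mu, forall x, Z x -> u n x = 0}.

Let mB : measurable B := measurable_grid_dom G.

(** Fix the limits, along an ultrafilter, of all the values of the step functions.
    Two indices whose values at level [k] are close to these limits give functions
    that are close against every admissible weight: the tails beyond level [k] are
    small by [weighted_tail_le], and at level [k] finitely many values matter. *)
Lemma grid_compactness : exists s : nat -> nat, (forall j, (j <= s j)%N) /\
  forall j l W w, (j <= l)%N -> 0 <= W -> grid_weight G W w ->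
  (\int[mu]_(x in B) (w x * (u (s j) x - u (s l) x) ^+ 2)%:E <= (W * 4^-1 ^+ j)%:E)%E.
Proof.
have /choice[c uc] : forall n, exists c, @approximates _ _ _ mu K G (u n) E c.
  move=> n; have [c h] := grid_approximation K_ge0 mK G (mu_ n) (uE n).
  by exists c.
have [U [UU ooU]] := @ultraFilterLemma nat \oo _.
have PU : ProperFilter U by exact: ultra_proper.
have lim k i : {L : R | forall t, 0 < t -> U [set n | `|c n k i - L| <= t]}.
  apply/cid; pose b := (2 * (form_cst G z * 1 * E) + 2 * (e0 * alpha ^+ k * E)) / m k.
  apply: (@ultra_bounded_limit _ _ _ (1 + b)) => n.
  have h := coefficient_le K_ge0 mK mZ ZB z0 zZ i (mu_ n) E0 (uE n) (uZ n) (uc n).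
  rewrite -ler_pdivlMr ?cell_mass_gt0// -/b in h.
  apply: le_trans (_ : 1 + `|c n k i| ^+ 2 <= _).
    rewrite -subr_ge0 (_ : _ - _ = (`|c n k i| - 2^-1) ^+ 2 + 3 / 4).
      by rewrite addr_ge0 ?sqr_ge0//; lra.
    by field.
  by rewrite lerD2l -normrX ger0_norm// sqr_ge0.
pose L k i := sval (lim k i).
have LU k i t : 0 < t -> U [set n | `|c n k i - L k i| <= t] by exact: (svalP (lim k i)).
have cauchy (eta : R) : 0 < eta -> exists2 S, U S & forall n n' W w, S n -> S n' -> 0 <= W ->
    grid_weight G W w ->
    (\int[mu]_(x in B) (w x * (u n x - u n' x) ^+ 2)%:E <= (W * eta)%:E)%E.
  move=> eta0; have rhob : 0 < rho < 1 by rewrite rho_gt0 rho_lt1.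
  have eta2 : 0 < eta / 2 by rewrite divr_gt0.
  have [k hk] := geometric_small (6 * tail_cst G * E) rhob eta2.
  pose D : R := 16 * beta ^+ k * (#|cell_index G k|%:R * m k).
  have D0 : 0 <= D.
    rewrite !mulr_ge0 ?exprn_ge0 ?ler0n ?(ltW (cell_mass_gt0 G k))//.
    exact/ltW/beta_gt0.
  (* D t^2 is the contribution of values within t of their limits *)
  pose t := Num.sqrt (eta / (2 * (D + 1))).
  have D1 : 0 < 2 * (D + 1) by rewrite mulr_gt0// ltr_wpDl.
  have t0 : 0 < t by rewrite sqrtr_gt0 divr_gt0.
  have Dt : D * t ^+ 2 <= eta / 2.
    rewrite sqr_sqrtr ?divr_ge0 ?(ltW eta0) ?(ltW D1)//.
    rewrite mulrA ler_pdivrMr// (_ : eta / 2 * _ = D * eta + eta); last by field.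
    by rewrite lerDl ltW.
  exists [set n | forall i, `|c n k i - L k i| <= t].
    by apply: filter_forall => i; exact: LU.
  move=> n n' W w Sn Sn' W0 wW; have [mw w0 _] := wW.
  have mwB : measurable_fun B w by exact: measurable_funTS.
  have muB j : measurable_fun B (u j) by exact: measurable_funTS.
  have mv j : measurable_fun B (fun x => c j k (loc k x)) by exact: measurable_step.
  pose delta i := c n k i - c n' k i.
  have dle i : delta i ^+ 2 <= 4 * t ^+ 2.
    rewrite (_ : 4 * t ^+ 2 = (2 * t) ^+ 2); last by ring.
    rewrite -[delta i ^+ 2]ger0_norm ?sqr_ge0// normrX lerXn2r// ?nnegrE ?normr_ge0 ?mulr_ge0 ?(ltW t0)//.
    rewrite /delta (_ : _ - _ = (c n k i - L k i) - (c n' k i - L k i)); last by ring.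
    apply: le_trans (ler_normB _ _) _; rewrite mulr2n mulrDl mul1r; apply: lerD; [exact: Sn|exact: Sn'].
  have H1 : (\int[mu]_(x in B) (delta (loc k x) ^+ 2)%:E <=
      (4 * t ^+ 2 * (#|cell_index G k|%:R * m k))%:E)%E.
    rewrite (@integral_step _ _ _ mu K G k (fun i => delta i ^+ 2)); last first.
      by move=> i; exact: sqr_ge0.
    rewrite lee_fin (_ : 4 * t ^+ 2 * _ = \sum_(i : cell_index G k) 4 * t ^+ 2 * m k).
      by apply: ler_sum => i _; rewrite ler_wpM2r ?(ltW (cell_mass_gt0 G k)).
    by rewrite sumr_const -mulr_natl; ring.
  have tri (x a b b' : R) : 0 <= x -> x * (a - b') ^+ 2 <= 2 * (x * (a - b) ^+ 2) + 2 * (x * (b - b') ^+ 2).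
    move=> x0; rewrite !(mulrCA 2) -mulrDr; apply: ler_wpM2l => //; rewrite -subr_ge0.
    rewrite (_ : _ - _ = ((a - b) - (b - b')) ^+ 2); last by ring.
    exact: sqr_ge0.
  have tl j := weighted_tail_le k (mu_ j) E0 (uc j) W0 wW.
  have H2 := weighted_step_le W0 wW H1.
  have H3 : (\int[mu]_(x in B) (w x * (c n k (loc k x) - u n' x) ^+ 2)%:E <=
     (2 * (W * beta ^+ k * (4 * t ^+ 2 * (#|cell_index G k|%:R * m k))) +
      2 * (tail_cst G * W * rho ^+ k * E))%:E)%E.
    apply: (@integral_le_lincomb _ _ _ mu B _
      (fun x => w x * (c n k (loc k x) - c n' k (loc k x)) ^+ 2)
      (fun x => w x * (u n' x - c n' k (loc k x)) ^+ 2)) => //;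
      try (by apply: measurable_funM => //; apply: measurable_funX; apply: measurable_funB);
      try (by move=> x _; rewrite mulr_ge0// sqr_ge0).
    by move=> x _; rewrite -(sqrrN (u n' x - _)) opprB; exact: tri.
  apply: (@le_trans _ _ (2 * (tail_cst G * W * rho ^+ k * E) +
     2 * (2 * (W * beta ^+ k * (4 * t ^+ 2 * (#|cell_index G k|%:R * m k))) +
      2 * (tail_cst G * W * rho ^+ k * E)))%:E).
    apply: (@integral_le_lincomb _ _ _ mu B _
      (fun x => w x * (u n x - c n k (loc k x)) ^+ 2)
      (fun x => w x * (c n k (loc k x) - u n' x) ^+ 2)) => //;
      try (by apply: measurable_funM => //; apply: measurable_funX; apply: measurable_funB);
      try (by move=> x _; rewrite mulr_ge0// sqr_ge0).
    by move=> x _; exact: tri.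
  rewrite lee_fin [leLHS](_ : _ = W * (6 * tail_cst G * E * rho ^+ k + D * t ^+ 2)); last first.
    by rewrite /D; ring.
  by rewrite ler_wpM2l// (_ : eta = eta / 2 + eta / 2) ?lerD//; field.
have four (j : nat) : (0 : R) < 4^-1 ^+ j by rewrite exprn_gt0.
have S_ j := cid2 (cauchy _ (four j)).
pose S j := s2val (S_ j).
have SU j : U (S j) by exact: (s2valP (S_ j)).
have Sle j := s2valP' (S_ j).
have US j : U [set n | (forall l, (l <= j)%N -> S l n) /\ (j <= n)%N].
  apply: filterI; last by apply: ooU; exists j.
  elim: j => [|j IH]; first by apply: filterS (SU 0%N) => n Sn l; rewrite leqn0 => /eqP ->.
  apply: filterS2 IH (SU j.+1) => n h Sn l.
  by rewrite leq_eqVlt => /predU1P[->//|/h].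
have /choice[s hs] : forall j, exists n, (forall l, (l <= j)%N -> S l n) /\ (j <= n)%N.
  by move=> j; have [n hn] := filter_ex (US j); exists n.
exists s; split; first by move=> j; case: (hs j).
move=> j l W w jl W0 wW; apply: (Sle j) => //.
  by case: (hs j) => h _; exact: h.
by case: (hs l) => h _; exact: h.
Qed.

End grid_compactness.

Section energy_compactness.
Context d (T : measurableType d) (R : realType).
Variables (mu : {sigma_finite_measure set T -> \bar R}) (K : T -> T -> R).
Hypothesis K_ge0 : forall x y, 0 <= K x y.
Hypothesis mK : measurable_fun setT (fun z : T * T => K z.1 z.2).
Variable G : grid mu K.
Implicit Types (w : T -> R).
Local Notation B := (grid_dom G).

Variables (Om Z : set T) (z E : R) (u : nat -> T -> R).
Hypotheses (mOm : measurable Om) (OmB : Om `<=` B).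
Hypotheses (mZ : measurable Z) (ZB : Z `<=` B) (ZOm : forall x, Z x -> ~ Om x).
Hypotheses (z0 : 0 < z) (zZ : (z%:E <= mu Z)%E).
Hypotheses (E0 : 0 <= E) (mu_ : forall n, measurable_fun setT (u n)).
Hypothesis uE : forall n, (energy mu K (u n) <= E%:E)%E.
Hypothesis uOm : forall n, {ae mu, forall x, ~ Om x -> u n x = 0}.

Let mB : measurable B := measurable_grid_dom G.

(** The subsequence of [grid_compactness] converges almost everywhere because the
    weight 1 is admissible. Fatou gives lower semicontinuity of the energy, and
    Fatou again, in the second index, turns the Cauchy bounds into distances to
    the limit. *)
Theorem energy_compactness : exists (s : nat -> nat) (v : T -> R),
  [/\ forall j, (j <= s j)%N, measurable_fun setT v,
      forall x, ~ Om x -> v x = 0,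
      (energy mu K v <= limn_einf (fun j => energy mu K (u (s j))))%E &
      forall j W w, 0 <= W -> grid_weight G W w ->
  (\int[mu]_(x in B) (w x * (u (s j) x - v x) ^+ 2)%:E <= (W * 4^-1 ^+ j)%:E)%E].
Proof.
have uZ n : {ae mu, forall x, Z x -> u n x = 0}.
  by apply: filterS (uOm n) => x h Zx; apply: h; exact: ZOm.
have [s [sj cauchy]] := grid_compactness K_ge0 mK mZ ZB z0 zZ E0 mu_ uE uZ.
pose f j := u (s j).
have mf j : measurable_fun setT (f j) by exact: mu_.
have mfB j : measurable_fun B (f j) by exact: measurable_funTS.
have [A [mA AB BA Acvg]] : exists A, [/\ measurable A, A `<=` B, mu (B `\` A) = 0%E &
    forall x, A x -> cvgn (fun j => f j x)].
  apply: fast_cauchy_cvg => // j.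
  have := cauchy j j.+1 1 (fun=> 1) (leqnSn j) ler01 (grid_weight1 G).
  rewrite [1 * 4^-1 ^+ j]mul1r; congr (_ <= _)%E.
  by apply: eq_integral => x _; rewrite mul1r.
pose A' := A `&` Om.
have mA' : measurable A' by exact: measurableI.
pose v := (fun x => limn (fun j => f j x)) \_ A'.
have mv : measurable_fun setT v.
  apply/(measurable_restrictT _ mA').
  apply: (@measurable_fun_cvg _ _ _ _ f) => [j|x [Ax _]].
    exact: measurable_funTS.
  exact: Acvg.
have v0 x : ~ Om x -> v x = 0.
  by move=> nOm; rewrite /v patchE memNset// => -[_].
have fv : {ae mu, forall x, f j x @[j --> \oo] --> v x}.
  have h1 : {ae mu, forall x, forall j, ~ Om x -> f j x = 0}.
    by apply: ae_foralln => j; exact: uOm.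
  have h2 : {ae mu, forall x, B x -> A x}.
    exists (B `\` A); split => //; first exact: measurableD.
    by move=> x /= /not_implyP.
  apply: filterS2 h1 h2 => x fx BAx; have [Ox|nOx] := pselect (Om x).
    have Ax : A x by apply: BAx; exact: OmB.
    by rewrite /v patchE mem_set//; exact: Acvg.
  by rewrite v0//; under eq_fun do rewrite fx//; exact: cvg_cst.
have dens_cvg (x y : T) : (f j x @[j --> \oo] --> v x) -> (f j y @[j --> \oo] --> v y) ->
    (energy_density K (f j) x y)%:E @[j --> \oo] --> (energy_density K v x y)%:E.
  move=> fx fy; apply: cvg_EFin; first exact: nearW.
  rewrite /energy_density; apply: cvgMl.
  rewrite /comp/= !expr2; under eq_fun do rewrite expr2.
  by apply: cvgM; apply: cvg_norm; apply: cvgB.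
exists s, v; split => //.
- pose Gn j y := (\int[mu]_x (energy_density K (f j) x y)%:E)%E.
  have Gn0 j y : (0 <= Gn j y)%E.
    by apply: integral_ge0 => x _; rewrite lee_fin energy_density_ge0.
  have mpart (h : T -> R) : measurable_fun setT h ->
      measurable_fun setT (fun y => \int[mu]_x (energy_density K h x y)%:E)%E.
    by move=> mh; apply: measurable_partial_energy.
  have mslice (h : T -> R) y : measurable_fun setT h ->
      measurable_fun setT (fun x => (energy_density K h x y)%:E).
    by move=> mh; apply: measurable_slice.
  apply: (@ae_fatou _ _ _ mu setT Gn) => //.
  + by move=> j; exact: mpart.
  + exact: mpart.
  + by move=> y _; apply: integral_ge0 => x _; rewrite lee_fin energy_density_ge0.
  apply: (filterS _ fv) => y fy _.
  apply: (@ae_fatou_cvg _ _ _ mu setT (fun j x => (energy_density K (f j) x y)%:E)) => //.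
  + by move=> j; exact: mslice.
  + by move=> j x _; rewrite lee_fin energy_density_ge0.
  + exact: mslice.
  + by move=> x _; rewrite lee_fin energy_density_ge0.
  by apply: (filterS _ fv) => x fx _; exact: dens_cvg.
- move=> j W w W0 wW; have [mw w0 _] := wW.
  have mwB : measurable_fun B w by exact: measurable_funTS.
  have mvB : measurable_fun B v by exact: measurable_funTS.
  apply: (@le_trans _ _ (limn_einf (fun l => \int[mu]_(x in B) (w x * (f j x - f l x) ^+ 2)%:E)%E)).
    apply: ae_fatou_cvg => //.
    + move=> l; apply/measurable_EFinP; apply: measurable_funM => //.
      by apply: measurable_funX; exact: measurable_funB.
    + by move=> l x _; rewrite lee_fin mulr_ge0// sqr_ge0.
    + apply/measurable_EFinP; apply: measurable_funM => //.
      by apply: measurable_funX; apply: measurable_funB => //; exact: (mfB j).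
    + by move=> x _; rewrite lee_fin mulr_ge0// sqr_ge0.
    apply: (filterS _ fv) => x fx _; apply: cvg_EFin; first exact: nearW.
    rewrite /comp/=; apply: cvgMr; rewrite expr2; under eq_fun do rewrite expr2.
    by apply: cvgM; apply: cvgB => //; exact: cvg_cst.
  by apply: (@limn_einf_le _ _ _ j) => l jl; exact: cauchy.
Qed.

End energy_compactness.

(** * Lebesgue measure of row vectors *)

Section lebesgue_rV_theory.
Variable R : realType.

(** Borel sets of tuples are Caratheodory measurable for the outer measure that they
    generate, with unchanged measure. *)
Lemma lebesgue_rV_borel n (A : set 'rV[R]_n) :
  measurable [set t : n.-tuple R | A (\row_(i < n) tnth t i)] ->
  measurable A /\
  lebesgue_rV A = borel_lebesgue R n [set t : n.-tuple R | A (\row_(i < n) tnth t i)].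
Proof.
move=> mA; split; last by rewrite /lebesgue_rV /lebesgue_outer measurable_mu_extE.
move=> X; rewrite /lebesgue_outer.
exact: (caratheodory_measurable_mu_ext (borel_lebesgue R n) mA
  [set t : n.-tuple R | X (\row_(i < n) tnth t i)]).
Qed.

Lemma measurable_coord n (i : 'I_n) : measurable_fun setT (fun x : 'rV[R]_n => x 0 i).
Proof.
move=> _ Y mY; rewrite setTI; apply: (lebesgue_rV_borel _).1.
rewrite [X in measurable X](_ : _ = (fun t : n.-tuple R => tnth t i) @^-1` Y).
  by rewrite -[X in measurable X]setTI; exact: measurable_tnth.
by apply/seteqP; split => t /=; rewrite mxE.
Qed.

Lemma measurable_tuple_box n (J : 'I_n -> set R) : (forall i, measurable (J i)) ->
  measurable [set t : n.-tuple R | forall i, J i (tnth t i)].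
Proof.
move=> mJ; rewrite [X in measurable X](_ : _ =
  \bigcap_(i in [set: 'I_n]) ((fun t : n.-tuple R => tnth t i) @^-1` J i)).
  apply: fin_bigcap_measurable => // i _.
  by rewrite -[X in measurable X]setTI; exact: measurable_tnth.
by apply/seteqP; split => t /= h; [move=> i _; exact: h|move=> i; exact: (h i I)].
Qed.

Lemma borel_lebesgue_box n (J : 'I_n -> set R) (h : R) : (forall i, measurable (J i)) ->
  (forall i, lebesgue_measure (J i) = h%:E) ->
  borel_lebesgue R n [set t : n.-tuple R | forall i, J i (tnth t i)] = (h ^+ n)%:E.
Proof.
elim: n J => [|n IH] J mJ hJ.
  rewrite /= diracE mem_set//= => -[]//.
rewrite /= /product_step /pushforward.
rewrite (_ : _ @^-1` _ = J ord0 `*`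
    [set t : n.-tuple R | forall i, J (lift ord0 i) (tnth t i)]); last first.
  apply/seteqP; split => -[x t] /=.
    move=> H; split; first exact: (H ord0).
    by move=> i; have := H (lift ord0 i); rewrite /tuple_cons tnthS.
  move=> [Hx Ht] i; case: (unliftP ord0 i) => [j ->|->] //.
  by rewrite /tuple_cons tnthS.
rewrite product_measure1E; [|exact: mJ|]; last first.
  exact: (@measurable_tuple_box n (fun i => J (lift ord0 i)) (fun i => mJ _)).
by rewrite [X in (X * _)%E]hJ exprS EFinM; congr (_ * _)%E;
  exact: (IH (fun i => J (lift ord0 i))).
Qed.

Lemma lebesgue_rV_box n (J : 'I_n -> set R) (h : R) : (forall i, measurable (J i)) ->
  (forall i, lebesgue_measure (J i) = h%:E) ->
  measurable [set x : 'rV[R]_n | forall i, J i (x 0 i)] /\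
  lebesgue_rV [set x : 'rV[R]_n | forall i, J i (x 0 i)] = (h ^+ n)%:E.
Proof.
move=> mJ hJ.
have E : [set t : n.-tuple R | [set x : 'rV[R]_n | forall i, J i (x 0 i)] (\row_(i < n) tnth t i)] =
    [set t : n.-tuple R | forall i, J i (tnth t i)].
  by apply/seteqP; split => t /= H i; have := H i; rewrite mxE.
have mE : measurable [set t : n.-tuple R |
    [set x : 'rV[R]_n | forall i, J i (x 0 i)] (\row_(i < n) tnth t i)].
  by rewrite E; exact: measurable_tuple_box.
have [mB ->] := lebesgue_rV_borel mE; split => //.
by rewrite E; exact: borel_lebesgue_box.
Qed.

Lemma lebesgue_rV_cube n (a : 'I_n -> R) (h : R) : 0 <= h ->
  measurable [set x : 'rV[R]_n | forall i, a i <= x 0 i < a i + h] /\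
  lebesgue_rV [set x : 'rV[R]_n | forall i, a i <= x 0 i < a i + h] = (h ^+ n)%:E.
Proof.
move=> h0.
have [||] := @lebesgue_rV_box n (fun i => `[a i, a i + h[%classic) h.
- by move=> i; exact: measurable_itv.
- move=> i; rewrite lebesgue_measure_itv/= lte_fin ltrDl.
  case: ltP => [_|h0']; first by rewrite -EFinD addrC addrA [- _ + _]addrC subrr add0r.
  by rewrite (@le_anti _ _ h 0)// h0' h0.
by rewrite (_ : [set x : 'rV[R]_n | forall i, `[a i, a i + h[%classic (x 0 i)] =
  [set x : 'rV[R]_n | forall i, a i <= x 0 i < a i + h]).
Qed.

Lemma lebesgue_rV_sigma_finite n : sigma_finite setT (@lebesgue_rV R n).
Proof.
exists (fun k => [set x : 'rV[R]_n | forall i, - k%:R <= x 0 i < - k%:R + 2 * k%:R]).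
  apply/seteqP; split => // x _.
  pose b := \sum_i `|x 0 i|.
  exists (Num.bound b) => // i /=.
  have hb : `|x 0 i| <= b.
    by rewrite /b (bigD1 i)//= lerDl sumr_ge0.
  have : `|x 0 i| < (Num.bound b)%:R.
    apply: le_lt_trans hb _; apply: archi_boundP; exact: sumr_ge0.
  by rewrite ltr_norml => /andP[h1 h2]; apply/andP; split; lra.
move=> k; have [|mB ->] := @lebesgue_rV_cube n (fun=> - k%:R) (2 * k%:R).
  by rewrite mulr_ge0.
by split => //; exact: ltry.
Qed.

HB.instance Definition _ n := Measure_isSigmaFinite.Build _ _ _ (@lebesgue_rV R n)
  (@lebesgue_rV_sigma_finite n).

(** Coordinate functions are thus the tie-breakers needed in [bathtub]. *)
Lemma lebesgue_rV_hyperplane n (n0 : (0 < n)%N) : exists i : 'I_n, forall c : R,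
  lebesgue_rV [set x : 'rV[R]_n | x 0 i = c] = 0%E.
Proof.
case: n n0 => // n _; exists ord0 => c.
have E : [set t : n.+1.-tuple R | [set x : 'rV[R]_n.+1 | x 0 ord0 = c] (\row_i tnth t i)] =
    (fun t : n.+1.-tuple R => tnth t ord0) @^-1` [set c].
  by apply/seteqP; split => t /=; rewrite mxE.
have mE : measurable ((fun t : n.+1.-tuple R => tnth t ord0) @^-1` [set c]).
  by rewrite -[X in measurable X]setTI; exact: measurable_tnth.
have [_ ->] := @lebesgue_rV_borel _ [set x : 'rV[R]_n.+1 | x 0 ord0 = c]
  ltac:(rewrite E; exact: mE).
rewrite E /= /product_step /pushforward.
rewrite (_ : _ @^-1` _ = [set c] `*` setT); last first.
  by apply/seteqP; split => -[x t] //= [].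
rewrite product_measure1E; [|exact: measurable_set1|exact: measurableT].
by rewrite [X in (X * _)%E]lebesgue_measure_set1 mul0e.
Qed.

End lebesgue_rV_theory.

(** * The fractional kernel and dyadic cubes *)

Section power_functions.
Variable R : realType.

Lemma powR_div_expn (a r : R) k : 0 <= a ->
  (a / 2 ^+ k) `^ r = a `^ r * (2 `^ (- r)) ^+ k.
Proof.
move=> a0; rewrite powRM ?invr_ge0 ?exprn_ge0//; congr (_ * _).
rewrite -powR_mulrn ?powR_ge0// powRN -powR_inv1 ?exprn_ge0//.
rewrite -powR_mulrn// -!powRrM -powR_inv1 ?powR_ge0// -powRrM.
rewrite -[RHS]powRrM; by congr (_ `^ _); ring.
Qed.

Lemma powR2_neg_bounds (r : R) : r < 0 -> 0 < 2 `^ r < 1.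
Proof.
move=> r0; rewrite powR_gt0//= -[r]opprK powRN invf_lt1 ?powR_gt0//.
have r1 : 1 <= (2 : R) `^ (- r).
  by rewrite -[leLHS](@powRr0 _ 2) ler_powR ?ler1n// oppr_ge0 ltW.
rewrite lt_neqAle r1 andbT eq_sym powR_eq1 !negb_or.
by apply/and3P; split; [|rewrite -leNgt|rewrite oppr_eq0 lt_eqF]; lra.
Qed.

End power_functions.

Section fractional_kernel.
Context {R : realType} {N : nat}.

Definition frac_kernel (s : R) (x y : 'rV[R]_N) : R :=
  (euclidean_norm (x - y) `^ (N%:R + 2 * s))^-1.

Lemma frac_kernel_ge0 s x y : 0 <= frac_kernel s x y.
Proof. by rewrite invr_ge0 powR_ge0. Qed.

Lemma measurable_frac_kernel s :
  measurable_fun setT (fun z : 'rV[R]_N * 'rV[R]_N => frac_kernel s z.1 z.2).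
Proof.
rewrite /frac_kernel; under eq_fun do rewrite -powRN.
apply: (@measurableT_comp _ _ _ _ _ _ (fun a : R => a `^ (- (N%:R + 2 * s))) _
  (fun z : 'rV[R]_N * 'rV[R]_N => euclidean_norm (z.1 - z.2))).
  exact: measurable_powR.
apply: (@measurableT_comp _ _ _ _ _ _ (@Num.sqrt R) _
  (fun z : 'rV[R]_N * 'rV[R]_N => \sum_(i < N) (z.1 - z.2) 0 i ^+ 2)).
  by apply: continuous_measurable_fun; exact: sqrt_continuous.
apply: measurable_sum => i; apply: measurable_funX.
under eq_fun do rewrite !mxE.
apply: measurable_funB.
  exact: (measurableT_comp (measurable_coord i) measurable_fst).
exact: (measurableT_comp (measurable_coord i) measurable_snd).
Qed.

Lemma euclidean_norm_eq0 (x : 'rV[R]_N) : euclidean_norm x = 0 -> x = 0.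
Proof.
move=> /eqP; rewrite sqrtr_eq0 => h; apply/rowP => i; rewrite mxE.
have S0 : 0 <= \sum_(j < N) x 0 j ^+ 2 by apply: sumr_ge0 => j _; exact: sqr_ge0.
have /eqP : \sum_(j < N) x 0 j ^+ 2 = 0 by apply/le_anti; rewrite h S0.
rewrite psumr_eq0; last by move=> j _; exact: sqr_ge0.
by move=> /allP/(_ i); rewrite mem_index_enum sqrf_eq0 => /(_ isT)/eqP.
Qed.

Lemma euclidean_norm_le (x : 'rV[R]_N) (h : R) : 0 <= h -> (forall i, `|x 0 i| <= h) ->
  euclidean_norm x <= Num.sqrt N%:R * h.
Proof.
move=> h0 xh; rewrite /euclidean_norm -[h]ger0_norm// -sqrtr_sqr -sqrtrM ?ler0n//.
apply: ler_wsqrtr; rewrite mulr_natl -[N in _ *+ N]card_ord -sumr_const.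
apply: ler_sum => i _; rewrite -[_ ^+ 2]ger0_norm ?sqr_ge0// normrX.
by rewrite lerXn2r ?nnegrE ?normr_ge0.
Qed.

Lemma frac_kernel_ge (s : R) (x y : 'rV[R]_N) (h : R) : 0 < N%:R + 2 * s -> 0 <= h ->
  (forall i, `|(x - y) 0 i| <= h) -> x <> y ->
  1 <= (Num.sqrt N%:R * h) `^ (N%:R + 2 * s) * frac_kernel s x y.
Proof.
move=> p0 h0 xh xy.
have e0 : 0 < euclidean_norm (x - y).
  rewrite lt_neqAle sqrtr_ge0 andbT; apply/eqP => /esym/euclidean_norm_eq0/eqP.
  by rewrite subr_eq0 => /eqP.
rewrite /frac_kernel ler_pdivlMr ?powR_gt0// mul1r.
by rewrite ge0_ler_powR ?(ltW p0) ?nnegrE ?mulr_ge0 ?sqrtr_ge0// euclidean_norm_le.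
Qed.

End fractional_kernel.

Section cube_grid.
Context {R : realType} {N : nat}.
Variables (s q M : R).
Hypotheses (s0 : 0 < s) (M0 : 0 < M) (q0 : 0 < q) (qs : N%:R / (2 * s) < q).

Let side k : R := 4 * M / 2 ^+ k.
Let side_gt0 k : 0 < side k.
Proof. by rewrite divr_gt0 ?mulr_gt0// exprn_gt0. Qed.

Let pos k (x : 'rV[R]_N) i : R := (x 0 i + M) / side k.

(** The large cube has side [4 M] so that a domain contained in the open cube
    (-M, M)^N leaves a part of it free, on which functions vanish. *)
Definition cube_dom : set 'rV[R]_N := [set x | forall i, - M <= x 0 i < - M + 4 * M].

Definition cube_locate k (x : 'rV[R]_N) : {ffun 'I_N -> 'I_((2 ^ k).-1.+1)} :=
  [ffun i => inord (Num.truncn (pos k x i))].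

Definition cube_parent k (j : {ffun 'I_N -> 'I_((2 ^ k.+1).-1.+1)}) :
    {ffun 'I_N -> 'I_((2 ^ k).-1.+1)} := [ffun i => inord (j i)./2].

Let pow2K k : (2 ^ k).-1.+1 = (2 ^ k)%N.
Proof. by rewrite prednK// expn_gt0. Qed.

Let pos_ge0 k x i : cube_dom x -> 0 <= pos k x i.
Proof.
move=> /(_ i) /andP[h _]; rewrite divr_ge0 ?(ltW (side_gt0 k))//.
by rewrite -[M]opprK subr_ge0.
Qed.

Let truncn_pos k x i : cube_dom x -> (Num.truncn (pos k x i) < 2 ^ k)%N.
Proof.
move=> Dx; rewrite truncn_lt_nat ?pos_ge0// ltr_pdivrMr// natrX /side.
rewrite mulrCA divff ?mulr1 ?expf_neq0//.
by have /andP[_] := Dx i; lra.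
Qed.

Let locateE k x i : cube_dom x -> cube_locate k x i = Num.truncn (pos k x i) :> nat.
Proof. by move=> Dx; rewrite ffunE inordK// pow2K truncn_pos. Qed.

Lemma cube_cellE k j : cube_dom `&` [set x | cube_locate k x = j] =
  [set x | forall i, - M + side k * (j i)%:R <= x 0 i < - M + side k * (j i)%:R + side k].
Proof.
have hs := side_gt0 k.
apply/seteqP; split => x /=.
  move=> [Dx <-] i; rewrite locateE//.
  have := truncn_itv (pos_ge0 k i Dx).
  set n := Num.truncn _; rewrite /pos ler_pdivlMr// ltr_pdivrMr// -natr1 => /andP[h1 h2].
  by apply/andP; split; nra.
move=> H.
have Dx : cube_dom x.
  move=> i; have /andP[h1 h2] := H i.
  have j0 : (0 : R) <= (j i)%:R by rewrite ler0n.
  have jlt : (j i)%:R + 1 <= (2 ^+ k : R).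
    rewrite natr1 -natrX ler_nat; apply: leq_trans (ltn_ord (j i)) _.
    by rewrite pow2K.
  have e : side k * 2 ^+ k = 4 * M.
    by rewrite /side mulfVK// expf_neq0.
  apply/andP; split; first by apply: le_trans h1; rewrite lerDl mulr_ge0// ltW.
  apply: lt_le_trans h2 _; rewrite -addrA lerD2l -e -{2}[side k]mulr1 -mulrDr.
  by rewrite ler_wpM2l// ltW.
split => //; apply/ffunP => i; apply: val_inj; rewrite /= locateE//.
apply: truncn_def; have /andP[h1 h2] := H i.
rewrite /pos ler_pdivlMr// ltr_pdivrMr// -natr1.
by apply/andP; split; nra.
Qed.

Let cube_measurable k j :
  measurable (cube_dom `&` [set x | cube_locate k x = j]) /\
  lebesgue_rV (cube_dom `&` [set x | cube_locate k x = j]) = (side k ^+ N)%:E.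
Proof.
rewrite cube_cellE.
exact: (@lebesgue_rV_cube R N (fun i => - M + side k * (j i)%:R) (side k) (ltW (side_gt0 k))).
Qed.

Let locate_parent_ k x : cube_dom x -> cube_locate k x = cube_parent (cube_locate k.+1 x).
Proof.
move=> Dx; apply/ffunP => i; apply: val_inj; rewrite /= locateE// ffunE.
have e : pos k.+1 x i = 2 * pos k x i.
  by rewrite /pos /side exprS; field; rewrite expf_neq0//= gt_eqF.
have := truncn_itv (pos_ge0 k.+1 i Dx); have := locateE k.+1 i Dx.
move: (cube_locate k.+1 x i) => n /= <-; rewrite e => /andP[h1 h2].
have hn : (n./2 < 2 ^ k)%N.
  rewrite ltn_half_double -mul2n -expnS; apply: leq_trans (ltn_ord n) _.
  by rewrite pow2K.
rewrite inordK; last by rewrite (pow2K k).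
apply: truncn_def; move: (nat_of_ord n) h1 h2 => {hn}n h1 h2.
have a1 : (n./2%:R : R) * 2 <= n%:R.
  by rewrite -natrM ler_nat muln2 -[leqRHS]odd_double_half leq_addl.
have a2 : (n.+1%:R : R) <= n./2.+1%:R * 2.
  by rewrite -natrM ler_nat muln2 doubleS ltnS -[leqLHS]odd_double_half -[leqRHS]add1n leq_add2r leq_b1.
by apply/andP; split; nra.
Qed.

Let single_root_ (i j : {ffun 'I_N -> 'I_((2 ^ 0).-1.+1)}) : i = j.
Proof. by apply/ffunP => a; move: (i a) (j a) => b c; rewrite (ord1 b) (ord1 c). Qed.

Let p := N%:R + 2 * s.
Let p_gt0 : 0 < p.
Proof. by rewrite ltr_wpDl ?ler0n// mulr_gt0. Qed.
Let osc : R := Num.sqrt N%:R `^ p * (4 * M) `^ (2 * s).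
Let dec : R := 2 `^ (- (2 * s)).
Let gro : R := 2 `^ (N%:R / q).

Let kernel_ k x y : cube_dom x -> cube_dom y -> cube_locate k x = cube_locate k y ->
  x <> y -> 1 <= (osc * dec ^+ k * side k ^+ N) * frac_kernel s x y.
Proof.
move=> Dx Dy lxy xy.
have hs := side_gt0 k.
have -> : osc * dec ^+ k * side k ^+ N = (Num.sqrt N%:R * side k) `^ p.
  rewrite powRM ?sqrtr_ge0 ?(ltW hs)// /osc -!mulrA; congr (_ * _).
  rewrite /p powRD; last by rewrite (gt_eqF hs) implybT.
  rewrite powR_mulrn ?(ltW hs)// mulrA mulrC; congr (_ * _).
  by rewrite /side powR_div_expn// mulr_ge0// ltW.
apply: frac_kernel_ge => //; first exact: ltW.
move=> i; rewrite !mxE.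
have cx : (cube_dom `&` [set x' | cube_locate k x' = cube_locate k y]) x by [].
have cy : (cube_dom `&` [set x' | cube_locate k x' = cube_locate k y]) y by [].
rewrite cube_cellE in cx; rewrite cube_cellE in cy.
have /andP[x1 x2] := cx i; have /andP[y1 y2] := cy i.
by rewrite ler_norml; apply/andP; split; lra.
Qed.

Let dec_bounds : 0 < dec < 1.
Proof. by apply: powR2_neg_bounds; rewrite oppr_lt0 mulr_gt0. Qed.

Let gro_ge1 : 1 <= gro.
Proof.
rewrite /gro -[leLHS](@powRr0 _ 2) ler_powR ?ler1n// divr_ge0 ?ler0n//.
exact: ltW.
Qed.

Let dec_gro : dec * gro < 1.
Proof.
rewrite /dec /gro -powRD; last by rewrite pnatr_eq0 implybT.
suff h : - (2 * s) + N%:R / q < 0 by case/andP: (powR2_neg_bounds h).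
have s2 : 0 < 2 * s by rewrite mulr_gt0.
by move: qs; rewrite addrC subr_lt0 !ltr_pdivrMr// mulrC.
Qed.

(** Halving the side multiplies the oscillation bound by [2^(-2s)] and the
    concentration of L^q weights by [2^(N/q)]; the product of the two rates is less
    than 1 exactly when [N / (2s) < q]. *)
Definition cube_grid : grid (@lebesgue_rV R N) (frac_kernel s) :=
  @Grid _ 'rV[R]_N R (@lebesgue_rV R N) (frac_kernel s) cube_dom
    (fun k => {ffun 'I_N -> 'I_((2 ^ k).-1.+1)} : finType) cube_locate cube_parent
    (fun k => side k ^+ N) osc dec gro
    (fun k j => (cube_measurable j).1) locate_parent_ single_root_
    (fun k => exprn_gt0 N (side_gt0 k)) (fun k j => (cube_measurable j).2)
    (mulr_ge0 (powR_ge0 _ _) (powR_ge0 _ _)) kernel_ dec_bounds gro_ge1 dec_gro.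

End cube_grid.

(** Hoelder against the indicator of [A]. *)
Lemma integral_le_Lnorm d (T : measurableType d) (R : realType)
    (mu : {measure set T -> \bar R}) (A : set T) (w : T -> R) (q m W : R) :
  measurable A -> mu A = m%:E -> measurable_fun setT w -> (forall x, 0 <= w x) ->
  1 < q -> ('N[mu]_q%:E[EFin \o w] <= W%:E)%E ->
  (\int[mu]_(x in A) (w x)%:E <= (W * m `^ (1 - q^-1))%:E)%E.
Proof.
move=> mA muA mw w0 q1 wW.
have q0 : 0 < q by exact: lt_trans q1.
pose q' := (1 - q^-1)^-1.
have q'0 : 0 < q' by rewrite invr_gt0 subr_gt0 invf_lt1.
have mI : measurable_fun setT (\1_A : T -> R) by exact: measurable_indic.
have cj : q^-1 + q'^-1 = 1 by rewrite /q' invrK addrC subrK.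
have := hoelder mu mw mI q0 q'0 cj.
rewrite Lnorm1 (_ : (\int[mu]_x `|(EFin \o (w \* \1_A)%R) x|)%E =
    (\int[mu]_(x in A) (w x)%:E)%E); last first.
  rewrite [RHS]integral_mkcond; apply: eq_integral => x _.
  rewrite /= patchE indicE; case: ifP => _; rewrite ?mulr1 ?mulr0 ?normr0//.
  by rewrite ger0_norm.
move=> /le_trans; apply.
rewrite (_ : ('N[mu]_q'%:E[EFin \o \1_A])%E = (m `^ (1 - q^-1))%:E).
  by rewrite EFinM lee_wpmul2r// lee_fin powR_ge0.
rewrite unlock /= /q' invrK (_ : (\int[mu]_x (`|(\1_A x)%:E| `^ (1 - q^-1)^-1))%E = mu A).
  by rewrite muA poweR_EFin.
transitivity (\int[mu]_x (\1_A x)%:E)%E; last by rewrite integral_indic// setIT.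
apply: eq_integral => x _; rewrite indicE; case: (x \in A) => /=.
  by rewrite normr1 powR1.
by rewrite normr0 powR0// gt_eqF.
Qed.

Section cube_grid_theory.
Context {R : realType} {N : nat}.
Variables (s q M : R).
Hypotheses (N1 : (0 < N)%N) (s0 : 0 < s) (M0 : 0 < M) (q1 : 1 < q)
  (qs : N%:R / (2 * s) < q).
Let q0 : 0 < q := lt_trans ltr01 q1.
Local Notation G := (cube_grid s0 M0 q0 qs).

Lemma cube_grid_weight (w : 'rV[R]_N -> R) (W : R) : measurable_fun setT w -> (forall x, 0 <= w x) ->
  ('N[@lebesgue_rV R N]_q%:E[EFin \o w] <= W%:E)%E ->
  grid_weight G (W * (4 * M) `^ (- (N%:R / q))) w.
Proof.
move=> mw w0 wW; split => // k i.
have h0 : 0 < 4 * M / 2 ^+ k by rewrite divr_gt0 ?mulr_gt0// exprn_gt0.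
apply: le_trans (integral_le_Lnorm (measurable_cell i) (mu_cell i) mw w0 q1 wW) _.
rewrite lee_fin /= powRB; last by rewrite expf_neq0 ?implybT// gt_eqF.
rewrite powRr1 ?exprn_ge0 ?(ltW h0)// -powRN.
rewrite -[X in X `^ _]powR_mulrn ?(ltW h0)// -powRrM mulrN.
rewrite powR_div_expn ?mulr_ge0 ?(ltW M0)// opprK.
by rewrite le_eqVlt; apply/orP; left; apply/eqP; ring.
Qed.

Lemma cube_dom_sub (Omega : set 'rV[R]_N) :
  (forall x, Omega x -> forall i, `|x 0 i| < M) -> Omega `<=` cube_dom M.
Proof.
move=> OM x Ox i; have := OM _ Ox i; rewrite ltr_norml => /andP[h1 h2].
by apply/andP; split; lra.
Qed.

(** An open set is the union of the dyadic cubes that it contains. *)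
Lemma open_measurable_rV (Omega : set 'rV[R]_N) : open Omega ->
  Omega `<=` cube_dom M -> measurable Omega.
Proof.
move=> oO OD.
pose C k (j : cell_index G k) := if pselect (cell j `<=` Omega) is left _ then cell j else set0.
rewrite (_ : Omega = \bigcup_k \big[setU/set0]_(j <- enum (cell_index G k)) C k j).
  apply: bigcupT_measurable => k; apply: bigsetU_measurable => j _.
  by rewrite /C; case: pselect => // _; exact: measurable_cell.
apply/seteqP; split => [x Ox|x [k _]]; last first.
  by rewrite -bigcup_seq => -[j _]; rewrite /C; case: pselect => // h; exact: h.
have /nbhs_ballP[e /= e0 be] : nbhs x Omega by exact: open_nbhs_nbhs.
have hb : 0 < (2^-1 : R) < 1 by apply/andP; split; lra.
have e2 : 0 < e / 2 by rewrite divr_gt0.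
have [k hk] := geometric_small (4 * M) hb e2.
exists k => //; rewrite -bigcup_seq; exists (locate G k x); first by rewrite /= mem_enum.
rewrite /C; case: pselect => [_|nh]; first by split => //; exact: OD.
exfalso; apply: nh => y cy; apply: be; split => // a i; rewrite (ord1 a).
have cx : cell (locate G k x) x by split => //; exact: OD.
move: cy cx; have -> : cell (locate G k x) = _ := cube_cellE M0 (cube_locate M k x).
move=> cy cx.
have /andP[x1 x2] := cx i; have /andP[y1 y2] := cy i.
rewrite exprVn in hk.
by rewrite /ball /= ltr_norml; apply/andP; split; lra.
Qed.

Lemma cube_zero_set : exists Z : set 'rV[R]_N, exists2 z : R, 0 < z &
  [/\ measurable Z, Z `<=` cube_dom M, lebesgue_rV Z = z%:E &
      forall x, Z x -> ~ forall i, `|x 0 i| < M].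
Proof.
have [|mZ Zz] := @lebesgue_rV_cube R N (fun=> M) (2 * M).
  by rewrite mulr_ge0// ltW.
exists [set x | forall i, M <= x 0 i < M + 2 * M], ((2 * M) ^+ N).
  by rewrite exprn_gt0// mulr_gt0.
split => //.
  by move=> x Zx i; have /andP[h1 h2] := Zx i; have := M0 => ?; apply/andP; split; lra.
move=> x Zx /(_ (Ordinal N1)); have /andP[h1 _] := Zx (Ordinal N1).
by rewrite ltNge (le_trans h1)// ler_norm.
Qed.

End cube_grid_theory.

Lemma bounded_rV (R : realType) N (Omega : set 'rV[R]_N) : bounded_set Omega ->
  exists2 M : R, 0 < M & forall x, Omega x -> forall i, `|x 0 i| < M.
Proof.
move=> [A [_ hA]]; pose M := `|A| + 1.
exists (M + 1) => [|x Ox i]; first by rewrite /M -addrA ltr_wpDl.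
have := hA M; rewrite /M => /(_ _) /(_ x Ox) h.
have {}h : `|x| <= `|A| + 1 by apply: h; rewrite (le_lt_trans (ler_norm A))// ltrDl.
apply: (@le_lt_trans _ _ `|x|); last by rewrite (le_lt_trans h)// ltrDl.
rewrite [leRHS]mx_normrE; exact: (le_bigmax _ (fun ij : 'I_1 * 'I_N => `|x ij.1 ij.2|) (0, i)).
Qed.

(** * Weighted quadratic forms *)

(** For every [t > 0], [`|u^2 - v^2| <= t^-1 (u - v)^2 + t (u^2 + v^2)]; a small [t] will be
    balanced against the speed of convergence of [u - v]. *)
Lemma quadratic_form_close d (T : measurableType d) (R : realType)
    (mu : {measure set T -> \bar R}) (A : set T) (g u v : T -> R) (t F eta : R) :
  measurable A -> measurable_fun A g -> measurable_fun A u -> measurable_fun A v ->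
  0 < t ->
  mu.-integrable A (fun x => (g x * `|u x| ^+ 2)%:E) ->
  mu.-integrable A (fun x => (g x * `|v x| ^+ 2)%:E) ->
  (\int[mu]_(x in A) (`|g x| * u x ^+ 2)%:E <= F%:E)%E ->
  (\int[mu]_(x in A) (`|g x| * v x ^+ 2)%:E <= F%:E)%E ->
  (\int[mu]_(x in A) (`|g x| * (u x - v x) ^+ 2)%:E <= eta%:E)%E ->
  `|\int[mu]_(x in A) (g x * `|u x| ^+ 2) - \int[mu]_(x in A) (g x * `|v x| ^+ 2)| <=
  t^-1 * eta + t * (2 * F).
Proof.
move=> mA mg mu_ mv t0 ifu ifv fu fv gd.
have mng : measurable_fun A (fun x => `|g x|) by exact: measurableT_comp.
have mS : measurable_fun A (fun x => `|g x| * (u x ^+ 2 + v x ^+ 2)).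
  by apply: measurable_funM => //; apply: measurable_funD; exact: measurable_funX.
have mD : measurable_fun A (fun x => `|g x| * `|u x ^+ 2 - v x ^+ 2|).
  apply: measurable_funM => //; apply: measurableT_comp => //.
  by apply: measurable_funB; exact: measurable_funX.
have fS : (\int[mu]_(x in A) (`|g x| * (u x ^+ 2 + v x ^+ 2))%:E <= (2 * F)%:E)%E.
  rewrite mulr2n mulrDl; apply: (@integral_le_lincomb _ _ _ mu A _
    (fun x => `|g x| * u x ^+ 2) (fun x => `|g x| * v x ^+ 2)) => //.
  - by apply: measurable_funM => //; exact: measurable_funX.
  - by apply: measurable_funM => //; exact: measurable_funX.
  - by move=> x _; rewrite mulr_ge0// addr_ge0// sqr_ge0.
  - by move=> x _; rewrite mulr_ge0// sqr_ge0.
  - by move=> x _; rewrite mulr_ge0// sqr_ge0.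
  - by move=> x _; rewrite !mul1r mulrDr.
have iD : mu.-integrable A (EFin \o (fun x => g x * `|u x| ^+ 2 - g x * `|v x| ^+ 2)).
  exact: (integrableB mA ifu ifv).
rewrite -RintegralB//.
apply: le_trans (le_normr_Rintegral mA iD) _.
rewrite -lee_fin fineK; last first.
  by apply: integrable_fin_num => //; exact: (integrable_norm iD).
apply: (@le_trans _ _ (\int[mu]_(x in A) (`|g x| * `|u x ^+ 2 - v x ^+ 2|)%:E)%E).
  rewrite le_eqVlt; apply/orP; left; apply/eqP; apply: eq_integral => x _ /=.
  by rewrite -!normrX !(ger0_norm (sqr_ge0 _)) -mulrBr normrM.
apply: (@integral_le_lincomb _ _ _ mu A _
  (fun x => `|g x| * (u x - v x) ^+ 2) (fun x => `|g x| * (u x ^+ 2 + v x ^+ 2))) => //.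
- by apply: measurable_funM => //; apply: measurable_funX; exact: measurable_funB.
- by rewrite invr_ge0 ltW.
- exact: ltW.
- by move=> x _; rewrite mulr_ge0// sqr_ge0.
- by move=> x _; rewrite mulr_ge0// addr_ge0// sqr_ge0.
move=> x _; rewrite !(mulrCA _ `|g x|) -mulrDr ler_wpM2l//.
rewrite -(ler_pM2l (_ : 0 < 2 * t)) ?mulr_gt0//.
rewrite mulrDr mulrA -[2 * t * t^-1]mulrA divff ?gt_eqF// mulr1.
rewrite subr_sqr normrM.
have h : (`|u x - v x| - t * `|u x + v x|) ^+ 2 >= 0 by exact: sqr_ge0.
have hu := real_normK (num_real (u x - v x)).
have hv := real_normK (num_real (u x + v x)).
have h3 : 0 <= t ^+ 2 * (u x - v x) ^+ 2 by rewrite mulr_ge0 ?sqr_ge0.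
set a := `|u x - v x| in h hu *; set b := `|u x + v x| in h hv *.
nra.
Qed.

Section fractional_forms.
Context {R : realType} {N : nat}.
Variables (s q M : R) (Omega : set 'rV[R]_N).
Hypotheses (s0 : 0 < s) (M0 : 0 < M) (q1 : 1 < q)
  (qs : N%:R / (2 * s) < q).
Hypothesis OM : forall x, Omega x -> forall i, `|x 0 i| < M.
Hypothesis mO : measurable Omega.
Implicit Types (u v g V : 'rV[R]_N -> R).

Local Notation mu := (@lebesgue_rV R N).
Local Notation K := (frac_kernel s).
Let q0 : 0 < q := lt_trans ltr01 q1.
Let G := cube_grid s0 M0 q0 qs.
Let OB : Omega `<=` grid_dom G := cube_dom_sub OM.
Let mB : measurable (grid_dom G) := measurable_grid_dom G.

Lemma gagliardoE u : gagliardo s u = (energy mu K u `^ 2^-1)%E.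
Proof. by []. Qed.

Lemma energy_ge0 u : (0 <= energy mu K u)%E.
Proof.
by apply: integral_ge0 => y _; apply: integral_ge0 => x _;
  rewrite lee_fin energy_density_ge0// => *; exact: frac_kernel_ge0.
Qed.

Lemma fine_gagliardo_sqr u : fine (gagliardo s u) ^+ 2 = fine (energy mu K u).
Proof.
rewrite gagliardoE fine_poweR -powR_mulrn ?powR_ge0// -powRrM mulVf ?powRr1//.
exact/fine_ge0/energy_ge0.
Qed.

Lemma gagliardo_lty u : (gagliardo s u < +oo)%E = (energy mu K u < +oo)%E.
Proof.
rewrite gagliardoE; apply/idP/idP; last exact: poweR_lty.
by apply: lty_poweRy; rewrite invr_eq0.
Qed.

Lemma mu_Omega_fin : exists m : R, mu Omega = m%:E.
Proof.
exists (fine (mu Omega)); rewrite fineK// ge0_fin_numE//.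
apply: (@le_lt_trans _ _ (mu (grid_dom G))).
  by apply: le_measure; rewrite ?inE.
rewrite -[grid_dom G]setIid.
have -> : grid_dom G `&` grid_dom G = cell (locate G 0 (point : 'rV[R]_N)).
  rewrite setIid; apply/seteqP; split => [x Bx|x []//]; split => //=.
  exact: (@single_root _ _ _ _ _ G).
by rewrite [X in (X < _)%E]mu_cell ltry.
Qed.

Lemma normOnE p f : 0 < p ->
  normOn Omega p f = ((\int[mu]_(x in Omega) (`|f x| `^ p)%:E) `^ p^-1)%E.
Proof.
move=> p0; rewrite /normOn unlock /=; congr (_ `^ _)%E.
rewrite [RHS]integral_mkcond; apply: eq_integral => x _ /=.
rewrite !patchE; case: ifP => // _.
by rewrite normr0 powR0 ?gt_eqF.
Qed.

Lemma normOn_equimeasurable (phi : R -> R) f g : measurable_fun setT phi ->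
  measurable_fun Omega f -> equimeasurable mu Omega f g ->
  normOn Omega q (phi \o g) = normOn Omega q (phi \o f).
Proof.
move=> mphi mf fg; rewrite !(normOnE _ q0); congr (_ `^ _)%E.
have [m muO] := mu_Omega_fin.
apply: (@equimeasurable_integral _ _ _ mu Omega f g (fun r => (`|phi r| `^ q)%:E)) => //.
- by rewrite [X in (X < _)%E]muO ltry.
- apply/measurable_EFinP; apply: (@measurableT_comp _ _ _ _ _ _ (fun a : R => a `^ q)).
    exact: measurable_powR.
  exact: measurableT_comp.
Qed.

Let cM := (4 * M) `^ (- (N%:R / q)).

Lemma weight_rV g (W : R) : measurable_fun Omega g -> (normOn Omega q g <= W%:E)%E ->
  grid_weight G (W * cM) (fun x => `|(g \_ Omega) x|).
Proof.
move=> mg gW.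
have mw : measurable_fun setT (g \_ Omega) by apply/(measurable_restrictT g mO).
have mnw : measurable_fun setT (fun x : 'rV[R]_N => `|(g \_ Omega) x|).
  by apply: measurableT_comp; [exact: normr_measurable|exact: mw].
apply: (cube_grid_weight s0 M0 q1 qs mnw (fun x => normr_ge0 _)).
apply: le_trans gW; rewrite le_eqVlt; apply/orP; left; apply/eqP.
rewrite /normOn -[RHS]Lnorm_abse; congr Lnorm.body.
Qed.

Lemma normOn_ge0 g : (0 <= normOn Omega q g)%E.
Proof. exact: Lnorm_ge0. Qed.

Variables (Z : set 'rV[R]_N) (z : R).
Hypotheses (z0 : 0 < z) (mZ : measurable Z) (ZB : Z `<=` cube_dom M)
  (muZ : mu Z = z%:E) (ZM : forall x, Z x -> ~ forall i, `|x 0 i| < M).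

Let ZO x : Z x -> ~ Omega x. Proof. by move=> Zx Ox; apply: (ZM Zx); exact: OM. Qed.
Let zZ : (z%:E <= mu Z)%E. Proof. by rewrite muZ. Qed.

Definition supported u := measurable_fun setT u /\ {ae mu, forall x, ~ Omega x -> u x = 0}.

Let form := form_cst G z.

Lemma integral_weight g (f : 'rV[R]_N -> R) :
  (\int[mu]_(x in grid_dom G) (`|(g \_ Omega) x| * f x)%:E =
   \int[mu]_(x in Omega) (`|g x| * f x)%:E)%E.
Proof.
rewrite [LHS]integral_mkcond [RHS]integral_mkcond; apply: eq_integral => x _.
rewrite !patchE; have [xO|xO] := boolP (x \in Omega).
  by rewrite mem_set//; apply: OB; rewrite inE in xO.
by rewrite normr0 mul0r; case: ifP.
Qed.

Lemma form_rV g u (W E : R) : measurable_fun Omega g -> (normOn Omega q g <= W%:E)%E ->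
  0 <= W -> supported u -> 0 <= E -> (energy mu K u <= E%:E)%E ->
  (\int[mu]_(x in Omega) (`|g x| * u x ^+ 2)%:E <= (form * (W * cM) * E)%:E)%E.
Proof.
move=> mg gW W0 [mu_ uO] E0 uE; rewrite -integral_weight.
apply: (@weighted_form_le _ _ _ _ _ (@frac_kernel_ge0 R N s) (measurable_frac_kernel s)
  G Z z mZ ZB z0 zZ u E (W * cM) _ mu_ E0 uE).
- by apply: (filterS _ uO) => x h Zx; apply: h; exact: ZO.
- by rewrite mulr_ge0// powR_ge0.
- exact: weight_rV.
Qed.

Lemma integrable_form g u (W E : R) : measurable_fun Omega g -> (normOn Omega q g <= W%:E)%E ->
  0 <= W -> supported u -> 0 <= E -> (energy mu K u <= E%:E)%E ->
  mu.-integrable Omega (fun x => (g x * `|u x| ^+ 2)%:E).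
Proof.
move=> mg gW W0 su E0 uE; have [mu_ uO] := su.
have muO : measurable_fun Omega u by exact: measurable_funTS.
have mnu : measurable_fun Omega (fun x => `|u x|).
  apply: measurableT_comp; [exact: normr_measurable|exact: muO].
have mu2 : measurable_fun Omega (fun x => `|u x| ^+ 2) by exact: measurable_funX.
apply/integrableP; split.
  by apply/measurable_EFinP; exact: (measurable_funM mg mu2).
apply: le_lt_trans (ltry (form * (W * cM) * E)).
apply: le_trans (form_rV mg gW W0 su E0 uE).
rewrite le_eqVlt; apply/orP; left; apply/eqP; apply: eq_integral => x _ /=.
by rewrite normrM -normrX normr_id (ger0_norm (sqr_ge0 _)).
Qed.

Lemma integrable_Lq g (W : R) : measurable_fun Omega g -> (normOn Omega q g <= W%:E)%E ->
  mu.-integrable Omega (EFin \o g).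
Proof.
move=> mg gW; have [m muO] := mu_Omega_fin; apply/integrableP; split.
  exact/measurable_EFinP.
apply: le_lt_trans (ltry (W * m `^ (1 - q^-1))).
have mgO : measurable_fun setT (fun x => `|(g \_ Omega) x|).
  by apply: measurableT_comp => //; apply/(measurable_restrictT g mO).
apply: le_trans (@integral_le_Lnorm _ _ _ mu Omega (fun x => `|(g \_ Omega) x|) q m W _ _ _ _ _ _) => //.
  rewrite le_eqVlt; apply/orP; left; apply/eqP; apply: eq_integral => x xO /=.
  by rewrite patchE xO.
by rewrite -[X in (X <= _)%E](Lnorm_abse mu) in gW.
Qed.

Local Notation I g u := (\int[mu]_(x in Omega) (g x * `|u x| ^+ 2)).

Lemma form_close g u v (W E t eta : R) :
  measurable_fun Omega g -> (normOn Omega q g <= W%:E)%E -> 0 <= W ->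
  supported u -> supported v -> 0 <= E -> (energy mu K u <= E%:E)%E ->
  (energy mu K v <= E%:E)%E -> 0 < t ->
  (\int[mu]_(x in grid_dom G) (`|(g \_ Omega) x| * (u x - v x) ^+ 2)%:E <= eta%:E)%E ->
  `|I g u - I g v| <= t^-1 * eta + t * (2 * (form * (W * cM) * E)).
Proof.
move=> mg gW W0 su sv E0 uE vE t0; rewrite integral_weight => gd.
have muO : measurable_fun Omega u by case: su => mu_ _; exact: measurable_funTS.
have mvO : measurable_fun Omega v by case: sv => mv_ _; exact: measurable_funTS.
exact: (quadratic_form_close mO mg muO mvO t0 (integrable_form mg gW W0 su E0 uE)
  (integrable_form mg gW W0 sv E0 vE) (form_rV mg gW W0 su E0 uE)
  (form_rV mg gW W0 sv E0 vE) gd).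
Qed.

Lemma H0s_supported u : H0s s Omega u -> supported u /\ (energy mu K u < +oo)%E.
Proof.
move=> [[u2 uG] uO]; rewrite -gagliardo_lty; split => //; split => //.
by have := sub_Lfun_mfun u2; rewrite inE.
Qed.

Lemma supported_H0s u : supported u -> (energy mu K u < +oo)%E -> H0s s Omega u.
Proof.
move=> su uoo; have [mu_ uO] := su; split; last exact: uO.
split; last by rewrite gagliardo_lty.
rewrite inE/=; apply/andP; split; first by rewrite inE.
rewrite inE/= /finite_norm unlock /=.
apply: poweR_lty.
have [m muO] := mu_Omega_fin.
have E0 : 0 <= fine (energy mu K u) by exact/fine_ge0/energy_ge0.
have EE : (energy mu K u <= (fine (energy mu K u))%:E)%E.
  by rewrite fineK// ge0_fin_numE ?energy_ge0.
have m1 : (normOn Omega q (fun _ : 'rV[R]_N => 1%R) <= (m `^ q^-1)%:E)%E.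
  rewrite (normOnE _ q0) normr1 powR1 integral_cst// mul1e.
  by rewrite [X in (X `^ _)%E]muO poweR_EFin.
have m1O : measurable_fun Omega (fun _ : 'rV[R]_N => 1 : R) by exact: measurable_cst.
have := form_rV m1O m1 (powR_ge0 _ _) su E0 EE.
move=> /le_lt_trans => /(_ _ (ltry _)); apply: le_lt_trans.
rewrite le_eqVlt; apply/orP; left; apply/eqP; rewrite [RHS]integral_mkcond.
apply: ae_eq_integral; first exact: measurableT.
- apply/measurable_EFinP; apply: (@measurableT_comp _ _ _ _ _ _ (fun a : R => a `^ 2)).
    exact: measurable_powR.
  by apply: measurableT_comp; [exact: normr_measurable|exact: mu_].
- apply/(measurable_restrictT _ mO); apply/measurable_EFinP; apply: measurable_funM.
    by apply: measurableT_comp; [exact: normr_measurable|exact: m1O].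
  by apply: measurable_funX; exact: measurable_funTS.
apply: (filterS _ uO) => x ux _; rewrite /= patchE; case: ifPn => xO.
  by rewrite normr1 mul1r powR_mulrn// real_normK ?num_real.
by rewrite ux; [rewrite normr0 powR0|move: xO; rewrite notin_setE].
Qed.

End fractional_forms.

(** * Coercivity *)

Lemma weighted_hoelder d (T : measurableType d) (R : realType)
    (mu : {measure set T -> \bar R}) (A : set T) (f u : T -> R) (q p : R) :
  measurable A -> measurable_fun A f -> measurable_fun A u ->
  0 < q -> 0 < p -> q^-1 + p^-1 = 1 ->
  (\int[mu]_(x in A) (`|f x| * `|u x| ^+ 2)%:E <=
   (\int[mu]_(x in A) (`|f x| `^ q)%:E) `^ q^-1 *
   ((\int[mu]_(x in A) (`|u x| `^ (2 * p))%:E) `^ (2 * p)^-1) `^ 2)%E.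
Proof.
move=> mA mf mu_ q0 p0 cj.
pose f0 := (fun x => `|f x|) \_ A; pose u0 := (fun x => `|u x| ^+ 2) \_ A.
have mf0 : measurable_fun setT f0.
  by apply/(measurable_restrictT _ mA); exact: measurableT_comp.
have mu0 : measurable_fun setT u0.
  by apply/(measurable_restrictT _ mA); apply: measurable_funX; exact: measurableT_comp.
have := hoelder mu mf0 mu0 q0 p0 cj; rewrite Lnorm1.
have -> : (\int[mu]_x `|(EFin \o (f0 \* u0)%R) x|)%E =
    (\int[mu]_(x in A) (`|f x| * `|u x| ^+ 2)%:E)%E.
  rewrite [RHS]integral_mkcond; apply: eq_integral => x _.
  rewrite /= /f0 /u0 !patchE; case: ifP => _; rewrite ?mulr0 ?normr0//.
  by rewrite ger0_norm// mulr_ge0// exprn_ge0.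
move=> /le_trans; apply; rewrite le_eqVlt; apply/orP; left; apply/eqP.
rewrite -poweRrM (_ : (2 * p)^-1 * 2 = p^-1); last first.
  by rewrite invfM mulrAC mulVf ?mul1r.
have fE : (\int[mu]_x (`|f0 x| `^ q)%:E = \int[mu]_(x in A) (`|f x| `^ q)%:E)%E.
  rewrite [RHS]integral_mkcond; apply: eq_integral => x _.
  by rewrite /f0 !patchE; case: ifP => _; rewrite ?normr_id// normr0 powR0 ?gt_eqF.
have uE : (\int[mu]_x (`|u0 x| `^ p)%:E = \int[mu]_(x in A) (`|u x| `^ (2 * p))%:E)%E.
  rewrite [RHS]integral_mkcond; apply: eq_integral => x _.
  rewrite /u0 !patchE; case: ifP => _; last by rewrite normr0 powR0 ?gt_eqF.
  by rewrite (ger0_norm (exprn_ge0 _ _))// -powR_mulrn// -powRrM.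
by rewrite -fE -uE unlock.
Qed.

Section coercivity.
Context {R : realType} {N : nat}.
Variables (s q : R) (Omega : set 'rV[R]_N).
Hypotheses (mO : measurable Omega) (q1 : 1 < q).
Local Notation mu := (@lebesgue_rV R N).
Local Notation K := (frac_kernel s).
Local Notation C := (embedding_cst s Omega (2 * (q / (q - 1)))).

(** The condition on a constant is closed, so that the infimum is itself admissible.
    If no constant is admissible, or if they are unbounded below, then the infimum
    has its default value 0. *)
Lemma embedding_cst_le u : H0s s Omega u -> C != 0 ->
  (normOn Omega (2 * (q / (q - 1))) u <= (C * fine (gagliardo s u))%:E)%E.
Proof.
move=> Hu C0; have [hC|nC] := pselect (has_inf [set c : R | forall u, H0s s Omega u ->
    (normOn Omega (2 * (q / (q - 1))) u <= c%:E * gagliardo s u)%E]); last first.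
  by move: C0; rewrite /embedding_cst inf_out ?eqxx.
have gfin : gagliardo s u = (fine (gagliardo s u))%:E.
  rewrite fineK// ge0_fin_numE ?poweR_ge0//; by case: Hu => -[].
have g0 : 0 <= fine (gagliardo s u) by rewrite fine_ge0// poweR_ge0.
apply: le_ereal_of_eps => e e0; set r := fine _ in gfin g0 *.
have er : 0 < e / (r + 1) by rewrite divr_gt0// ltr_wpDl.
have [c /(_ _ Hu) uc cC] := inf_adherent er hC.
apply: le_trans uc _; rewrite gfin -EFinM lee_fin.
apply: (@le_trans _ _ ((C + e / (r + 1)) * r)); first by rewrite ler_wpM2r// ltW.
rewrite mulrDl lerD2l mulrAC ler_pdivrMr ?ltr_wpDl//.
by rewrite ler_wpM2l ?ltW// ltrDl.
Qed.

(** Hoelder and the embedding give [I V^- u <= |V^-|_q C^2 [u]^2]. If [C = 0] the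
    hypothesis forces [V^-] to be 0 almost everywhere, because [a / 0 = 0]. *)
Lemma form_lower (V u : 'rV[R]_N -> R) (a : R) : 0 <= a -> measurable_fun Omega V -> H0s s Omega u ->
  mu.-integrable Omega (fun x => (V x * `|u x| ^+ 2)%:E) ->
  (normOn Omega q (V^\-)%R <= (a / C ^+ 2)%:E)%E ->
  - (a * fine (energy mu K u)) <= \int[mu]_(x in Omega) (V x * `|u x| ^+ 2).
Proof.
move=> a0 mV Hu iV Vn.
have q0 : 0 < q by exact: lt_trans q1.
have q'0 : 0 < q / (q - 1) by rewrite divr_gt0// subr_gt0.
have p0 : 0 < 2 * (q / (q - 1)) by rewrite mulr_gt0.
have cj : q^-1 + (q / (q - 1))^-1 = 1.
  by rewrite invf_div -[X in X + _]mul1r -mulrDl addrC subrK divff// gt_eqF.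
have [[mu_ _] uoo] := H0s_supported Hu.
have E0 : 0 <= fine (energy mu K u) by exact/fine_ge0/energy_ge0.
have muO : measurable_fun Omega u by exact: measurable_funTS.
have mVn : measurable_fun Omega (V^\-)%R.
  by apply: measurable_funrneg.
have neg_le : (\int[mu]_(x in Omega) (`|(V^\-)%R x| * `|u x| ^+ 2)%:E <=
    (a * fine (energy mu K u))%:E)%E.
  apply: le_trans (weighted_hoelder mu mO mVn muO q0 q'0 cj) _.
  rewrite -(normOnE Omega (V^\-)%R q0) -(normOnE Omega u p0).
  have [C0|C0] := eqVneq C 0.
    have -> : normOn Omega q (V^\-)%R = 0%E.
      apply/eqP; rewrite eq_le Lnorm_ge0 andbT.
      by rewrite C0 expr0n invr0 mulr0 in Vn.
    by rewrite mul0e lee_fin mulr_ge0.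
  have uC := embedding_cst_le Hu C0.
  apply: (@le_trans _ _ ((a / C ^+ 2)%:E * ((C * fine (gagliardo s u))%:E `^ 2))%E).
    apply: lee_pmul => //; first exact: Lnorm_ge0.
      exact: poweR_ge0.
    apply: gt0_ler_poweR; rewrite ?in_itv/= ?leey ?andbT//.
      exact: Lnorm_ge0.
    by apply: le_trans uC; exact: Lnorm_ge0.
  rewrite poweR_EFin -EFinM lee_fin powR_mulrn; last first.
    by rewrite -lee_fin; apply: le_trans uC; exact: Lnorm_ge0.
  rewrite -fine_gagliardo_sqr le_eqVlt; apply/orP; left; apply/eqP.
  by move: C0 (fine _); move: C => c c0 r; field.
have iN : mu.-integrable Omega (EFin \o (fun x => `|(V^\-)%R x| * `|u x| ^+ 2)).
  apply/integrableP; split.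
    apply/measurable_EFinP; apply: measurable_funM.
      by apply: measurableT_comp; [exact: normr_measurable|exact: mVn].
    apply: measurable_funX.
    by apply: measurableT_comp; [exact: normr_measurable|exact: muO].
  apply: le_lt_trans (ltry (a * fine (energy mu K u))).
  apply: le_trans neg_le; rewrite le_eqVlt; apply/orP; left; apply/eqP.
  apply: eq_integral => x _ /=.
  by rewrite normrM normr_id -normrX normr_id.
apply: (@le_trans _ _ (- \int[mu]_(x in Omega) (`|(V^\-)%R x| * `|u x| ^+ 2))).
  by rewrite lerN2 -lee_fin fineK//; exact: integrable_fin_num.
rewrite -[X in - X <= _]mul1r -mulNr -RintegralZl//; apply: le_Rintegral => //.
  exact: (integrableZl mO (-1) iN).
move=> x _; rewrite mulN1r -mulNr ler_wpM2r ?exprn_ge0//.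
by rewrite ger0_norm ?funrneg_ge0// lerNl /funrneg le_max lexx.
Qed.

End coercivity.

(** * Minimizing sequences *)

Lemma equimeasurableN d (T : measurableType d) (R : realType)
    (mu : {measure set T -> \bar R}) (D : set T) (f g : T -> R) :
  measurable D -> (mu D < +oo)%E -> measurable_fun D f ->
  equimeasurable mu D f g -> equimeasurable mu D (fun x => - f x) (fun x => - g x).
Proof.
move=> mD Doo mf fg; have [mg _] := fg; split; first exact: measurableT_comp.
move=> t; pose h (r : R) := (\1_[set r : R | t < - r] r)%:E : \bar R.
have mt : measurable [set r : R | t < - r].
  rewrite (_ : [set r : R | t < - r] = `]-oo, (- t)[%classic); first exact: measurable_itv.
  by apply/seteqP; split => r /=; rewrite in_itv/= ltrNr.
have hE (k : T -> R) : measurable_fun D k ->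
    (\int[mu]_(x in D) h (k x) = mu (D `&` [set x | (t < - k x)%R]))%E.
  move=> mk; rewrite /h.
  have mDk : measurable (D `&` [set x | t < - k x]).
    exact: (mk mD _ mt).
  transitivity (\int[mu]_(x in D) (\1_(D `&` [set x | (t < - k x)%R]) x)%:E)%E.
    apply: eq_integral => x xD; rewrite !indicE; congr (_%:R)%:E.
    by rewrite in_setI xD.
  by rewrite integral_indic// setIAC setIid.
rewrite -!hE//; apply: (equimeasurable_integral mD Doo mf fg) => //.
  by apply/measurable_EFinP; exact: measurable_indic.
by move=> r; rewrite /h lee_fin.
Qed.

Lemma energy_scale d (T : measurableType d) (R : realType)
    (mu : {sigma_finite_measure set T -> \bar R}) (K : T -> T -> R) (u : T -> R) (a : R) :
  (forall x y, 0 <= K x y) -> measurable_fun setT (fun z : T * T => K z.1 z.2) ->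
  measurable_fun setT u ->
  energy mu K (fun x => a * u x) = ((a ^+ 2)%:E * energy mu K u)%E.
Proof.
move=> K0 mK mu_; rewrite /energy -ge0_integralZl//; first last.
- by rewrite lee_fin sqr_ge0.
- by move=> y _; apply: integral_ge0 => x _; rewrite lee_fin energy_density_ge0.
- exact: measurable_partial_energy.
apply: eq_integral => y _; rewrite -ge0_integralZl//; first last.
- by rewrite lee_fin sqr_ge0.
- by move=> x _; rewrite lee_fin energy_density_ge0.
- exact: measurable_slice.
apply: eq_integral => x _; rewrite -EFinM /energy_density -mulrBr normrM exprMn.
by rewrite (real_normK (num_real a)) -mulrA.
Qed.

Section minimization.
Context {R : realType} {N : nat}.
Variables (s q M : R) (Omega : set 'rV[R]_N).
Hypotheses (N1 : (0 < N)%N) (s0 : 0 < s) (M0 : 0 < M) (q1 : 1 < q)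
  (qs : N%:R / (2 * s) < q).
Hypothesis OM : forall x, Omega x -> forall i, `|x 0 i| < M.
Hypothesis mO : measurable Omega.

Local Notation mu := (@lebesgue_rV R N).
Local Notation K := (frac_kernel s).
Local Notation I g u := (\int[mu]_(x in Omega) (g x * `|u x| ^+ 2)).

Lemma integrable_form_H0s (g u : 'rV[R]_N -> R) (W : R) :
  measurable_fun Omega g -> (normOn Omega q g <= W%:E)%E ->
  supported Omega u -> (energy mu K u < +oo)%E ->
  mu.-integrable Omega (fun x => (g x * `|u x| ^+ 2)%:E).
Proof.
move=> mg gW su uoo; have [Z [z z0 [mZ ZB muZ ZM]]] := cube_zero_set N1 M0.
have E0 : 0 <= fine (energy mu K u) by exact/fine_ge0/energy_ge0.
have W0 : 0 <= W by rewrite -lee_fin; apply: le_trans gW; exact: normOn_ge0.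
apply: (integrable_form s0 M0 q1 qs OM mO z0 mZ ZB muZ ZM mg gW W0 su E0).
by rewrite fineK// ge0_fin_numE ?energy_ge0.
Qed.

(** The distances [4 ^- j] of [energy_compactness] are balanced in
    [quadratic_form_close] against [t = 2 ^- j]. The constant depends on the weight
    only through a bound on its L^q norm. *)
Lemma forms_compactness (u : nat -> 'rV[R]_N -> R) (E : R) : 0 <= E ->
  (forall n, supported Omega (u n)) -> (forall n, (energy mu K (u n) <= E%:E)%E) ->
  exists (k : nat -> nat) v,
  [/\ forall j, (j <= k j)%N, H0s s Omega v,
      (energy mu K v <= limn_einf (fun j => energy mu K (u (k j))))%E &
      forall W : R, 0 <= W -> exists2 D : R, 0 <= D & forall (g : 'rV[R]_N -> R) j, measurable_fun Omega g ->
        (normOn Omega q g <= W%:E)%E ->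
        `|I g (u (k j)) - I g v| <= D * 2^-1 ^+ j].
Proof.
move=> E0 su uE; have [Z [z z0 [mZ ZB muZ ZM]]] := cube_zero_set N1 M0.
have OB := cube_dom_sub OM.
have ZO x : Z x -> ~ Omega x by move=> Zx Ox; apply: (ZM x Zx); exact: OM.
have zZ : (z%:E <= mu Z)%E by rewrite muZ.
have [k [v [kj mv v0 vE cvg]]] := @energy_compactness _ _ _ mu K
  (@frac_kernel_ge0 R N s) (measurable_frac_kernel s)
  (cube_grid s0 M0 (lt_trans ltr01 q1) qs) Omega Z z E u mO OB mZ ZB ZO z0 zZ E0
  (fun n => (su n).1) uE (fun n => (su n).2).
have sv : supported Omega v by split => //; apply/aeW => x; exact: v0.
have vE' : (energy mu K v <= E%:E)%E.
  by apply: le_trans vE _; apply: (@limn_einf_le _ _ _ 0%N) => n _; exact: uE.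
have Hv : H0s s Omega v.
  apply: (supported_H0s s0 M0 q1 qs OM mO z0 mZ ZB muZ ZM sv).
  by rewrite (le_lt_trans vE')// ltry.
exists k, v; split => // W W0.
pose c := (4 * M) `^ (- (N%:R / q)).
have c0 : 0 <= c by exact: powR_ge0.
pose F := form_cst (cube_grid s0 M0 (lt_trans ltr01 q1) qs) z * (W * c) * E.
have F0 : 0 <= F by rewrite !mulr_ge0// form_cst_ge0.
exists (W * c + 2 * F); first by rewrite addr_ge0// mulr_ge0.
move=> g j mg gW; have t0 : 0 < (2^-1 : R) ^+ j by rewrite exprn_gt0.
have Wc0 : 0 <= W * c by rewrite mulr_ge0.
have wW := weight_rV s0 M0 q1 qs mO mg gW.
have := @form_close R N s q M Omega s0 M0 q1 qs OM mO Z z z0 mZ ZB muZ ZM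
  g _ v W E _ _ mg gW W0 (su (k j)) sv E0
  (uE (k j)) vE' t0 (cvg j _ _ Wc0 wW).
move=> /le_trans; apply; rewrite -/c -/F [leRHS]mulrDl lerD//; last by rewrite mulrC.
have -> : (4^-1 : R) = 2^-1 * 2^-1 by field.
rewrite exprMn le_eqVlt; apply/orP; left; apply/eqP.
by move: (2^-1 ^+ j) t0 => t t0; field; rewrite gt_eqF.
Qed.

(** The bathtub principle for [v^2], with a coordinate function breaking the ties. *)
Lemma maximal_rearrangement (g0 v : 'rV[R]_N -> R) (W : R) : measurable_fun Omega g0 ->
  (normOn Omega q g0 <= W%:E)%E -> supported Omega v -> (energy mu K v < +oo)%E ->
  exists2 g, equimeasurable mu Omega g0 g &
    forall h, equimeasurable mu Omega g0 h -> I h v <= I g v.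
Proof.
move=> mg0 gW sv voo; have [i hi] := lebesgue_rV_hyperplane R N1.
have [m muO] := mu_Omega_fin s0 M0 q1 qs OM mO.
have Ooo : (mu Omega < +oo)%E by rewrite [X in (X < _)%E]muO ltry.
have mv2 : measurable_fun Omega (fun x => `|v x| ^+ 2).
  case: sv => mv _; apply: measurable_funX; apply: measurableT_comp.
    exact: normr_measurable.
  exact: measurable_funTS.
have mp : measurable_fun Omega (fun x : 'rV[R]_N => x 0 i).
  by apply: measurable_funTS; exact: measurable_coord.
have pc (c : R) : mu (Omega `&` [set x | x 0 i = c]) = 0%E.
  have mH : measurable [set x : 'rV[R]_N | x 0 i = c].
    rewrite (_ : [set x | _] = (fun x : 'rV[R]_N => x 0 i) @^-1` [set c])//.
    by rewrite -[X in measurable X]setTI; apply: measurable_coord.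
  apply/eqP; rewrite eq_le measure_ge0 andbT -(hi c).
  by apply: le_measure; rewrite ?inE//; exact: measurableI.
have v2 (x : 'rV[R]_N) : Omega x -> 0 <= `|v x| ^+ 2 by move=> _; exact: exprn_ge0.
have ig0 := integrable_Lq s0 M0 q1 qs OM mO mg0 gW.
have [g eg gmax] := bathtub mO Ooo mv2 v2 mp pc ig0.
have ig h : equimeasurable mu Omega g0 h ->
    mu.-integrable Omega (fun x => (h x * `|v x| ^+ 2)%:E).
  move=> eh; have [mh _] := eh; apply: (@integrable_form_H0s _ _ W) => //.
  rewrite (_ : normOn Omega q h = normOn Omega q g0)//.
  exact: (normOn_equimeasurable s0 M0 q1 qs OM mO (@measurable_id _ _ setT) mg0 eh).
exists g => // h eh; apply: fine_le.
- exact: (integrable_fin_num mO (ig h eh)).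
- exact: (integrable_fin_num mO (ig g eg)).
exact: (gmax h eh (ig h eh) (ig g eg)).
Qed.

(** The bathtub principle for [- V0]. *)
Lemma minimal_rearrangement (V0 v : 'rV[R]_N -> R) (W : R) : measurable_fun Omega V0 ->
  (normOn Omega q V0 <= W%:E)%E -> supported Omega v -> (energy mu K v < +oo)%E ->
  exists2 V, equimeasurable mu Omega V0 V &
    forall h, equimeasurable mu Omega V0 h -> I V v <= I h v.
Proof.
move=> mV0 VW sv voo; have [m muO] := mu_Omega_fin s0 M0 q1 qs OM mO.
have Ooo : (mu Omega < +oo)%E by rewrite [X in (X < _)%E]muO ltry.
have mN : measurable_fun Omega (fun x => - V0 x).
  by apply: measurableT_comp; [exact: oppr_measurable|exact: mV0].
have NE (h : 'rV[R]_N -> R) : normOn Omega q (fun x => - h x) = normOn Omega q h.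
  rewrite !(normOnE _ _ (lt_trans ltr01 q1)); congr (_ `^ _)%E.
  by apply: eq_integral => x _; rewrite normrN.
have NW : (normOn Omega q (fun x => (- V0 x)%R) <= W%:E)%E by rewrite NE.
have [g eg gmax] := maximal_rearrangement mN NW sv voo.
have eV : equimeasurable mu Omega V0 (fun x => - g x).
  have := equimeasurableN mO Ooo mN eg.
  by rewrite (_ : (fun x => - - V0 x) = V0)//; apply/funext => x; rewrite opprK.
exists (fun x => - g x) => // h eh.
have eNh := equimeasurableN mO Ooo mV0 eh.
have NI k : equimeasurable mu Omega V0 k -> I (fun x => - k x) v = - I k v.
  move=> ek; have [mk _] := ek; rewrite -[RHS]mulN1r -RintegralZl//; last first.
    apply: (@integrable_form_H0s _ _ W) => //.
    rewrite (_ : normOn Omega q k = normOn Omega q V0)//.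
    exact: (normOn_equimeasurable s0 M0 q1 qs OM mO (@measurable_id _ _ setT) mV0 ek).
  by apply: eq_Rintegral => x _; rewrite mulN1r mulNr.
rewrite -[leLHS]opprK -(NI _ eV) -[leRHS]opprK -(NI _ eh) lerN2.
rewrite (_ : I (fun x => - - g x) v = I g v); first exact: gmax.
by apply: eq_Rintegral => x _; rewrite opprK.
Qed.

Variables (g0 V0 : 'rV[R]_N -> R) (delta Wg WV : R).
Hypotheses (mg0 : measurable_fun Omega g0) (mV0 : measurable_fun Omega V0).
Hypotheses (gW : (normOn Omega q g0 <= Wg%:E)%E) (VW : (normOn Omega q V0 <= WV%:E)%E).
Hypotheses (delta0 : 0 < delta) (delta_lt : delta < frac_laplacian_cst N s / 2).
Hypothesis V0_neg : (normOn Omega q (V0^\-)%R <=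
  ((frac_laplacian_cst N s / 2 - delta)
    / embedding_cst s Omega (2 * (q / (q - 1))) ^+ 2)%:E)%E.
Local Notation c := (frac_laplacian_cst N s / 2).

Lemma normOn_rearrangement f g : measurable_fun Omega f -> equimeasurable mu Omega f g ->
  normOn Omega q g = normOn Omega q f.
Proof.
move=> mf fg.
exact: (normOn_equimeasurable s0 M0 q1 qs OM mO (@measurable_id _ _ setT) mf fg).
Qed.

Lemma integrable_rearrangement f g u (W : R) : measurable_fun Omega f ->
  (normOn Omega q f <= W%:E)%E -> equimeasurable mu Omega f g ->
  supported Omega u -> (energy mu K u < +oo)%E ->
  mu.-integrable Omega (fun x => (g x * `|u x| ^+ 2)%:E).
Proof.
move=> mf fW fg su uoo; apply: (@integrable_form_H0s _ _ W fg.1) => //.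
by rewrite (normOn_rearrangement mf fg).
Qed.

(** The L^q norm of the negative part is the same for all rearrangements of [V0]. *)
Lemma coercive V u : equimeasurable mu Omega V0 V -> H0s s Omega u ->
  delta * fine (energy mu K u) <= c * fine (energy mu K u) + I V u.
Proof.
move=> eV Hu; have [su uoo] := H0s_supported Hu; have [mV _] := eV.
have a0 : 0 <= c - delta by rewrite subr_ge0 ltW.
have iV := integrable_rearrangement mV0 VW eV su uoo.
have Vn : (normOn Omega q (V^\-)%R <=
    ((c - delta) / embedding_cst s Omega (2 * (q / (q - 1))) ^+ 2)%:E)%E.
  apply: le_trans V0_neg; rewrite le_eqVlt; apply/orP; left; apply/eqP.
  apply: (normOn_equimeasurable s0 M0 q1 qs OM mO (phi := fun r => Num.max (- r) 0) _ mV0 eV).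
  by apply: measurable_maxr => //; exact: oppr_measurable.
have := form_lower mO q1 a0 mV Hu iV Vn.
by rewrite mulrBl; lra.
Qed.

(** Numerator and denominator are both quadratic, so that dividing [u] by the square
    root of [I g u] leaves the ratio unchanged. *)
Lemma normalize g V u (L : R) : equimeasurable mu Omega g0 g ->
  equimeasurable mu Omega V0 V -> H0s s Omega u -> 0 < I g u ->
  (c * fine (energy mu K u) + I V u) / I g u <= L ->
  exists w, [/\ supported Omega w, (energy mu K w <= (L / delta)%:E)%E, I g w = 1 &
    c * fine (energy mu K w) + I V w <= L].
Proof.
move=> eg eV Hu Ig0 ratio; have [su uoo] := H0s_supported Hu; have [mu_ uO] := su.
have coer := coercive eV Hu.
have ig := integrable_rearrangement mg0 gW eg su uoo.
have iV := integrable_rearrangement mV0 VW eV su uoo.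
pose a := (Num.sqrt (I g u))^-1.
have a2 : a ^+ 2 = (I g u)^-1 by rewrite exprVn sqr_sqrtr// ltW.
pose w x := a * u x.
have Ew : energy mu K w = ((I g u)^-1 * fine (energy mu K u))%:E.
  rewrite /w energy_scale//; [|exact: frac_kernel_ge0|exact: measurable_frac_kernel].
  by rewrite a2 EFinM fineK// ge0_fin_numE ?energy_ge0.
have Iw h : mu.-integrable Omega (fun x => (h x * `|u x| ^+ 2)%:E) ->
    I h w = (I g u)^-1 * I h u.
  move=> ih; rewrite -a2 -RintegralZl//; apply: eq_Rintegral => x _.
  by rewrite /w normrM exprMn (real_normK (num_real a)) mulrCA.
exists w; split.
- split; first by apply: measurable_funM => //.
  by apply: (filterS _ uO) => x h Ox; rewrite /w h// mulr0.
- rewrite Ew lee_fin ler_pdivlMr// mulrC mulrA -mulrA mulrCA; apply: le_trans ratio.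
  by rewrite [leRHS]mulrC ler_pM2l ?invr_gt0.
- by rewrite Iw// mulVf// gt_eqF.
- rewrite Ew/= Iw//; apply: le_trans ratio; rewrite mulrCA -mulrDr.
  by rewrite mulrC.
Qed.

(** The weights [g_ n] and [V_ n] of the minimizing sequence are compared at the
    limit [v] with the extremal rearrangements for [v]. *)
Lemma minimizer (L : R) : 0 <= L ->
  (forall n, exists g V u, [/\ equimeasurable mu Omega g0 g, equimeasurable mu Omega V0 V,
    H0s s Omega u, 0 < I g u &
    (c * fine (energy mu K u) + I V u) / I g u <= L + n.+1%:R^-1]) ->
  exists g V u, [/\ equimeasurable mu Omega g0 g, equimeasurable mu Omega V0 V,
    H0s s Omega u, 0 < I g u & (c * fine (energy mu K u) + I V u) / I g u <= L].
Proof.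
move=> L0 near_min.
have c0 : 0 < c by exact: lt_trans delta_lt.
have /choice[p pP] n : exists p : ('rV[R]_N -> R) * ('rV[R]_N -> R) * ('rV[R]_N -> R),
    [/\ equimeasurable mu Omega g0 p.1.1, equimeasurable mu Omega V0 p.1.2,
      supported Omega p.2 /\ (energy mu K p.2 <= ((L + 1) / delta)%:E)%E, I p.1.1 p.2 = 1 &
      c * fine (energy mu K p.2) + I p.1.2 p.2 <= L + n.+1%:R^-1].
  have [g [V [u [eg eV Hu Ig ratio]]]] := near_min n.
  have [w [sw Ew Igw wL]] := normalize eg eV Hu Ig ratio.
  exists (g, V, w); split => //=; split => //; apply: le_trans Ew _.
  by rewrite lee_fin ler_pM2r ?invr_gt0// lerD2l invf_le1// ler1n.
pose g_ n := (p n).1.1; pose V_ n := (p n).1.2; pose w n := (p n).2.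
have E0 : 0 <= (L + 1) / delta by rewrite divr_ge0 ?(ltW delta0)// addr_ge0.
have sw n : supported Omega (w n) by have [_ _ []] := pP n.
have wE n : (energy mu K (w n) <= ((L + 1) / delta)%:E)%E by have [_ _ []] := pP n.
have [k [v [kj Hv vE close]]] := forms_compactness E0 sw wE.
have [sv voo] := H0s_supported Hv.
have Wg0 : 0 <= Wg by rewrite -lee_fin; apply: le_trans gW; exact: normOn_ge0.
have WV0 : 0 <= WV by rewrite -lee_fin; apply: le_trans VW; exact: normOn_ge0.
have [Dg Dg0 closeg] := close _ Wg0; have [DV DV0 closeV] := close _ WV0.
have [gs eg gmax] := maximal_rearrangement mg0 gW sv voo.
have [Vs eV Vmin] := minimal_rearrangement mV0 VW sv voo.
have hb : 0 < (2^-1 : R) < 1 by apply/andP; split; lra.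
have gj_form j : 1 <= I gs v + Dg * 2^-1 ^+ j.
  have [egj _ _ Ig _] := pP (k j).
  have gjW : (normOn Omega q (g_ (k j)) <= Wg%:E)%E.
    by rewrite (normOn_rearrangement mg0 egj).
  have := closeg _ j egj.1 gjW; rewrite Ig ler_distl => /andP[_ /le_trans]; apply.
  by rewrite lerD2r; exact: gmax.
have Ig1 : 1 <= I gs v.
  apply/ler_addgt0Pr => e e0; have [j hj] := geometric_small Dg hb e0.
  by apply: le_trans (gj_form j) _; rewrite lerD2l.
have arith (A a b x y i D : R) : a - D <= b -> i <= a -> A + b <= L + x -> x <= y ->
    A <= L + y - i + D by lra.
have Vj_form j : c * fine (energy mu K (w (k j))) <=
    L + (j.+1)%:R^-1 - I Vs v + DV * 2^-1 ^+ j.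
  have [_ eVj _ _ ratio] := pP (k j).
  have VjW : (normOn Omega q (V_ (k j)) <= WV%:E)%E.
    by rewrite (normOn_rearrangement mV0 eVj).
  have h1 : I (V_ (k j)) v - DV * 2^-1 ^+ j <= I (V_ (k j)) (w (k j)).
    by have := closeV (V_ (k j)) j eVj.1 VjW; rewrite ler_distl => /andP[].
  have h2 : I Vs v <= I (V_ (k j)) v := Vmin _ eVj.
  have h3 : c * fine (energy mu K (w (k j))) + I (V_ (k j)) (w (k j)) <=
    L + (k j).+1%:R^-1 := ratio.
  have h4 : ((k j).+1)%:R^-1 <= (j.+1)%:R^-1 :> R by rewrite lef_pV2 ?posrE// ler_nat ltnS.
  exact: arith h1 h2 h3 h4.
have fE u : (energy mu K u <= ((L + 1) / delta)%:E)%E ->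
    energy mu K u = (fine (energy mu K u))%:E.
  move=> uE; apply/esym/fineK; rewrite (ge0_fin_numE (energy_ge0 s u)).
  exact: le_lt_trans uE (ltry _).
have Ev : c * fine (energy mu K v) + I Vs v <= L.
  apply/ler_addgt0Pr => e e0; have e2 : 0 < e / 2 by rewrite divr_gt0.
  have [n1 hn1] := geometric_small DV hb e2.
  pose n2 := Num.truncn (e / 2)^-1.
  rewrite -lerBrDr -ler_pdivlMl// -lee_fin fineK; last first.
    by rewrite ge0_fin_numE ?energy_ge0.
  apply: le_trans vE _; apply: (@limn_einf_le _ _ _ (maxn n1 n2)) => j.
  rewrite geq_max => /andP[n1j n2j].
  rewrite (fE _ (wE _)) lee_fin ler_pdivlMl//; apply: le_trans (Vj_form j) _.
  have h1 : DV * 2^-1 ^+ j <= e / 2.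
    by apply: le_trans hn1; rewrite ler_wpM2l// ler_wiXn2l//; lra.
  have h2 : (j.+1)%:R^-1 <= e / 2.
    rewrite -[e / 2]invrK lef_pV2 ?posrE ?invr_gt0//.
    by apply: ltW; apply: lt_le_trans (truncnS_gt _) _; rewrite ler_nat ltnS.
  have sum_le (l i a b r : R) : a <= r / 2 -> b <= r / 2 -> l + b - i + a <= l + r - i.
    by lra.
  exact: sum_le h1 h2.
have Igs0 : 0 < I gs v by exact: lt_le_trans Ig1.
exists gs, Vs, v; split => //; rewrite ler_pdivrMr//; apply: le_trans Ev _.
by rewrite ler_peMr.
Qed.

End minimization.

Theorem theorem1p1 (R : realType) (N : nat) (s q : R) (Omega : set 'rV[R]_N)
    (g0 V0 : 'rV[R]_N -> R) (delta : R)
    (N_ge2 : (2 <= N)%N)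
    (s_bounds : 0 < s < 1)
    (Omega_domain : smooth_bounded_domain Omega)
    (q_gt : N%:R / (2 * s) < q)
    (g0_Lq : LpOn Omega q g0)
    (V0_Lq : LpOn Omega q V0)
    (g0_pos : ~ {ae lebesgue_rV, forall x, Omega x -> g0^\+ x = 0})
    (delta_bounds : 0 < delta < frac_laplacian_cst N s / 2)
    (V0_neg : (normOn Omega q (V0^\-)%R <=
      ((frac_laplacian_cst N s / 2 - delta)
        / embedding_cst s Omega (2 * (q / (q - 1))) ^+ 2)%:E)%E) :
  exists g V : 'rV[R]_N -> R,
    [/\ rearrangements Omega g0 g,
        rearrangements Omega V0 V &
        lambda1 s Omega g V = lambda1_min s Omega g0 V0].
Proof.
have /andP[s0 s1] := s_bounds; have /andP[delta0 delta_lt] := delta_bounds.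
have N1 : (0 < N)%N by exact: leq_trans N_ge2.
have q1 : 1 < q.
  apply: le_lt_trans q_gt; rewrite ler_pdivlMr ?mulr_gt0// mul1r.
  have : (2 : R) <= N%:R by rewrite ler_nat.
  by lra.
have [_ oO _ bO _] := Omega_domain.
have [M M0 OM] := bounded_rV bO.
have mO : measurable Omega := open_measurable_rV s0 M0 q1 q_gt oO (cube_dom_sub OM).
have Lq f : LpOn Omega q f -> measurable_fun Omega f /\
    (normOn Omega q f <= (fine (normOn Omega q f))%:E)%E.
  move=> fq; split.
    by apply/(measurable_restrictT f mO); have := sub_Lfun_mfun fq; rewrite inE.
  have := sub_Lfun_finLfun fq; rewrite inE /finite_norm => foo.
  by rewrite fineK// ge0_fin_numE// Lnorm_ge0.
have [mg0 gW] := Lq g0 g0_Lq; have [mV0 VW] := Lq V0 V0_Lq.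
have min_le g V : rearrangements Omega g0 g -> rearrangements Omega V0 V ->
    (lambda1_min s Omega g0 V0 <= lambda1 s Omega g V)%E.
  by move=> eg eV; apply: ereal_inf_lbound; exists (g, V).
(* this case covers a class without any admissible test function *)
have [minoo|minoo] := eqVneq (lambda1_min s Omega g0 V0) +oo%E.
  exists g0, V0; split => //; rewrite minoo; apply/eqP; rewrite -leye_eq -minoo.
  exact: min_le.
have lambda1_ge0 g V : rearrangements Omega V0 V -> (0 <= lambda1 s Omega g V)%E.
  move=> eV; apply: le_ereal_inf_tmp => _ [u [Hu Ig] <-].
  rewrite lee_fin divr_ge0 ?(ltW Ig)// fine_gagliardo_sqr.
  apply: le_trans (coercive N1 s0 M0 q1 q_gt OM mO mV0 VW delta_lt V0_neg eV Hu).
  by rewrite mulr_ge0 ?(ltW delta0)// fine_ge0// energy_ge0.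
have min_ge0 : (0 <= lambda1_min s Omega g0 V0)%E.
  by apply: le_ereal_inf_tmp => _ [[g V] [_ eV] <-]; exact: lambda1_ge0.
have minE : lambda1_min s Omega g0 V0 = (fine (lambda1_min s Omega g0 V0))%:E.
  by rewrite fineK// ge0_fin_numE// lt_neqAle minoo leey.
set L := fine _ in minE.
have L0 : 0 <= L by rewrite fine_ge0.
have [n|g [V [u [eg eV Hu Ig uL]]]] := minimizer N1 s0 M0 q1 q_gt OM mO mg0 mV0 gW VW
    delta0 delta_lt V0_neg L0.
  have : (lambda1_min s Omega g0 V0 < (L + n.+1%:R^-1)%:E)%E.
    by rewrite minE lte_fin ltrDl invr_gt0.
  move=> /ereal_inf_lt[_ [[g V] [/= eg eV] <-]].
  move=> /ereal_inf_lt[_ [u [Hu Ig] <-]]; rewrite lte_fin fine_gagliardo_sqr => ratio.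
  by exists g, V, u; split => //; exact: ltW.
exists g, V; split => //; apply/eqP; rewrite eq_le min_le// andbT minE.
apply: (@le_trans _ _ (((frac_laplacian_cst N s / 2 * fine (gagliardo s u) ^+ 2
  + \int[lebesgue_rV]_(x in Omega) (V x * `|u x| ^+ 2))
  / \int[lebesgue_rV]_(x in Omega) (g x * `|u x| ^+ 2))%:E)).
  by apply: ereal_inf_lbound; exists u.
by rewrite fine_gagliardo_sqr lee_fin.
Qed.
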